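(* Let $\mu$ be a Poisson measure on $\mathbb{R}^d$. Then the following hold. (a) $\mu$ is a strongly almost periodic distribution if and only if $\mu$ is a translation-bounded distribution. (b) $\mu$ is a strongly almost periodic tempered distribution if and only if $\mu$ is a translation-bounded tempered distribution. (c) $\mu$ is a strongly almost periodic measure if and only if $\mu$ is a translation-bounded measure.
   Context: A measure on $\mathbb{R}^d$ is a complex Radon measure. A measure $\mu$ is tempered if there is a tempered distribution $T_\mu\in\mathcal{S}'(\mathbb{R}^d)$ with $\mu(\varphi)=T_\mu(\varphi)$ for all $\varphi\in C_c^\infty(\mathbb{R}^d)$; one identifies $\mu$ with $T_\mu$, and $\widehat\mu$ denotes the distributional Fourier transform of $T_\mu$, with $\widehat\varphi(k)=\int e^{-2\pi i k\cdot x}\varphi(x)\,dx$. A tempered distribution is said to be a measure if it agrees with some measure on $C_c^\infty(\mathbb{R}^d)$. A Poisson measure is a tempered measure $\mu$ such that both $\mu$ and $\widehat\mu$ are pure-point measures. For a functional $Y$ and a test function $\varphi$, $(Y*\varphi)(t)=\langle Y,\varphi(t-\cdot)\rangle$ for $t\in\mathbb{R}^d$. A measure (respectively distribution, respectively tempered distribution) $Y$ is translation bounded if $Y*\varphi$ is a bounded function for all $\varphi$ in $C_c(\mathbb{R}^d)$ (respectively $C_c^\infty(\mathbb{R}^d)$, respectively the Schwartz space $\mathcal{S}(\mathbb{R}^d)$), and strongly almost periodic if $Y*\varphi$ is a Bohr almost periodic function for all $\varphi$ in the same test function space. A continuous bounded function is Bohr almost periodic if, for every $\varepsilon>0$, its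 set of $\varepsilon$-almost periods in the sup norm is relatively dense. *)

(* Defs.v *)
From HB Require Import structures.
From mathcomp Require Import all_boot all_order all_algebra.
From mathcomp Require Import all_classical all_reals all_analysis.
From mathcomp Require Import summability complex.

Set Implicit Arguments.
Unset Strict Implicit.
Unset Printing Implicit Defensive.
Import Order.TTheory GRing.Theory Num.Theory.
Import numFieldNormedType.Exports.

Local Open Scope classical_set_scope.
Local Open Scope ring_scope.

(* [Rcomplex R] is the alias of [R[i]] that carries the R-valued modulus and
   the structure of a vector space over R; its norm makes it a normed module
   over R, so that [continuous] and ['D_v f] apply to complex-valued functions
   of a real vector variable. *)
Section Rcomplex_normedModType.
Variable R : realType.

HB.instance Definition _ :=
  PseudoMetric.copy (Rcomplex R) (pseudoMetric_normed (Rcomplex R)).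

HB.instance Definition _ := isPointed.Build (Rcomplex R) 0.

HB.instance Definition _ :=
  NormedZmod_PseudoMetric_eq.Build R (Rcomplex R) erefl.

Let Rcomplex_normrZ (l : R) (x : Rcomplex R) : `|l *: x| = `|l| * `|x|.
Proof.
case: x => a b; rewrite /Num.norm /=.
by rewrite !exprMn -mulrDr sqrtrM ?sqr_ge0// sqrtr_sqr.
Qed.

HB.instance Definition _ :=
  PseudoMetricNormedZmod_Lmodule_isNormedModule.Build R (Rcomplex R)
    Rcomplex_normrZ.

End Rcomplex_normedModType.

(* Lebesgue measure on R^n, as the n-fold product of the Lebesgue measure on R,
   carried by the measurable type of n-tuples. *)
Section lebesgue_tuple.
Variable R : realType.
Local Notation RM := (measurableTypeR R).

Section step.
Variables (n : nat) (m : {sigma_finite_measure set (n.-tuple RM) -> \bar R}).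

Definition tcons (p : RM * n.-tuple RM) : n.+1.-tuple RM :=
  [tuple of p.1 :: p.2].

Let measurable_tcons : measurable_fun [set: RM * n.-tuple RM] tcons.
Proof. exact: measurable_cons. Qed.

Definition lebesgue_tupleS : set (n.+1.-tuple RM) -> \bar R :=
  pushforward (product_measure1 lebesgue_measure m) tcons.

Let lebesgue_tupleS0 : lebesgue_tupleS set0 = 0%E.
Proof. by rewrite /lebesgue_tupleS /pushforward preimage_set0 measure0. Qed.

Let lebesgue_tupleS_ge0 A : (0 <= lebesgue_tupleS A)%E.
Proof. exact: measure_ge0. Qed.

Let lebesgue_tupleS_sigma_additive : semi_sigma_additive lebesgue_tupleS.
Proof.
move=> F mF tF mUF; rewrite /lebesgue_tupleS /pushforward preimage_bigcup.
apply: measure_semi_sigma_additive.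
- by move=> k; rewrite -[X in measurable X]setTI; exact: measurable_tcons.
- apply/trivIsetP => /= i j _ _ ij; rewrite -preimage_setI.
  by move/trivIsetP : tF => /(_ _ _ _ _ ij) ->//; rewrite preimage_set0.
- rewrite -preimage_bigcup -[X in measurable X]setTI.
  exact: measurable_tcons.
Qed.

HB.instance Definition _ := isMeasure.Build _ _ _ lebesgue_tupleS
  lebesgue_tupleS0 lebesgue_tupleS_ge0 lebesgue_tupleS_sigma_additive.

Let lebesgue_tupleS_sigma_finite : sigma_finite setT lebesgue_tupleS.
Proof.
have /sigma_finiteP[F [FT ndF Foo]] := sigma_finiteT (@lebesgue_measure R).
have /sigma_finiteP[G [GT ndG Goo]] := sigma_finiteT m.
pose tuncons (t : n.+1.-tuple RM) : RM * n.-tuple RM :=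
  (tnth t ord0, [tuple of behead t]).
have mtuncons : measurable_fun setT tuncons.
  apply: measurable_fun_pair; first exact: measurable_tnth.
  exact: measurable_behead.
have tconsK : cancel tcons tuncons.
  by case=> x t; congr pair; apply/val_inj.
exists (fun i => tuncons @^-1` (F i `*` G i)).
  rewrite -preimage_bigcup (_ : \bigcup_i _ = setT) ?preimage_setT//.
  apply/seteqP; split=> // -[x t] _.
  have [i _ Fix] : (\bigcup_i F i) x by rewrite -FT.
  have [j _ Gjt] : (\bigcup_i G i) t by rewrite -GT.
  exists (maxn i j) => //; split => /=.
    by move: x Fix; exact/subsetPset/ndF/leq_maxl.
  by move: t Gjt; exact/subsetPset/ndG/leq_maxr.
move=> i; have [mF Fioo] := Foo i; have [mG Gioo] := Goo i; split.
  by rewrite -[X in measurable X]setTI; apply: mtuncons => //; exact: measurableX.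
rewrite /lebesgue_tupleS /pushforward (_ : _ @^-1` _ = F i `*` G i); last first.
  by apply/funext => p; rewrite /preimage/mkset tconsK.
rewrite product_measure1E//.
by apply: lte_mul_pinfty => //; rewrite ge0_fin_numE.
Qed.

HB.instance Definition _ := Measure_isSigmaFinite.Build _ _ _
  lebesgue_tupleS lebesgue_tupleS_sigma_finite.
End step.

Fixpoint lebesgue_tuple (n : nat) :
    {sigma_finite_measure set (n.-tuple RM) -> \bar R} :=
  if n is n'.+1 then lebesgue_tupleS (lebesgue_tuple n')
  else \d_[tuple].
End lebesgue_tuple.

(* Functionals are total functions [('rV[R]_d -> Rcomplex R) -> Rcomplex R]
   that are only meaningful on a class of test functions; every notion below
   evaluates them on the relevant class only. *)
Section measures_and_distributions.
Variables (R : realType) (d : nat).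
Local Notation C := (Rcomplex R).
Local Notation E := 'rV[R]_d.
Implicit Types (f g phi : E -> C) (x k t : E).

Definition cis (u : R) : C := (cos u +i* sin u)%C.

Definition dotp k x : R := \sum_(i < d) k ord0 i * x ord0 i.

Definition rV_of_tuple (y : d.-tuple (measurableTypeR R)) : E :=
  \row_i tnth y i.

Definition integral_rV (h : E -> R) : R :=
  Rintegral (lebesgue_tuple R d) setT (h \o rV_of_tuple).

Definition cintegral_rV f : C :=
  (integral_rV (fun x => complex.Re (f x)) +i*
   integral_rV (fun x => complex.Im (f x)))%C.

Definition fourier f : E -> C :=
  fun k => cintegral_rV (fun x => cis (- (2 * pi * dotp k x)) * f x).

Definition supp f : set E := closure [set x | f x != 0].

Definition supnorm f : R := sup (range (fun x => `|f x|)).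

Definition partial (i : 'I_d) f : E -> C := fun x => 'D_(delta_mx 0 i) f x.

Definition partials (s : seq 'I_d) f : E -> C := foldr partial f s.

Definition smooth f : Prop := forall s : seq 'I_d,
  continuous (partials s f) /\
  forall (i : 'I_d) x, derivable (partials s f) x (delta_mx 0 i).

Definition Cc : set (E -> C) := [set f | continuous f /\ compact (supp f)].

Definition Cc_smooth : set (E -> C) := [set f | smooth f /\ compact (supp f)].

Definition monomial (a : 'I_d -> nat) x : R := \prod_(i < d) x ord0 i ^+ a i.

Definition schwartz_term (a : 'I_d -> nat) (s : seq 'I_d) f : E -> C :=
  fun x => monomial a x *: partials s f x.

Definition schwartz : set (E -> C) := [set f | smooth f /\
  forall a s, bounded_fun (schwartz_term a s f)].

Definition functional := (E -> C) -> C.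
Implicit Types (mu nu T Y : functional).

Definition linear_on (S : set (E -> C)) Y : Prop :=
  forall (c : C) f g, S f -> S g ->
    Y (fun x => c * f x + g x) = c * Y f + Y g.

Definition agree_on (S : set (E -> C)) Y T : Prop :=
  forall phi, S phi -> Y phi = T phi.

Definition radon_measure mu : Prop := linear_on Cc mu /\
  forall K : set E, compact K -> exists M : R,
    forall phi, Cc phi -> supp phi `<=` K -> `|mu phi| <= M * supnorm phi.

(* The last clause is continuity for the topology of S(R^d) given by the
   seminorms [supnorm (schwartz_term a s _)]. *)
Definition tempered_distribution T : Prop := linear_on schwartz T /\
  forall f, schwartz f -> forall e : R, 0 < e ->
    exists N : nat, exists2 r : R, 0 < r & forall g, schwartz g ->
      (forall (a : 'I_d -> nat) (s : seq 'I_d),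
         (\sum_(i < d) a i <= N)%N -> (size s <= N)%N ->
         supnorm (schwartz_term a s (fun x => g x - f x)) < r) ->
      `|T g - T f| < e.

Definition tempered mu : Prop :=
  exists T, tempered_distribution T /\ agree_on Cc_smooth mu T.

(* T_mu; meaningful when [mu] is tempered, in which case its values on S(R^d)
   are determined by [mu], since C_c^oo(R^d) is dense in S(R^d). *)
Definition tempered_ext mu : functional :=
  xget (fun=> 0)
    [set T | tempered_distribution T /\ agree_on Cc_smooth mu T].

Definition fourier_dist T : functional := fun phi => T (fourier phi).

(* mu = \sum_x a(x) delta_x; the net of finite partial sums converges, so the
   sum is unconditional: for every compact K, a Radon measure of this form has
   \sum_(x in K) |a(x)| < +oo. *)
Definition pure_point mu : Prop := exists a : E -> C,
  forall phi, Cc phi ->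
    partial_sum (fun x => a x * phi x) A @[A --> totally] --> mu phi.

Definition pure_point_measure mu : Prop := radon_measure mu /\ pure_point mu.

Definition poisson_measure mu : Prop :=
  [/\ pure_point_measure mu, tempered mu &
      exists2 nu, pure_point_measure nu &
        agree_on Cc_smooth (fourier_dist (tempered_ext mu)) nu].

Definition conv Y phi : E -> C := fun t => Y (fun x => phi (t - x)).

Definition relatively_dense (P : set E) : Prop :=
  exists2 r : R, 0 < r & forall x, P `&` ball x r !=set0.

Definition almost_period f (e : R) : set E :=
  [set t | supnorm (fun x => f (x - t) - f x) <= e].

Definition bohr_almost_periodic f : Prop :=
  [/\ continuous f, bounded_fun f &
      forall e : R, 0 < e -> relatively_dense (almost_period f e)].

Definition translation_bounded (S : set (E -> C)) Y : Prop :=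
  forall phi, S phi -> bounded_fun (conv Y phi).

Definition strongly_almost_periodic (S : set (E -> C)) Y : Prop :=
  forall phi, S phi -> bohr_almost_periodic (conv Y phi).

End measures_and_distributions.

(* Main.v *)
(* For the nontrivial directions let T be the tempered extension of mu. If h is
   smooth with compact support, then t |-> T(F(e^(-2 pi i <., t>) h)) is the sum
   \sum_k a(k) h(k) e^(-2 pi i <k, t>) over the atoms of F T in the support of h;
   this sum converges unconditionally, hence absolutely, so it is a uniform limit
   of trigonometric polynomials. For phi in S and psi = F g with g smooth of
   compact support and \int psi = 1, the function
   phi_r(x) = \int phi(x - r z) psi(z) dz is the Fourier transform of such an h,
   so T * phi_r is a uniform limit of trigonometric polynomials. When f = T * phi
   and its first derivatives T * (partial_i phi) are bounded, f is Lipschitz and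
   (T * phi_r)(t) = \int f(t - r z) psi(z) dz differs from f(t) by O(r) uniformly
   in t; hence f is a uniform limit of trigonometric polynomials too. For measures,
   a gliding hump argument bounds mu * phi uniformly by the supremum norm of phi on
   test functions with support in a fixed ball, and continuous test functions are
   uniform limits of smooth ones. *)
Require Import Defs.
From mathcomp Require Import all_boot all_order all_algebra.
From mathcomp Require Import all_classical all_reals all_analysis.
From mathcomp Require Import measurable_realfun summability complex ring lra finmap.

Set Implicit Arguments.
Unset Strict Implicit.
Unset Printing Implicit Defensive.
Import Order.TTheory GRing.Theory Num.Theory.
Import numFieldNormedType.Exports.

Local Open Scope classical_set_scope.
Local Open Scope ring_scope.

(** * Complex-valued functions *)

(** The mollifier is band-limited, the Fourier transform of some [g] of compact support, because the
    spectral measure is only tested on functions of compact support; a compactly supported mollifier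
    would not confine the spectrum. It must have nonzero integral, and [fourier_unit_integral] gets
    this from the multiplication formula and positivity instead of the inversion theorem. The
    delicate identity is that T * phi_r equals the integral of f(t - r z) psi(z): T has to pass
    under an integral, and it is continuous only for the Schwartz topology. Quadrature sums with
    error O(1/n) in every seminorm at once provide this. Derivatives of f are convolutions of T with
    partial derivatives of phi. The two smooth test classes are closed under differentiation, so
    translation boundedness alone makes f Lipschitz. [Cc] has no such closure: for measures one must
    approximate phi by smooth functions, which helps only if mu * phi is controlled by the supremum
    norm uniformly in the translate. That is the purpose of the gliding hump. *)

Section complex_values.
Variable R : realType.
Local Notation C := (Rcomplex R).
Implicit Types (z w : C).

Definition cre (z : C) : R := complex.Re z.
Definition cim (z : C) : R := complex.Im z.

Lemma RcomplexE z : z = (cre z +i* cim z)%C. Proof. by case: z. Qed.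

Lemma Rcomplex_normE z : `|z| = Num.sqrt (cre z ^+ 2 + cim z ^+ 2).
Proof. by case: z. Qed.

Lemma cre_le z : `|cre z| <= `|z|.
Proof. by rewrite Rcomplex_normE -sqrtr_sqr ler_wsqrtr// lerDl sqr_ge0. Qed.

Lemma cim_le z : `|cim z| <= `|z|.
Proof. by rewrite Rcomplex_normE -sqrtr_sqr ler_wsqrtr// lerDr sqr_ge0. Qed.

Lemma cnorm_le z : `|z| <= `|cre z| + `|cim z|.
Proof.
rewrite Rcomplex_normE -[leRHS]ger0_norm ?addr_ge0// -sqrtr_sqr ler_wsqrtr//.
by rewrite sqrrD !real_normK ?num_real// -addrA lerD2l addrC lerDl mulrn_wge0// mulr_ge0.
Qed.

Lemma cnormM z w : `|(z * w : C)| = `|z| * `|w|.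
Proof. exact: Normc.normcM. Qed.

Lemma creD z w : cre (z + w) = cre z + cre w. Proof. by case: z; case: w. Qed.
Lemma cimD z w : cim (z + w) = cim z + cim w. Proof. by case: z; case: w. Qed.
Lemma creN z : cre (- z) = - cre z. Proof. by case: z. Qed.
Lemma cimN z : cim (- z) = - cim z. Proof. by case: z. Qed.
Lemma creB z w : cre (z - w) = cre z - cre w. Proof. by rewrite creD creN. Qed.
Lemma cimB z w : cim (z - w) = cim z - cim w. Proof. by rewrite cimD cimN. Qed.
Lemma creM z w : cre (z * w) = cre z * cre w - cim z * cim w.
Proof. by case: z; case: w. Qed.
Lemma cimM z w : cim (z * w) = cre z * cim w + cim z * cre w.
Proof. by case: z => a b; case: w => c e; rewrite /cim /cre/= . Qed.
Lemma creZ (a : R) z : cre (a *: z) = a * cre z. Proof. by case: z. Qed.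
Lemma cimZ (a : R) z : cim (a *: z) = a * cim z. Proof. by case: z. Qed.

(** Real scalars are turned into complex factors because [linear_on] and the product rule speak of
    complex products; [cofrM] returns to [*:]. *)
Definition cofr (a : R) : C := (a +i* 0)%C.

Lemma cofrM a z : cofr a * z = a *: z.
Proof. by case: z => x y; rewrite /cofr; congr Complex; ring. Qed.

Lemma cnorm_cofr a : `|cofr a| = `|a|.
Proof. by rewrite Rcomplex_normE/= expr0n addr0 sqrtr_sqr. Qed.

Lemma cis0 : cis (0 : R) = 1.
Proof. by rewrite /cis cos0 sin0. Qed.

Lemma cisD (a b : R) : cis (a + b) = cis a * cis b.
Proof. by rewrite /cis cosD sinD; congr Complex; ring. Qed.

Lemma cnorm_cis (a : R) : `|cis a| = 1.
Proof. by rewrite Rcomplex_normE/= cos2Dsin2 sqrtr1. Qed.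

Lemma conjC_cis (a : R) : cre (cis (- a)) = cre (cis a) /\ cim (cis (- a)) = - cim (cis a).
Proof. by rewrite /cis /= cosN sinN. Qed.

Section limits.
Context {T : Type} {F : set_system T} {FF : Filter F}.
Implicit Types f g : T -> C.

Lemma cvgCP f (l : C) : f @ F --> l <->
  (cre (f x) @[x --> F] --> cre l) /\ (cim (f x) @[x --> F] --> cim l).
Proof.
split=> [/cvgrPdist_le fl|[/cvgrPdist_le fr /cvgrPdist_le fi]].
  split; apply/cvgrPdist_le => e e0; have := fl _ e0; apply: filterS => x;
    apply: le_trans.
  - by rewrite -creB; exact: cre_le.
  - by rewrite -cimB; exact: cim_le.
apply/cvgrPdist_le => e e0.
have e20 : 0 < e / 2 by rewrite divr_gt0.
apply: filterS2 (fr _ e20) (fi _ e20) => x hr hi.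
apply: (le_trans (cnorm_le _)); rewrite creB cimB (le_trans (lerD hr hi))//.
by rewrite -splitr.
Qed.

Lemma cvgCM f g (l m : C) : f @ F --> l -> g @ F --> m ->
  (fun x => f x * g x) @ F --> l * m.
Proof.
move=> /cvgCP[fr fi] /cvgCP[gr gi]; apply/cvgCP; split.
- under eq_fun do rewrite creM.
  by rewrite creM; exact: cvgB (cvgM fr gr) (cvgM fi gi).
- under eq_fun do rewrite cimM.
  by rewrite cimM; exact: cvgD (cvgM fr gi) (cvgM fi gr).
Qed.

End limits.

Lemma continuousCP {T : topologicalType} (f : T -> C) : continuous f <->
  continuous (fun x => cre (f x)) /\ continuous (fun x => cim (f x)).
Proof.
split=> [fc|[fr fi] x]; last by apply/cvgCP; split; [exact: fr|exact: fi].
by split=> x; have /cvgCP[] := fc x.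
Qed.

Lemma continuousCM {T : topologicalType} (f g : T -> C) :
  continuous f -> continuous g -> continuous (fun x => f x * g x).
Proof. by move=> fc gc x; apply: cvgCM; [exact: fc|exact: gc]. Qed.

Lemma cis_continuous : continuous (@cis R).
Proof.
apply/continuousCP; split; [exact: continuous_cos|exact: continuous_sin].
Qed.

Section derivatives.
Context {V : normedModType R}.
Implicit Types (f g : V -> C) (x v : V).

Lemma is_derive_CP f x v (l : C) : is_derive x v f l <->
  is_derive x v (fun y => cre (f y)) (cre l) /\
  is_derive x v (fun y => cim (f y)) (cim l).
Proof.
have E (W : normedModType R) (h : V -> W) (k : W) : is_derive x v h k <->
    (fun t : R => t^-1 *: (h (t *: v + x) - h x)) @ 0^' --> k.
  split=> [[dh <-]|hk]; first exact: dh.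
  by split; [apply/cvg_ex; exists k|apply/cvg_lim].
rewrite !E; split.
  move=> /cvgCP[]; under eq_fun do rewrite creZ creB.
  by under [X in _ -> X @ _ --> _ -> _]eq_fun do rewrite cimZ cimB.
move=> [h1 h2]; apply/cvgCP; split.
  by under eq_fun do rewrite creZ creB.
by under eq_fun do rewrite cimZ cimB.
Qed.

Lemma is_derive_cre f x v (l : C) : is_derive x v f l ->
  is_derive x v (fun y => cre (f y)) (cre l).
Proof. by move=> /is_derive_CP[]. Qed.

Lemma is_derive_cim f x v (l : C) : is_derive x v f l ->
  is_derive x v (fun y => cim (f y)) (cim l).
Proof. by move=> /is_derive_CP[]. Qed.

Lemma is_deriveCM f g x v (f' g' : C) : is_derive x v f f' -> is_derive x v g g' ->
  is_derive x v (fun y => f y * g y) (f' * g x + f x * g').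
Proof.
move=> /is_derive_CP[fr fi] /is_derive_CP[gr gi]; apply/is_derive_CP; split.
- under eq_fun do rewrite creM.
  apply: is_derive_eq; rewrite creD !creM /GRing.scale/=; ring.
- under eq_fun do rewrite cimM.
  apply: is_derive_eq; rewrite cimD !cimM /GRing.scale/=; ring.
Qed.

Lemma is_deriveCcst (c : C) x v : is_derive x v (fun=> c) 0.
Proof. exact: is_derive_cst. Qed.

Section line.
Variables (f : V -> C) (x v : V) (u : R) (l : C).

Let lineE : (fun h : R => h^-1 *: (f (h *: v + (x + u *: v)) - f (x + u *: v)))
  = (fun h : R => h^-1 *: (f (x + (h *: (1 : R) + u) *: v) - f (x + u *: v))).
Proof.
apply/funext => h; congr (_ *: (f _ - _)).
by rewrite (_ : h *: (1 : R) = h) ?scalerDl 1?addrCA// /GRing.scale/= mulr1.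
Qed.

(** By [lineE] the difference quotients on both sides are the same functions. The passage to a line
    makes the one-variable chain rule and mean value theorem available. *)
Lemma is_derive_to_line : is_derive (x + u *: v) v f l ->
  is_derive u (1 : R) (fun u => f (x + u *: v)) l.
Proof.
by move=> [d dl]; split; move: d dl; rewrite /derivable /derive/= lineE.
Qed.

Lemma is_derive_of_line : is_derive u (1 : R) (fun u => f (x + u *: v)) l ->
  is_derive (x + u *: v) v f l.
Proof.
by move=> [d dl]; split; move: d dl; rewrite /derivable /derive/= lineE.
Qed.

End line.

End derivatives.

End complex_values.

(** * Smooth functions *)

Section smooth_functions.
Variables (R : realType) (d : nat).
Local Notation C := (Rcomplex R).
Local Notation E := 'rV[R]_d.
Implicit Types (f g : E -> C) (x : E) (i j : 'I_d) (s : seq 'I_d).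

Definition dir i : E := delta_mx 0 i.

Lemma smooth_continuous f : smooth f -> continuous f.
Proof. by move=> /(_ [::])[]. Qed.

Lemma partials_rcons s i f : partials (rcons s i) f = partials s (partial i f).
Proof. by rewrite /partials foldr_rcons. Qed.

Lemma smooth_partial f i : smooth f -> smooth (partial i f).
Proof. by move=> fs s; rewrite -partials_rcons; exact: fs. Qed.

Lemma smooth_partials f s : smooth f -> smooth (partials s f).
Proof. by elim: s => //= i s ih /ih; exact: smooth_partial. Qed.

Lemma smooth_is_derive f x i : smooth f -> is_derive x (dir i) f (partial i f x).
Proof. by move=> /(_ [::])[_ /(_ i x)]/derivableP. Qed.

(** A coinduction principle: each [partial i] is forced to be the witness [g], so iterated
    derivatives never leave [P]. It serves classes that are visibly closed under differentiation,
    such as Fourier transforms and mollifications. *)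
Lemma smooth_coind (P : (E -> C) -> Prop) :
  (forall f, P f -> continuous f /\
    forall i, exists2 g, forall x, is_derive x (dir i) f (g x) & P g) ->
  forall f, P f -> smooth f.
Proof.
move=> PP f Pf s; have {Pf} : P (partials s f).
  elim: s => //= i s /PP[_ /(_ i)[g gd Pg]].
  suff -> : partial i (partials s f) = g by [].
  by apply/funext => x; rewrite /partial; have [_ ->] := gd x.
move=> /PP[fc fd]; split => // i x.
by have [g /(_ x)[]] := fd i.
Qed.

(** Differentiability of finite order, by recursion on the order: the derivative of a product is a
    sum of products, so induction on [n] proves stability where an induction on the list of
    directions in [smooth] would have to carry the whole Leibniz formula. *)
Fixpoint Cn (n : nat) f : Prop := continuous f /\
  if n is n'.+1 then
    forall i, exists2 g, forall x, is_derive x (dir i) f (g x) & Cn n' g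
  else True.

Lemma CnS n f : Cn n.+1 f -> Cn n f.
Proof.
elim: n f => [f []//|n ih f [fc fd]]; split=> // i.
by have [g gd Cg] := fd i; exists g => //; exact: ih.
Qed.

Lemma smooth_Cn f : smooth f <-> forall n, Cn n f.
Proof.
split=> [fs n|].
  elim: n f fs => [|n ih] f fs; split => //; do ?exact: smooth_continuous.
  move=> i; exists (partial i f) => [x|]; first exact: smooth_is_derive.
  exact/ih/smooth_partial.
move: f; apply: smooth_coind => f fn; split; first by have [] := fn 0%N.
move=> i; have [_ /(_ i)[g gd _]] := fn 1%N; exists g => // n.
have [_ /(_ i)[g' gd' Cg']] := fn n.+1.
suff -> : g = g' by [].
by apply/funext => x; have [_ <-] := gd x; have [_ <-] := gd' x.
Qed.

Lemma CnD n f g : Cn n f -> Cn n g -> Cn n (fun x => f x + g x).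
Proof.
elim: n f g => [|n ih] f g [fc fd] [gc gd]; split => //.
- by move=> x; exact: (cvgD (fc x) (gc x)).
- by move=> x; exact: (cvgD (fc x) (gc x)).
move=> i; have [f' fd' Cf'] := fd i; have [g' gd' Cg'] := gd i.
by exists (fun x => f' x + g' x); [move=> x; exact: is_deriveD|exact: ih].
Qed.

Lemma CnM n f g : Cn n f -> Cn n g -> Cn n (fun x => f x * g x).
Proof.
elim: n f g => [|n ih] f g Cf Cg; have [fc fd] := Cf; have [gc gd] := Cg.
  by split => //; exact: continuousCM.
split; first exact: continuousCM.
move=> i; have [f' fd' Cf'] := fd i; have [g' gd' Cg'] := gd i.
exists (fun x => f' x * g x + f x * g' x); first by move=> x; exact: is_deriveCM.
by apply: CnD; apply: ih => //; exact: CnS.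
Qed.

Lemma smoothD f g : smooth f -> smooth g -> smooth (fun x => f x + g x).
Proof.
by rewrite !smooth_Cn => fs gs n; apply: CnD; [exact: fs|exact: gs].
Qed.

Lemma smoothM f g : smooth f -> smooth g -> smooth (fun x => f x * g x).
Proof.
by rewrite !smooth_Cn => fs gs n; apply: CnM; [exact: fs|exact: gs].
Qed.

Lemma smooth_cst (c : C) : smooth (fun _ : E => c).
Proof.
apply: (smooth_coind (P := fun f => exists c, f = fun=> c)); last by exists c.
move=> _ [{}c ->]; split; first exact: cst_continuous.
by move=> i; exists (fun=> 0); [move=> x; exact: is_deriveCcst|exists 0].
Qed.

Lemma smooth_prod (I : Type) (r : seq I) (F : I -> E -> C) :
  (forall k, smooth (F k)) -> smooth (fun x => \prod_(k <- r) F k x).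
Proof.
move=> Fs; elim: r => [|k r ih].
  by under eq_fun do rewrite big_nil; exact: smooth_cst.
by under eq_fun do rewrite big_cons; exact: smoothM.
Qed.

Lemma is_derive_affine f (a : R) (b x v : E) (l : C) :
  is_derive (b + a *: x) v f l -> is_derive x v (fun y => f (b + a *: y)) (a *: l).
Proof.
move=> fl.
have : is_derive (0 : R) (1 : R) (fun u : R => f (b + a *: (x + u *: v))) (a *: l).
  have -> : (fun u : R => f (b + a *: (x + u *: v))) =
            (fun w : R => f ((b + a *: x) + w *: v)) \o (fun u => a * u).
    by apply/funext => u /=; rewrite scalerDr scalerA addrA.
  have : is_derive (a * 0 : R) (1 : R) (fun w : R => f ((b + a *: x) + w *: v)) l.
    by apply: is_derive_to_line; rewrite mulr0 scale0r addr0.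
  have da : is_derive (0 : R) (1 : R) (fun u : R => a * u) a.
    by apply: is_derive_eq; rewrite /GRing.scale/= mulr1 ?mulr0 ?add0r ?addr0.
  move=> /is_derive_CP[dr di]; apply/is_derive_CP; split.
    by rewrite creZ mulrC; exact: is_derive1_comp.
  by rewrite cimZ mulrC; exact: is_derive1_comp.
by move=> /(@is_derive_of_line _ _ (fun y => f (b + a *: y))); rewrite scale0r addr0.
Qed.

Lemma smooth_affine f (a : R) (b : E) : smooth f -> smooth (fun x => f (b + a *: x)).
Proof.
rewrite !smooth_Cn => fs n; move: (fs n) => {fs}.
have aff (g : E -> C) : continuous g -> continuous (fun x => g (b + a *: x)).
  move=> gc x; apply: (@continuous_comp _ _ _ (fun x => b + a *: x)); last exact: gc.
  exact: (cvgD (cvg_cst b) (cvgZl_tmp (k := a) cvg_id)).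
elim: n f => [|n ih] f [fc fd]; split => //; do ?exact: aff.
move=> i; have [g gd Cg] := fd i; exists (fun x => a *: g (b + a *: x)).
  by move=> x; apply: is_derive_affine; exact: gd.
have -> : (fun x => a *: g (b + a *: x)) = (fun x => cofr a * g (b + a *: x)).
  by apply/funext => x; rewrite cofrM.
by apply: CnM; [apply: (smooth_Cn _).1; exact: smooth_cst|exact: ih].
Qed.

Lemma partials_affine f (a : R) (b : E) s : smooth f ->
  partials s (fun x => f (b + a *: x)) =
  fun x => a ^+ size s *: partials s f (b + a *: x).
Proof.
move=> fs; elim: s => [|i s ih].
  by apply/funext => x /=; rewrite expr0 scale1r.
apply/funext => x; rewrite /= -/(partials _ _) ih /partial.
have := smooth_is_derive (b + a *: x) i (smooth_partials s fs).
move=> /is_derive_affine h.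
have [_ ->] : is_derive x (dir i) (fun y => a ^+ size s *: partials s f (b + a *: y))
   (a ^+ size s *: (a *: partial i (partials s f) (b + a *: x))).
  exact: is_deriveZ.
by rewrite scalerA exprSr.
Qed.

Lemma partials_lin (c : C) f g s : smooth f -> smooth g ->
  partials s (fun x => c * f x + g x) = fun x => c * partials s f x + partials s g x.
Proof.
move=> fs gs; elim: s => //= i s ih.
apply/funext => x; rewrite -/(partials _ _) ih {1}/partial.
have := smooth_is_derive x i (smooth_partials s fs).
have := smooth_is_derive x i (smooth_partials s gs).
move=> dg df.
have [_ ->//] : is_derive x (dir i) (fun y => c * partials s f y + partials s g y)
   (c * partial i (partials s f) x + partial i (partials s g) x).
apply: is_deriveD.
have := is_deriveCM (is_deriveCcst c x (dir i)) df.
by rewrite mul0r add0r.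
Qed.

(** The factor 2 appears because the real mean value theorem is applied to the real and imaginary
    parts separately. *)
Lemma mean_value_bound (phi dphi : R -> C) (h L : R) :
  (forall u : R, is_derive u (1 : R) phi (dphi u)) ->
  (forall u, `|u| <= `|h| -> `|dphi u| <= L) ->
  `|phi h - phi 0| <= 2 * L * `|h|.
Proof.
have real (p dp : R -> R) : (forall u : R, is_derive u (1 : R) p (dp u)) ->
    (forall u, `|u| <= `|h| -> `|dp u| <= L) -> `|p h - p 0| <= L * `|h|.
  move=> pd pb.
  have pc (a b : R) : {within `[a, b], continuous p}.
    apply: continuous_subspaceT => x; apply: differentiable_continuous.
    by apply/derivable1_diffP; have [] := pd x.
  have [h0|h0] := leP 0 h.
    have [c] := MVT_segment h0 (fun u _ => pd u) (pc _ _).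
    rewrite in_itv/= => /andP[c0 ch] ->; rewrite subr0 normrM ler_wpM2r// pb//.
    by rewrite !ger0_norm.
  have [c] := MVT_segment (ltW h0) (fun u _ => pd u) (pc _ _).
  rewrite in_itv/= => /andP[ch c0]; rewrite distrC => ->.
  rewrite sub0r normrM normrN ler_wpM2r// pb//.
  by rewrite (ler0_norm c0) (ltr0_norm h0) lerN2.
move=> dp pb; apply: (le_trans (cnorm_le _)); rewrite creB cimB -mulrA mulr2n mulrDl !mul1r.
apply: lerD; [apply: (real (fun u => cre (phi u)) (fun u => cre (dphi u)))|apply: (real (fun u => cim (phi u)) (fun u => cim (dphi u)))].
- by move=> u; exact: is_derive_cre.
- by move=> u /pb; exact/le_trans/cre_le.
- by move=> u; exact: is_derive_cim.
- by move=> u /pb; exact/le_trans/cim_le.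
Qed.

End smooth_functions.

(** * Mean value estimates in several variables and the symmetry of second derivatives *)

Section mean_value.
Variables (R : realType) (d : nat).
Local Notation C := (Rcomplex R).
Local Notation E := 'rV[R]_d.
Implicit Types (f g : E -> C) (x y v : E) (i j : 'I_d).
Local Notation dir := (@dir R d).

(** Inserts an intermediate quantity [c], so that a difference of two approximated values becomes a
    difference of two errors. *)
Lemma scalerB_sub (W : lmodType R) (c a b : W) (k : R) :
  k *: (a - b) = (c - k *: b) - (c - k *: a).
Proof. by rewrite opprB (addrC c) addrACA subrr addr0 addrC scalerBr. Qed.

Lemma coord_le v i : `|v ord0 i| <= `|v|.
Proof.
rewrite [leRHS]/Num.norm/= mx_normrE.
exact: (le_bigmax_cond _ (fun ij : 'I_1 * 'I_d => `|v ij.1 ij.2|) (j := (ord0, i))).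
Qed.

Lemma norm_rV_le v (c : R) : 0 <= c -> (forall i, `|v ord0 i| <= c) -> `|v| <= c.
Proof.
move=> c0 vc; rewrite [leLHS]/Num.norm/= mx_normrE.
by apply/bigmax_leP; split => // -[k i] _ /=; rewrite ord1.
Qed.

Lemma dirE i k : dir i ord0 k = (k == i)%:R.
Proof. by rewrite mxE eqxx. Qed.

Lemma norm_dir i : `|dir i| <= 1.
Proof.
by apply: norm_rV_le => // k; rewrite dirE; case: (k == i); rewrite ?normr1 ?normr0.
Qed.

Let row_on (v : E) (l : seq 'I_d) : E := \row_k (if k \in l then v ord0 k else 0).

(** Only derivatives along the axes are given, so [x] and [x + v] are joined by a staircase that
    changes one coordinate at a time; its corners are the [x + row_on v l]. The norm is the maximum
    norm, hence the staircase stays within distance [|v|] of [x], and each of the [d] steps costs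
    [2 * L * |v|]. *)
Lemma path_bound f (D : 'I_d -> E -> C) x v (L : R) : 0 <= L ->
  (forall y i, is_derive y (dir i) f (D i y)) ->
  (forall y i, `|y - x| <= `|v| -> `|D i y| <= L) ->
  `|f (x + v) - f x| <= 2 * d%:R * L * `|v|.
Proof.
move=> L0 fD DL.
suff H l : uniq l -> `|f (x + row_on v l) - f x| <= 2 * (size l)%:R * L * `|v|.
  have := H (enum 'I_d) (enum_uniq _); rewrite size_enum_ord.
  suff -> : row_on v (enum 'I_d) = v by [].
  by apply/rowP => k; rewrite mxE mem_enum.
elim: l => [_|i l ih /= /andP[il ul]].
  rewrite (_ : row_on v [::] = 0) ?addr0 ?subrr ?normr0 ?mulr0 ?mul0r//.
  by apply/rowP => k; rewrite !mxE.
have E1 : row_on v (i :: l) = row_on v l + v ord0 i *: dir i.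
  apply/rowP => k; rewrite !mxE in_cons eqxx/= .
  have [->|ki] /= := eqVneq k i; first by rewrite (negbTE il) add0r mulr1.
  by rewrite mulr0 addr0.
have -> : f (x + row_on v (i :: l)) - f x =
  (f (x + row_on v l + v ord0 i *: dir i) - f (x + row_on v l + 0 *: dir i))
  + (f (x + row_on v l) - f x).
  by rewrite E1 scale0r addr0 addrA addrA subrK.
apply: (le_trans (ler_normD _ _)).
have -> : (size l).+1%:R = (size l)%:R + 1 :> R by rewrite natr1.
rewrite mulrDr mulr1 2!mulrDl addrC lerD ?ih//.
apply: (@le_trans _ _ (2 * L * `|v ord0 i|)); last first.
  by rewrite ler_wpM2l ?mulr_ge0// coord_le.
apply: (mean_value_bound (phi := fun u => f (x + row_on v l + u *: dir i))
  (dphi := fun u => D i (x + row_on v l + u *: dir i))) => u.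
  exact: is_derive_to_line.
move=> uv; apply: DL; rewrite -(addrA x) (addrC x) addrK.
apply: norm_rV_le => // k; rewrite !mxE eqxx/=.
have [->|ki] := eqVneq k i; last first.
  by rewrite mulr0 addr0; case: ifP; rewrite ?normr0// coord_le.
by rewrite (negbTE il) add0r mulr1 (le_trans uv)// coord_le.
Qed.

(** The mean value bound is used in direction [j] and then in direction [i]; the two factors 2 give
    the 4. *)
Lemma second_difference f x i j (e : R) : smooth f -> 0 < e ->
  exists2 r : R, 0 < r & forall h, `|h| < r ->
    `|(f (x + h *: dir i + h *: dir j) - f (x + h *: dir j)
      - (f (x + h *: dir i) - f x)) - (h * h) *: partial i (partial j f) x|
    <= 4 * e * (`|h| * `|h|).
Proof.
move=> fs e0; set A := partial i _ x.
have /smooth_continuous/(_ x)/cvgrPdist_le/(_ _ e0) :=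
  smooth_partial i (smooth_partial j fs).
move=> /nbhs_ballP[r /= r0 rA]; exists (r / 2); first by rewrite divr_gt0.
(* The term linear in [u] is subtracted so that the derivative [dphi u] is itself an increment,
   namely [psi h - psi 0] for the function [psi] introduced below, whose derivative is small by
   continuity of the mixed derivative. *)
move=> h hr; pose phi (u : R) : C := f (x + h *: dir i + u *: dir j) - f (x + u *: dir j)
  - (u * h) *: A.
pose dphi (u : R) : C := partial j f (x + h *: dir i + u *: dir j)
  - partial j f (x + u *: dir j) - h *: A.
have dlin (h' : R) (u : R) : is_derive u (1 : R) (fun u : R => (u * h') *: A) (h' *: A).
  apply/is_derive_CP; split.
    rewrite creZ; under eq_fun do rewrite creZ.
    by apply: is_derive_eq; rewrite /GRing.scale/=; ring.
  rewrite cimZ; under eq_fun do rewrite cimZ.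
  by apply: is_derive_eq; rewrite /GRing.scale/=; ring.
have phid u : is_derive u (1 : R) phi (dphi u).
  have d1 := dlin h u.
  have d2 := is_derive_to_line (smooth_is_derive (x + h *: dir i + u *: dir j) j fs).
  have d3 := is_derive_to_line (smooth_is_derive (x + u *: dir j) j fs).
  exact: is_deriveB.
have := mean_value_bound (h := h) (L := 2 * e * `|h|) phid.
have -> : phi h - phi 0 =
  f (x + h *: dir i + h *: dir j) - f (x + h *: dir j) -
  (f (x + h *: dir i) - f x) - h * h *: A.
  by rewrite /phi !scale0r mul0r scale0r !addr0 subr0 [RHS]addrAC.
move=> H; apply: (le_trans (H _)); last by lra.
move=> u uh {H}; pose psi (v : R) : C := partial j f (x + u *: dir j + v *: dir i) - (v * 1) *: A.
pose dpsi (v : R) : C := partial i (partial j f) (x + u *: dir j + v *: dir i) - 1 *: A.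
have psid (v : R) : is_derive v (1 : R) psi (dpsi v).
  have d1 := dlin 1 v.
  have d2 := is_derive_to_line (smooth_is_derive (x + u *: dir j + v *: dir i) i
    (smooth_partial j fs)).
  exact: is_deriveB.
have := mean_value_bound (h := h) (L := e) psid.
have -> : psi h - psi 0 = dphi u.
  by rewrite /psi /dphi !mulr1 !scale0r !addr0 subr0 addrAC [in LHS](addrAC x).
apply => v vh; rewrite /dpsi scale1r distrC; apply: rA.
rewrite -ball_normE /ball_/= opprD addrA opprD addrA subrr sub0r -opprD normrN.
apply: (le_lt_trans (ler_normD _ _)); rewrite !normrZ (splitr r) ltr_leD//.
  by apply: le_lt_trans hr; rewrite -[leRHS]mulr1 ler_pM// norm_dir.
by apply: le_trans (ltW hr); rewrite -[leRHS]mulr1 ler_pM// norm_dir.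
Qed.

(** Schwarz's theorem: the second difference is symmetric in [i] and [j], and divided by [h * h] it
    approximates both mixed derivatives. The two errors [4 * (e / 8)] add up to [e]. *)
Lemma partialC f i j : smooth f -> partial i (partial j f) = partial j (partial i f).
Proof.
move=> fs; apply/funext => x; apply/eqP; rewrite -subr_eq0 -normr_eq0 eq_le normr_ge0 andbT.
apply/ler_addgt0Pr => e e0; rewrite add0r.
have e80 : 0 < e / 8 by rewrite divr_gt0.
have [r r0 rij] := second_difference x i j fs e80.
have [r' r'0 rji] := second_difference x j i fs e80.
pose h := Num.min r r' / 2.
have m0 : 0 < Num.min r r' by rewrite lt_min r0.
have h0 : 0 < h by rewrite divr_gt0.
have hm : `|h| < Num.min r r'.
  by rewrite gtr0_norm// ltr_pdivrMr// mulr_natr mulr2n ltrDl.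
have := rij h; rewrite (lt_le_trans hm) ?ge_min ?lexx// => /(_ isT).
have := rji h; rewrite (lt_le_trans hm) ?ge_min ?lexx ?orbT// => /(_ isT).
set A := partial i (partial j f) x; set B := partial j (partial i f) x.
have -> : f (x + h *: dir j + h *: dir i) - f (x + h *: dir i) - (f (x + h *: dir j) - f x)
  = f (x + h *: dir i + h *: dir j) - f (x + h *: dir j) - (f (x + h *: dir i) - f x).
  rewrite [x + h *: dir j + _]addrAC !opprB addrACA [RHS]addrACA; congr (_ + _).
  exact: addrC.
set D := (X in `|X - _| <= _ -> _).
move=> hB hA; have hh : 0 < h * h by rewrite mulr_gt0.
suff : (h * h) * `|A - B| <= (h * h) * e by rewrite ler_pM2l.
rewrite -[X in X * `|A - B|](gtr0_norm hh) -normrZ.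
rewrite (scalerB_sub (D : C)).
apply: (le_trans (ler_normB _ _)); apply: (le_trans (lerD hB hA)).
rewrite gtr0_norm//; clear; move: (h * h) => H.
by rewrite (_ : 4 * (e / 8) * H + _ = H * e)//; field.
Qed.

Lemma partials_partial f s i : smooth f ->
  partials s (partial i f) = partial i (partials s f).
Proof.
move=> fs; elim: s => //= j s ih; rewrite -!/(partials _ _) ih partialC//.
exact: smooth_partials.
Qed.

End mean_value.

(** * Integration on the space of row vectors *)

Section lebesgue_tuple_integral.
Variable R : realType.
Local Notation RM := (measurableTypeR R).
Local Notation leb := (@lebesgue_measure R).
Local Open Scope ereal_scope.

Lemma measurable_tcons n : measurable_fun [set: RM * n.-tuple RM] (@tcons R n).
Proof. exact: measurable_cons. Qed.

Lemma lebesgue_tuple_tonelli n (f : n.+1.-tuple RM -> \bar R) :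
  measurable_fun [set: n.+1.-tuple RM] f -> (forall t, 0 <= f t) ->
  \int[lebesgue_tuple R n.+1]_t f t =
  \int[leb]_x \int[lebesgue_tuple R n]_t f (tcons (x, t)).
Proof.
move=> mf f0.
have mft : measurable_fun setT (f \o @tcons R n).
  by apply: measurableT_comp => //; exact: measurable_tcons.
rewrite -(@fubini_tonelli1 _ _ _ _ _ leb (lebesgue_tuple R n) _ mft (fun x => f0 _)).
rewrite (eq_measure_integral (pushforward (leb \x lebesgue_tuple R n) (@tcons R n)))//.
  exact: measurable_tcons.
by move=> mt; rewrite (ge0_integral_pushforward mt _ measurableT mf (fun y _ => f0 y)).
Qed.

Lemma lebesgue_tuple_tensor n (w : R -> R) (c : R) :
  measurable_fun [set: RM] w -> (forall x, (0 <= w x)%R) ->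
  \int[leb]_x (w x)%:E = c%:E ->
  \int[lebesgue_tuple R n]_t (\prod_(i < n) w (tnth t i))%:E = (c ^+ n)%:E.
Proof.
move=> mw w0 wc.
have mp m : measurable_fun [set: m.-tuple RM] (fun t : m.-tuple RM => (\prod_(i < m) w (tnth t i))%:E).
  apply/measurable_EFinP; apply: measurable_prod => i _.
  by apply: (measurableT_comp mw); exact: measurable_tnth.
elim: n => [|n ih].
  rewrite integral_dirac//; last exact: mp.
  by rewrite diracT mul1e big_ord0 expr0.
rewrite lebesgue_tuple_tonelli//; last first.
  by move=> t; rewrite lee_fin; exact: prodr_ge0.
rewrite exprS mulrC.
have E x : \int[lebesgue_tuple R n]_t (\prod_(i < n.+1) w (tnth (tcons (x, t)) i))%:E =
    (c ^+ n)%:E * (w x)%:E.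
  rewrite muleC -ih -ge0_integralZl_EFin//.
  - by apply: eq_integral => t _; rewrite big_ord_recl/= EFinM;
      under eq_bigr do rewrite tnthS.
  - by move=> t _; rewrite lee_fin; exact: prodr_ge0.
  - exact: mp.
under eq_integral do rewrite E.
have cn0 : (0 <= c ^+ n)%R.
  rewrite -lee_fin -ih; apply: integral_ge0 => t _.
  by rewrite lee_fin; exact: prodr_ge0.
have wE0 x : [set: RM] x -> 0 <= (w x)%:E by rewrite lee_fin.
have mwE : measurable_fun [set: RM] (fun x => (w x)%:E) by exact/measurable_EFinP.
by rewrite (ge0_integralZl_EFin _ measurableT wE0 mwE cn0) wc EFinM.
Qed.

Lemma measurable_affine (a b : R) : measurable_fun [set: RM] (fun x : RM => (b + a * x)%R : RM).
Proof. by apply: measurable_funD => //; exact: measurable_funM. Qed.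

(** By uniqueness on half-open intervals, Lebesgue measure is [|a|] times its pushforward under the
    affine map. A negative [a] moves the closed end of the interval to the other side, which is why
    the signs are treated apart. *)
Lemma lebesgue_integral_affine (a b : R) (f : RM -> \bar R) : (a != 0)%R ->
  measurable_fun [set: RM] f -> (forall x, 0 <= f x) ->
  \int[leb]_x f (b + a * x)%R = (`|a|^-1)%:E * \int[leb]_x f x.
Proof.
move=> a0 mf f0.
have na0 : (0 < `|a|)%R by rewrite normr_gt0.
pose phi (x : RM) : RM := (b + a * x)%R.
have mphi : measurable_fun [set: RM] phi := measurable_affine a b.
have E A : measurable A -> leb A = mscale (NngNum (ltW na0)) (pushforward leb phi) A.
  move=> mA; apply: lebesgue_measure_unique => //= _ [[c e]] _ <-.
  rewrite /mscale/= /pushforward.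
  have [ap|an] := ltP 0%R a.
    have -> : phi @^-1` `]c, e]%classic = `]((c - b) / a)%R, ((e - b) / a)%R]%classic.
      apply/seteqP; split => x /=; rewrite !in_itv/=;
        by rewrite ltr_pdivrMr// ler_pdivlMr// ltrBlDl lerBrDl mulrC.
    rewrite !lebesgue_measure_itv/= !lte_fin ltr_pM2r ?invr_gt0// ltrBlDr subrK.
    case: ifP => _; last by rewrite mule0.
    by rewrite -EFinM; congr EFin; rewrite (gtr0_norm ap); field.
  have {}an : (a < 0)%R by rewrite lt_neqAle a0.
  have -> : phi @^-1` `]c, e]%classic = `[((e - b) / a)%R, ((c - b) / a)%R[%classic.
    apply/seteqP; split => x /=; rewrite !in_itv/=;
      by rewrite ler_ndivrMr// ltr_ndivlMr// lerBrDl ltrBlDl mulrC andbC.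
  rewrite !lebesgue_measure_itv/= !lte_fin ltr_nM2r ?invr_lt0// ltrBlDr subrK.
  case: ifP => _; last by rewrite mule0.
  by rewrite -EFinM; congr EFin; rewrite (ltr0_norm an); field.
have E2 : \int[leb]_x f x = `|a|%:E * \int[leb]_x f (phi x).
  rewrite (eq_measure_integral (mscale (NngNum (ltW na0)) (pushforward leb phi))).
    rewrite ge0_integral_mscale// ge0_integral_pushforward// preimage_setT//.
  by move=> A mA _; exact: E.
by rewrite E2 muleA -EFinM mulVf ?mul1e// gt_eqF.
Qed.

Definition taffine n (a : R) (b t : n.-tuple RM) : n.-tuple RM :=
  [tuple (tnth b i + a * tnth t i)%R | i < n].

Lemma measurable_taffine n a b : measurable_fun [set: n.-tuple RM] (@taffine n a b).
Proof.
apply/measurable_fun_tnthP => i.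
rewrite (_ : _ \o _ = (fun x => tnth b i + a * x)%R \o (fun t => tnth t i)).
  by apply: measurableT_comp; [exact: measurable_affine|exact: measurable_tnth].
by apply/funext => t /=; rewrite tnth_mktuple.
Qed.

Lemma lebesgue_tuple_affine n (a : R) (b : n.-tuple RM) (f : n.-tuple RM -> \bar R) :
  (a != 0)%R -> measurable_fun [set: n.-tuple RM] f -> (forall t, 0 <= f t) ->
  \int[lebesgue_tuple R n]_t f (taffine a b t) =
  ((`|a| ^+ n)^-1)%:E * \int[lebesgue_tuple R n]_t f t.
Proof.
move=> a0; elim: n b f => [|n ih] b f mf f0.
  rewrite expr0 invr1 mul1e; apply: eq_integral => t _.
  by rewrite (tuple0 t) (tuple0 (taffine _ _ _)).
rewrite lebesgue_tuple_tonelli//; last first.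
  by apply: measurableT_comp => //; exact: measurable_taffine.
have E x t : taffine a b (tcons (x, t)) =
    tcons ((thead b + a * x)%R, taffine a [tuple of behead b] t).
  apply: eq_from_tnth => i; rewrite tnth_mktuple.
  case: (unliftP ord0 i) => [j ->|->]; last by [].
  rewrite /tcons/= !tnthS tnth_mktuple/= tnth_behead; congr (tnth b _ + _)%R.
  by apply/val_inj; rewrite /= inordK// ltnS.
have msec x : measurable_fun [set: n.-tuple RM] (fun t => f (tcons (x, t))).
  apply: measurableT_comp => //.
  apply: (measurableT_comp (f := @tcons R n) (g := fun t => (x, t))).
    exact: measurable_tcons.
  exact: measurable_pair1.
under eq_integral => x _.
  under eq_integral => t _ do rewrite E.
  rewrite (ih _ (fun t => f (tcons ((thead b + a * x)%R, t))))//.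
  over.
rewrite (lebesgue_tuple_tonelli mf)//.
set G := fun x : R => \int[lebesgue_tuple R n]_t f (tcons (x, t)).
have mG : measurable_fun [set: RM] G.
  have mft : measurable_fun setT (f \o @tcons R n).
    by apply: measurableT_comp => //; exact: measurable_tcons.
  exact: (@measurable_fun_fubini_tonelli_F _ _ _ _ R (lebesgue_tuple R n) _ mft (fun x => f0 _)).
have G0 x : 0 <= G x by exact: integral_ge0.
have mGa : measurable_fun [set: RM] (fun x => G (thead b + a * x)%R).
  by apply: (measurableT_comp mG); exact: measurable_affine.
have an0 : (0 <= (`|a| ^+ n)^-1)%R by rewrite invr_ge0 exprn_ge0.
rewrite (ge0_integralZl_EFin _ measurableT (fun x _ => G0 _) mGa an0).
rewrite (lebesgue_integral_affine (thead b) a0 mG)// muleA -EFinM; congr (_%:E * _).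
by rewrite exprS invfM mulrC.
Qed.

End lebesgue_tuple_integral.

(** * Measurability and integrals of real functions of a row vector *)

Section integral_on_rV.
Variables (R : realType) (d : nat).
Local Notation RM := (measurableTypeR R).
Local Notation leb := (@lebesgue_measure R).
Local Notation E := 'rV[R]_d.
Local Notation TU := (d.-tuple RM).
Implicit Types (f g h : E -> R) (x y : E).

Definition mes h := measurable_fun [set: TU] (h \o @rV_of_tuple R d).

Definition itg h :=
  (lebesgue_tuple R d).-integrable [set: TU] (EFin \o (h \o @rV_of_tuple R d)).

Definition tuple_of_rV x : TU := [tuple x ord0 i | i < d].

Lemma tuple_of_rVK : cancel tuple_of_rV (@rV_of_tuple R d).
Proof. by move=> x; apply/rowP => i; rewrite mxE tnth_mktuple. Qed.

Lemma mes_coord i : mes (fun x => x ord0 i).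
Proof.
rewrite /mes (_ : _ \o _ = (fun t => tnth t i)); first exact: measurable_tnth.
by apply/funext => t; rewrite /= mxE.
Qed.

Lemma ballrVP x y (r : R) : 0 < r -> ball x r y <-> forall i, `|x ord0 i - y ord0 i| < r.
Proof.
move=> r0; rewrite -ball_normE /ball_/=; split=> [xy i|xy].
  by have := coord_le (x - y) i; rewrite !mxE => /le_lt_trans; exact.
rewrite [ltLHS]/Num.norm/= mx_normrE.
by apply/bigmax_ltP; split => // -[k i] _ /=; rewrite !mxE ord1; exact: xy.
Qed.

Lemma measurable_ball_rV x (r : R) : 0 < r ->
  measurable (@rV_of_tuple R d @^-1` ball x r : set TU).
Proof.
move=> r0.
rewrite (_ : _ @^-1` _ =
  \bigcap_(i in [set: 'I_d]) ((fun t : TU => tnth t i) @^-1` ball (x ord0 i) r)).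
  apply: fin_bigcap_measurable; first exact: finite_finset.
  move=> i _; rewrite -[X in measurable X]setTI.
  by apply: measurable_tnth => //; apply: open_measurable; exact: ball_open.
apply/seteqP; split => t /=.
  by move=> /ballrVP-/(_ r0) H i _; have := H i; rewrite mxE.
by move=> H; apply/ballrVP => // i; rewrite mxE; exact: H.
Qed.

(** Balls of the maximum norm are boxes, hence measurable for the product structure on tuples, and
    an open set is the countable union of the balls it contains with rational centre and radius of
    the form [1 / (n + 1)]. *)
Lemma measurable_open_rV (U : set E) : open U ->
  measurable (@rV_of_tuple R d @^-1` U : set TU).
Proof.
move=> Uo.
pose F (p : 'rV[rat]_d * nat) : set TU :=
  let B := ball (map_mx (ratr : rat -> R) p.1 : E) p.2.+1%:R^-1 in
  if `[< B `<=` U >] then @rV_of_tuple R d @^-1` B else set0.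
rewrite (_ : _ @^-1` U = \bigcup_p F p).
  apply: countable_bigcupT_measurable; first exact: countableP.
  move=> p; rewrite /F; case: ifP => _; last exact: measurable0.
  by apply: measurable_ball_rV; rewrite invr_gt0.
apply/seteqP; split => [t /= Ut|t [p _]]; last first.
  by rewrite /F; case: ifPn => [/asboolP BU|//]; exact: BU.
have := Uo _ Ut => /nbhs_ballP[r /= r0 rU].
have [k kr] : exists k : nat, k.+1%:R^-1 < r / 2.
  exists (Num.truncn (r / 2)^-1); rewrite invf_plt ?posrE ?divr_gt0//.
  exact: truncnS_gt.
have k0 : 0 < k.+1%:R^-1 :> R by rewrite invr_gt0.
have /(_ _)/cid-/all_sig[q qt] : forall i : 'I_d, exists q : rat,
    `|ratr q - tnth t i| < k.+1%:R^-1.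
  move=> i; have : tnth t i - k.+1%:R^-1 < tnth t i + k.+1%:R^-1.
    by rewrite ltrBlDr -addrA ltrDl addr_gt0.
  by move=> /rat_in_itvoo[q]; rewrite in_itv/= => qi; exists q; rewrite ltr_distl.
exists (\row_i q i, k) => //; rewrite /F /=.
have tB : ball (map_mx (ratr : rat -> R) (\row_i q i) : E) k.+1%:R^-1 (rV_of_tuple t).
  by apply/ballrVP => // i; rewrite !mxE.
case: ifPn => // /asboolPn[]; move=> y yB; apply: rU.
apply: (ball_split (z := map_mx (ratr : rat -> R) (\row_i q i))).
  by apply: ball_sym; exact: (le_ball (ltW kr)).
exact: (le_ball (ltW kr)).
Qed.

Lemma mes_continuous h : continuous h -> mes h.
Proof.
move=> /continuousP hc; apply: (measurability _ (RGenOpens.measurableE R)).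
move=> _ [_ [a [b ->] <-]]; rewrite setTI comp_preimage; apply: measurable_open_rV.
exact/hc/interval_open.
Qed.

Lemma mesM f g : mes f -> mes g -> mes (fun x => f x * g x).
Proof. exact: measurable_funM. Qed.

Lemma mes_norm f : mes f -> mes (fun x => `|f x|).
Proof. by move=> mf; exact: measurableT_comp. Qed.

Lemma mes_cst (c : R) : mes (fun=> c).
Proof. exact: measurable_cst. Qed.

Lemma mes_itg f : itg f -> mes f.
Proof. by move=> /integrableP[/measurable_EFinP]. Qed.

Lemma itg_le f g : mes f -> itg g -> (forall x, `|f x| <= g x) -> itg f.
Proof.
move=> mf ig fg; apply: le_integrable ig => //; first exact/measurable_EFinP.
by move=> t _ /=; rewrite lee_fin (le_trans (fg _))// ler_norm.
Qed.

Lemma itgD f g : itg f -> itg g -> itg (fun x => f x + g x).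
Proof. by move=> fi gi; exact: (integrableD measurableT fi gi). Qed.

Lemma itgZ (c : R) f : itg f -> itg (fun x => c * f x).
Proof. by move=> fi; exact: (integrableZl measurableT c fi). Qed.

Lemma itgN f : itg f -> itg (fun x => - f x).
Proof. by move=> /(itgZ (-1)); apply: eq_integrable => // t _ /=; rewrite mulN1r. Qed.

Lemma itgB f g : itg f -> itg g -> itg (fun x => f x - g x).
Proof. by move=> fi gi; apply: itgD => //; exact: itgN. Qed.

Lemma itg_norm f : itg f -> itg (fun x => `|f x|).
Proof. by move=> fi; exact: (integrable_abse fi). Qed.

Lemma integral_rVD f g : itg f -> itg g ->
  integral_rV (fun x => f x + g x) = integral_rV f + integral_rV g.
Proof. by move=> fi gi; exact: RintegralD. Qed.

Lemma integral_rVZ (c : R) f : itg f ->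
  integral_rV (fun x => c * f x) = c * integral_rV f.
Proof. by move=> fi; exact: RintegralZl. Qed.

Lemma integral_rVN f : itg f -> integral_rV (fun x => - f x) = - integral_rV f.
Proof.
move=> fi; rewrite -mulN1r -integral_rVZ//; congr integral_rV.
by apply/funext => x; rewrite mulN1r.
Qed.

Lemma integral_rVB f g : itg f -> itg g ->
  integral_rV (fun x => f x - g x) = integral_rV f - integral_rV g.
Proof. by move=> fi gi; exact: RintegralB. Qed.

Lemma le_integral_rV f g : itg f -> itg g -> (forall x, f x <= g x) ->
  integral_rV f <= integral_rV g.
Proof. by move=> fi gi fg; apply: le_Rintegral. Qed.

Lemma integral_rV_ge0 f : (forall x, 0 <= f x) -> 0 <= integral_rV f.
Proof. by move=> f0; apply: Rintegral_ge0 => t _; exact: f0. Qed.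

Lemma norm_integral_rV f : itg f -> `|integral_rV f| <= integral_rV (fun x => `|f x|).
Proof. by move=> fi; exact: le_normr_Rintegral. Qed.

Lemma integral_rV_tensor (w : R -> R) (c : R) :
  measurable_fun [set: RM] w -> (forall u, 0 <= w u) ->
  (\int[leb]_u (w u)%:E)%E = c%:E ->
  itg (fun x => \prod_i w (x ord0 i)) /\ integral_rV (fun x => \prod_i w (x ord0 i)) = c ^+ d.
Proof.
move=> mw w0 wc; have H := lebesgue_tuple_tensor d mw w0 wc.
have E1 t : \prod_i w (rV_of_tuple t ord0 i) = \prod_(i < d) w (tnth t i).
  by apply: eq_bigr => i _; rewrite mxE.
split; last by rewrite /integral_rV /Rintegral; under eq_integral do rewrite /= E1; rewrite H.
apply/integrableP; split.
  apply/measurable_EFinP; rewrite (_ : _ \o _ = fun t => \prod_(i < d) w (tnth t i)).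
    apply: measurable_prod => i _; apply: (measurableT_comp mw); exact: measurable_tnth.
  by apply/funext => t /=; rewrite E1.
under eq_integral => t _.
  rewrite /= E1 ger0_norm; last exact: prodr_ge0.
  over.
by rewrite H ltry.
Qed.

Lemma itg_affine f (a : R) (b : E) : a != 0 -> itg f ->
  itg (fun x => f (b + a *: x)) /\
  integral_rV (fun x => f (b + a *: x)) = (`|a| ^+ d)^-1 * integral_rV f.
Proof.
move=> a0 fi.
have E1 t : b + a *: rV_of_tuple t = rV_of_tuple (taffine a (tuple_of_rV b) t).
  by apply/rowP => i; rewrite !mxE !tnth_mktuple.
have H (F : E -> \bar R) : measurable_fun [set: TU] (F \o @rV_of_tuple R d) ->
    (forall x, 0 <= F x)%E ->
    (\int[lebesgue_tuple R d]_t F (b + a *: rV_of_tuple t)%R =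
    ((`|a| ^+ d)^-1)%:E * \int[lebesgue_tuple R d]_t F (rV_of_tuple t))%E.
  move=> mF F0; under eq_integral do rewrite E1.
  exact: (lebesgue_tuple_affine (tuple_of_rV b) a0 mF (fun t => F0 _)).
have /integrableP[mf foo] := fi.
have c0 : 0 <= (`|a| ^+ d)^-1 by rewrite invr_ge0 exprn_ge0.
split.
  apply/integrableP; split.
    apply/measurable_EFinP.
    rewrite (_ : _ \o _ = (f \o @rV_of_tuple R d) \o taffine a (tuple_of_rV b)).
      by apply: measurableT_comp; [exact/measurable_EFinP|exact: measurable_taffine].
    by apply/funext => t /=; rewrite E1.
  rewrite /= (H (fun x => `|(f x)%:E|%E))//; last exact: measurableT_comp.
  by rewrite lte_mul_pinfty.
rewrite /integral_rV /Rintegral.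
rewrite integralE [X in fine X = _](_ : _ = ((`|a| ^+ d)^-1)%:E *
   \int[lebesgue_tuple R d]_t (f (rV_of_tuple t))%:E)%E.
  by rewrite fineM//; exact: integrable_fin_num.
rewrite [in RHS]integralE muleBr//; last first.
  by rewrite fin_num_adde_defr//; apply: integrable_pos_fin_num.
congr (_ - _)%E.
- under eq_integral do rewrite funeposE.
  under [in RHS]eq_integral do rewrite funeposE.
  apply: (H (fun x => maxe (f x)%:E 0%E)) => [|x]; last by rewrite le_max lexx orbT.
  rewrite (_ : _ \o _ = (EFin \o (f \o @rV_of_tuple R d))^\+%E).
    exact: measurable_funepos.
  by apply/funext => t; rewrite funeposE.
- under eq_integral do rewrite funenegE.
  under [in RHS]eq_integral do rewrite funenegE.
  apply: (H (fun x => maxe (- (f x)%:E)%E 0%E)) => [|x]; last by rewrite le_max lexx orbT.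
  rewrite (_ : _ \o _ = (EFin \o (f \o @rV_of_tuple R d))^\-%E).
    exact: measurable_funeneg.
  by apply/funext => t; rewrite funenegE.
Qed.

(** The one-variable factor of the integrable majorant in [itg_decay]. Each half-line contributes
    [pi / 2], the left one by reflection, which bounds the integral from above and from below. *)
Lemma cauchy_density_integral : exists2 c : R, 0 < c &
  (\int[leb]_u ((oneDsqr u)^-1)%:E)%E = c%:E.
Proof.
have m1 : measurable_fun [set: RM] (fun u => ((oneDsqr u)^-1)%:E).
  apply/measurable_EFinP; apply: continuous_measurable_fun.
  exact: continuous_oneDsqrV.
have p0 (u : R) : (0 <= ((oneDsqr u)^-1)%:E)%E by rewrite lee_fin invr_ge0.
have E0 : [set: R] = `]-oo, (0:R)[%classic `|` `[(0:R), +oo[%classic.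
  by apply/seteqP; split => // u _ /=; rewrite !in_itv/= andbT; case: ltP; [left|right].
have EN : (\int[leb]_(u in `]-oo, 0%R]) ((oneDsqr u)^-1)%:E = (pi / 2)%:E)%E.
  have := @integral0y_oneDsqr R.
  rewrite ge0_integration_by_substitution0//.
  by under eq_integral do rewrite /oneDsqr sqrrN.
have pi2 : 0 < pi / 2 :> R by rewrite divr_gt0 ?pi_gt0.
have le1 : (\int[leb]_u ((oneDsqr u)^-1)%:E <= (pi / 2)%:E + (pi / 2)%:E)%E.
  rewrite {1}E0 ge0_integral_setU//=.
  - rewrite integral0y_oneDsqr leeD2r// -EN; apply: ge0_subset_integral => //=.
      exact: measurable_funTS.
    by move=> u /=; rewrite !in_itv/=; exact: ltW.
  - exact: measurable_funTS.
  - by apply/disj_setPS => u [] /=; rewrite !in_itv/= andbT; case: ltP.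
have ge1 : ((pi / 2)%:E <= \int[leb]_u ((oneDsqr u)^-1)%:E)%E.
  by rewrite -integral0y_oneDsqr; exact: ge0_subset_integral.
have fin : (\int[leb]_u ((oneDsqr u)^-1)%:E)%E \is a fin_num.
  by rewrite ge0_fin_numE ?integral_ge0// (le_lt_trans le1)// ltry.
exists (fine (\int[leb]_u ((oneDsqr u)^-1)%:E)%E); last by rewrite fineK.
by rewrite -lte_fin fineK// (lt_le_trans _ ge1)// lte_fin.
Qed.

(** The majorant is a product of Cauchy densities. The exponent [2 * d] is what dominates its
    inverse: each of the [d] factors [1 + x_i ^ 2] is at most [(1 + |x|) ^ 2]. *)
Lemma itg_decay h (c : R) : mes h ->
  (forall x, (1 + `|x|) ^+ (2 * d) * `|h x| <= c) -> itg h.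
Proof.
move=> mh hc; have [c1 _ c1E] := cauchy_density_integral.
have mw : measurable_fun [set: RM] (fun u => (oneDsqr u)^-1).
  by apply: continuous_measurable_fun; exact: continuous_oneDsqrV.
have w0 (u : R) : 0 <= (oneDsqr u)^-1 by rewrite invr_ge0.
have [wi _] := integral_rV_tensor mw w0 c1E.
have c0 : 0 <= c by apply: le_trans (hc 0); rewrite mulr_ge0// exprn_ge0// addr_ge0.
apply: (itg_le mh (itgZ c wi)) => x.
have W0 : 0 < 1 + `|x| by rewrite ltr_pwDl.
have P0 : 0 < \prod_i oneDsqr (x ord0 i) by apply: prodr_gt0 => i _; exact: lt_le_trans ltr01 (oneDsqr_ge1 _).
have W2 : 0 < (1 + `|x|) ^+ (2 * d) by rewrite exprn_gt0.
rewrite -[leLHS](mulKf (lt0r_neq0 W2)) mulrC; apply: ler_pM; [by rewrite mulr_ge0// ltW| |exact: hc|].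
  by rewrite invr_ge0 ltW.
rewrite prodfV lef_pV2 ?posrE//.
rewrite exprM -[X in _ <= _ ^+ X](card_ord d) -prodr_const.
apply: ler_prod => i _; rewrite (le_trans ler01 (oneDsqr_ge1 _))/= /oneDsqr sqrrD expr1n.
rewrite -addrA lerD2l mul1r (le_trans (y := `|x| ^+ 2))//; last by rewrite lerDr mulrn_wge0.
by rewrite -[leLHS]real_normK ?num_real// lerXn2r ?nnegrE// coord_le.
Qed.

(** Near [x] the function exceeds [h x / 2] on a cube of side [2 * s]. The indicator of the cube is
    a tensor product, so its integral [(2 * s) ^ d] is known. *)
Lemma integral_rV_gt0 h x : continuous h -> (forall y, 0 <= h y) -> itg h ->
  0 < h x -> 0 < integral_rV h.
Proof.
move=> hc h0 hi hx.
have h20 : 0 < h x / 2 by rewrite divr_gt0.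
have := hc x => /cvgrPdist_lt/(_ _ h20)/nbhs_ballP[r /= r0 rh].
pose s := r / 2; have s0 : 0 < s by rewrite divr_gt0.
pose w : R -> R := \1_(`[- s, s]%classic).
have mw : measurable_fun [set: RM] w by exact: measurable_indic.
have w0 u : 0 <= w u by [].
have wE : (\int[leb]_u (w u)%:E)%E = (2 * s)%:E.
  transitivity (leb (`[- s, s]%classic : set R)); first by rewrite /w integral_indic// setIT.
  rewrite lebesgue_measure_itv/= lte_fin -subr_gt0 opprK addr_gt0//.
  by rewrite -EFinD; congr EFin; ring.
have [wi wI] := integral_rV_tensor mw w0 wE.
have [gi gI] := itg_affine (- x) (oner_neq0 _) wi.
rewrite normr1 expr1n invr1 mul1r wI in gI.
apply: (@lt_le_trans _ _ (h x / 2 * (2 * s) ^+ d)).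
  by rewrite mulr_gt0// exprn_gt0// mulr_gt0.
rewrite -gI -integral_rVZ//; apply: le_integral_rV => //; first exact: itgZ.
move=> y /=; set P := \prod_i _.
have [H|/existsNP[i Hi]] := pselect (forall i, `|x ord0 i - y ord0 i| <= s); last first.
  rewrite /P (bigD1 i)//= {1}/w indicE memNset ?mul0r ?mulr0//=.
  rewrite in_itv/= -ler_norml; move: Hi; rewrite !mxE mul1r.
  by rewrite -normrN opprD opprK addrC.
have -> : P = 1.
  rewrite /P big1// => i _; rewrite /w indicE mem_set//= in_itv/= -ler_norml.
  by have := H i; rewrite !mxE mul1r -normrN opprD opprK addrC.
have : `|h x - h y| < h x / 2.
  apply: rh; apply/ballrVP => // i; apply: (le_lt_trans (H i)).
  by rewrite /s ltr_pdivrMr// mulr_natr mulr2n ltrDl.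
by rewrite ltr_distlC => /andP[]; lra.
Qed.

Lemma integral_rV_Fubini (H : E -> E -> R) (p q : E -> R) :
  measurable_fun [set: TU * TU] (fun z => H (rV_of_tuple z.1) (rV_of_tuple z.2)) ->
  itg p -> itg q -> (forall x y, `|H x y| <= p x * q y) ->
  integral_rV (fun x => integral_rV (H x)) =
  integral_rV (fun y => integral_rV (H ^~ y)).
Proof.
move=> mH ip iq Hpq; set m := lebesgue_tuple R d.
have mHE : measurable_fun [set: TU * TU]
   (fun z => (H (rV_of_tuple z.1) (rV_of_tuple z.2))%:E) by exact/measurable_EFinP.
have i1 x : itg (H x).
  rewrite -[x]tuple_of_rVK; apply: itg_le (itgZ _ iq) (Hpq _).
  exact: (measurable_comp measurableT _ mH (measurable_pair1 _)).
have i2 y : itg (H ^~ y).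
  rewrite -[y]tuple_of_rVK; apply: (itg_le _ (itgZ (q (rV_of_tuple (tuple_of_rV y))) ip)).
    exact: (measurable_comp measurableT _ mH (measurable_pair2 _)).
  by move=> x; rewrite mulrC.
have iH : (m \x m)%E.-integrable setT (fun z => (H (rV_of_tuple z.1) (rV_of_tuple z.2))%:E).
  apply/integrable12ltyP => //=.
  apply: (@le_lt_trans _ _ (\int[m]_x (`|p (rV_of_tuple x)|%:E * (integral_rV (fun y => `|q y|))%:E))%E).
    apply: ge0_le_integral => //.
    - by move=> x _; exact: integral_ge0.
    - apply: (@measurable_fun_fubini_tonelli_F _ _ _ _ R m
        (fun z => (`|H (rV_of_tuple z.1) (rV_of_tuple z.2)|)%:E)) => //.
      by apply/measurable_EFinP; exact: measurableT_comp.
    - apply/measurable_EFinP; apply: measurable_funM => //.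
      exact: (mes_norm (mes_itg ip)).
    - move=> x _; rewrite -EFinM -integral_rVZ; last exact: itg_norm.
      rewrite /integral_rV /Rintegral fineK; last first.
        apply: integrable_fin_num => //.
        by have := itgZ `|p (rV_of_tuple x)| (itg_norm iq).
      apply: ge0_le_integral => //=.
      + apply/measurable_EFinP; exact: (mes_norm (mes_itg (i1 _))).
      + apply/measurable_EFinP; apply: measurable_funM => //.
        exact: (mes_norm (mes_itg iq)).
      + by move=> y _; rewrite lee_fin -normrM (le_trans (Hpq _ _))// ler_norm.
  under eq_integral do rewrite muleC.
  rewrite ge0_integralZl_EFin//.
  - rewrite lte_mul_pinfty//.
      by rewrite lee_fin; exact: integral_rV_ge0.
    by have /integrableP[] := ip.
  - by apply/measurable_EFinP; exact: (mes_norm (mes_itg ip)).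
  - by apply: integral_rV_ge0.
have := Fubini iH => /= /(congr1 fine).
rewrite /integral_rV /Rintegral; congr (_ = _); congr fine.
- apply: eq_integral => x _ /=; rewrite fineK//; apply: integrable_fin_num => //.
  exact: i1.
- apply: eq_integral => y _ /=; rewrite fineK//; apply: integrable_fin_num => //.
  exact: i2.
Qed.

End integral_on_rV.

(** * Complex-valued integrals and differentiation under the integral sign *)

Section complex_integral.
Variables (R : realType) (d : nat).
Local Notation C := (Rcomplex R).
Local Notation E := 'rV[R]_d.
Local Notation dir := (@dir R d).
Implicit Types (f g : E -> C) (x y k : E) (i : 'I_d).

Definition cmes f := mes (fun x => cre (f x)) /\ mes (fun x => cim (f x)).
Definition citg f := itg (fun x => cre (f x)) /\ itg (fun x => cim (f x)).

Lemma cmes_continuous f : continuous f -> cmes f.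
Proof. by move=> /continuousCP[fr fi]; split; exact: mes_continuous. Qed.

Lemma citg_le f (g : E -> R) : cmes f -> itg g -> (forall x, `|f x| <= g x) -> citg f.
Proof.
move=> [fr fi] gi fg; split.
- by apply: (itg_le fr gi) => x; exact: (le_trans (cre_le _)).
- by apply: (itg_le fi gi) => x; exact: (le_trans (cim_le _)).
Qed.

Lemma citg_decay f (c : R) : cmes f ->
  (forall x, (1 + `|x|) ^+ (2 * d) * `|f x| <= c) -> citg f.
Proof.
move=> [fr fi] fc; split.
- apply: (itg_decay fr) => x; apply: le_trans (fc x).
  by rewrite ler_wpM2l ?cre_le// exprn_ge0// addr_ge0.
- apply: (itg_decay fi) => x; apply: le_trans (fc x).
  by rewrite ler_wpM2l ?cim_le// exprn_ge0// addr_ge0.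
Qed.

Lemma cintE f : cintegral_rV f =
  (integral_rV (fun x => cre (f x)) +i* integral_rV (fun x => cim (f x)))%C.
Proof. by []. Qed.

Lemma citgD f g : citg f -> citg g -> citg (fun x => f x + g x).
Proof.
move=> [fr fi] [gr gi]; split.
- by under eq_fun do rewrite creD; exact: itgD.
- by under eq_fun do rewrite cimD; exact: itgD.
Qed.

Lemma citgM (c : C) f : citg f -> citg (fun x => c * f x).
Proof.
move=> [fr fi]; split.
- by under eq_fun do rewrite creM; apply: itgB; exact: itgZ.
- by under eq_fun do rewrite cimM; apply: itgD; exact: itgZ.
Qed.

Lemma cintD f g : citg f -> citg g ->
  cintegral_rV (fun x => f x + g x) = cintegral_rV f + cintegral_rV g.
Proof.
move=> [fr fi] [gr gi]; rewrite !cintE.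
under eq_fun do rewrite creD.
under [X in (_ +i* integral_rV X)%C]eq_fun do rewrite cimD.
by rewrite !integral_rVD.
Qed.

Lemma cintM (c : C) f : citg f ->
  cintegral_rV (fun x => c * f x) = c * cintegral_rV f.
Proof.
move=> [fr fi]; rewrite [c in RHS]RcomplexE !cintE.
under eq_fun do rewrite creM.
under [X in (_ +i* integral_rV X)%C]eq_fun do rewrite cimM.
rewrite integral_rVB; [|exact: itgZ..].
rewrite integral_rVD; [|exact: itgZ..].
by rewrite !integral_rVZ.
Qed.

Lemma cintB f g : citg f -> citg g ->
  cintegral_rV (fun x => f x - g x) = cintegral_rV f - cintegral_rV g.
Proof.
move=> fi gi; rewrite -[in RHS]mulN1r -cintM// -cintD//; last exact: citgM.
by congr cintegral_rV; apply/funext => x; rewrite mulN1r.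
Qed.

Lemma cint_sum (I : Type) (r : seq I) (F : I -> E -> C) :
  (forall j, citg (F j)) ->
  citg (fun x => \sum_(j <- r) F j x) /\
  cintegral_rV (fun x => \sum_(j <- r) F j x) = \sum_(j <- r) cintegral_rV (F j).
Proof.
move=> Fi; elim: r => [|j r [ih1 ih2]].
  under eq_fun do rewrite big_nil.
  have c0 : citg (fun x : E => 0).
    have i0 : itg (fun x : E => 0 : R).
      apply: (itg_decay (c := 0)); first exact: mes_cst.
      by move=> x; rewrite normr0 mulr0.
    by split.
  split=> //; rewrite big_nil.
  transitivity ((0 : C) * cintegral_rV (fun _ : E => 0 : C)); last exact: mul0r.
  by rewrite -cintM//; congr cintegral_rV; apply/funext => x; rewrite mul0r.
under eq_fun do rewrite big_cons.
split; first exact: citgD.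
by rewrite big_cons -ih2 -cintD.
Qed.

(** The real and imaginary parts are estimated separately, whence the factor 2 that reappears in the
    later error bounds. *)
Lemma norm_cint f (g : E -> R) : citg f -> itg g -> (forall x, `|f x| <= g x) ->
  `|cintegral_rV f| <= 2 * integral_rV g.
Proof.
move=> [fr fi] gi fg; apply: (le_trans (cnorm_le _)); rewrite mulr2n mulrDl !mul1r.
apply: lerD; apply: (le_trans (norm_integral_rV _)) => //;
  apply: le_integral_rV => //; do ?exact: itg_norm.
- by move=> x; exact: (le_trans (cre_le _)).
- by move=> x; exact: (le_trans (cim_le _)).
Qed.

Lemma cint_affine f (a : R) (b : E) : a != 0 -> citg f ->
  citg (fun x => f (b + a *: x)) /\
  cintegral_rV (fun x => f (b + a *: x)) = (`|a| ^+ d)^-1 *: cintegral_rV f.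
Proof.
move=> a0 [fr fi]; have [r1 r2] := itg_affine b a0 fr; have [i1 i2] := itg_affine b a0 fi.
by split; [split|rewrite !cintE r2 i2].
Qed.

Let derive_under_integral (H DH : E -> E -> R) (G : E -> R) x i :
  (forall x, itg (H x)) -> itg G ->
  (forall x y, is_derive x (dir i) (H ^~ y) (DH x y)) ->
  (forall z y, `|z - x| <= 1 -> `|DH z y| <= G y) ->
  is_derive (0 : R) (1 : R) (fun u => integral_rV (H (x + u *: dir i))) (integral_rV (DH x)).
Proof.
move=> Hi Gi Hd HG.
have line (u : R) y : is_derive u (1 : R) (fun u => H (x + u *: dir i) y) (DH (x + u *: dir i) y).
  have := Hd (x + u *: dir i) y.
  have lineE : (fun h : R => h^-1 *: (H (h *: dir i + (x + u *: dir i)) y - H (x + u *: dir i) y))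
    = (fun h : R => h^-1 *: (H (x + (h *: (1 : R) + u) *: dir i) y - H (x + u *: dir i) y)).
    apply/funext => h; congr (_ *: (H _ _ - _)).
    by rewrite (_ : h *: (1 : R) = h) ?scalerDl 1?addrCA// /GRing.scale/= mulr1.
  by move=> [dr dl]; split; move: dr dl; rewrite /derivable /derive/= lineE.
(* The theorem on parameter integrals has one real parameter, so [x] moves along [dir i]. For
   parameters in []-1, 1[] it stays within distance 1 of its start, where [G] dominates the
   derivative. *)
pose f (u : R) (y : d.-tuple (measurableTypeR R)) := H (x + u *: dir i) (rV_of_tuple y).
have I0 : `]-1, 1[%classic (0 : R) by rewrite /= in_itv/= ltrN10 ltr01.
have fi u : `]-1, 1[%classic u -> (lebesgue_tuple R d).-integrable setT (EFin \o f u).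
  by move=> _; exact: Hi.
have fd u t : `]-1, 1[%classic u -> setT t -> derivable (f ^~ t) u 1.
  by move=> _ _; have [] := line u (rV_of_tuple t).
have d1E u t : partial1of2 f u t = DH (x + u *: dir i) (rV_of_tuple t).
  by rewrite partial1of2E; have [_] := line u (rV_of_tuple t).
have G0 t : 0 <= (G \o @rV_of_tuple R d) t by apply: le_trans (HG x _ _); rewrite ?subrr ?normr0.
have fG u t : `]-1, 1[%classic u -> setT t -> `|partial1of2 f u t| <= (G \o @rV_of_tuple R d) t.
  rewrite /= in_itv/= => /andP[u1 u2] _; rewrite d1E HG// addrC addKr normrZ.
  by rewrite mulr_ile1// ?norm_dir// ler_norml !ltW.
split.
  exact: (derivable_under_integral measurableT I0 fi fd G0 Gi fG).
have := differentiation_under_integral measurableT I0 fi fd G0 Gi fG.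
rewrite derive1E => ->; apply: eq_Rintegral => y _.
by rewrite d1E scale0r addr0.
Qed.

Lemma is_derive_cint (H DH : E -> E -> C) (G : E -> R) x i :
  (forall x, citg (H x)) -> itg G ->
  (forall x y, is_derive x (dir i) (H ^~ y) (DH x y)) ->
  (forall z y, `|z - x| <= 1 -> `|DH z y| <= G y) ->
  is_derive x (dir i) (fun x => cintegral_rV (H x)) (cintegral_rV (DH x)).
Proof.
move=> Hi Gi Hd HG.
suff : is_derive (0 : R) (1 : R) (fun u => cintegral_rV (H (x + u *: dir i)))
  (cintegral_rV (DH x)).
  by move=> /(@is_derive_of_line _ _ (fun x => cintegral_rV (H x))); rewrite scale0r addr0.
apply/is_derive_CP; split.
- apply: (@derive_under_integral (fun x y => cre (H x y)) (fun x y => cre (DH x y)) G) => //.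
  + by move=> z; case: (Hi z).
  + by move=> z y; exact: is_derive_cre.
  + by move=> z y zx; apply: (le_trans (cre_le _)); exact: HG.
- apply: (@derive_under_integral (fun x y => cim (H x y)) (fun x y => cim (DH x y)) G) => //.
  + by move=> z; case: (Hi z).
  + by move=> z y; exact: is_derive_cim.
  + by move=> z y zx; apply: (le_trans (cim_le _)); exact: HG.
Qed.

Lemma bounded_derive_lipschitz f (D : 'I_d -> E -> C) (L : R) : 0 <= L ->
  (forall y i, is_derive y (dir i) f (D i y)) -> (forall y i, `|D i y| <= L) ->
  forall x y, `|f x - f y| <= 2 * d%:R * L * `|x - y|.
Proof.
move=> L0 fD DL x y; have {1}-> : x = y + (x - y) by rewrite addrC subrK.
by apply: (path_bound L0 fD) => z i _; exact: DL.
Qed.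

Lemma lipschitz_continuous f (L : R) :
  (forall x y, `|f x - f y| <= L * `|x - y|) -> continuous f.
Proof.
move=> fL x; apply/(@cvgrPdist_le _ _ _ (nbhs x) (nbhs_filter x)) => e e0.
have L0 : 0 < `|L| + 1 by rewrite ltr_wpDl.
near=> y; apply: (le_trans (fL _ _)); apply: (@le_trans _ _ ((`|L| + 1) * `|x - y|)).
  by rewrite ler_wpM2r// (le_trans (ler_norm _))// lerDl.
rewrite mulrC -ler_pdivlMr//; near: y; apply: cvgr_dist_le; first exact: cvg_id.
by rewrite divr_gt0.
Unshelve. all: by end_near. Qed.

End complex_integral.

(** * Rapidly decreasing functions and the Fourier transform *)

Section fourier_transform.
Variables (R : realType) (d : nat).
Local Notation C := (Rcomplex R).
Local Notation E := 'rV[R]_d.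
Local Notation dir := (@dir R d).
Implicit Types (f g u : E -> C) (x y k : E) (i : 'I_d).

(** The weight [1 + |x|] replaces monomials because it is submultiplicative under translation, which
    makes decay estimates for shifted functions immediate. *)
Definition rapid f := continuous f /\
  forall m : nat, exists c : R, forall x, (1 + `|x|) ^+ m * `|f x| <= c.

Lemma weight_gt0 x : 0 < 1 + `|x|. Proof. by rewrite ltr_pwDl. Qed.
Hint Resolve weight_gt0 : core.

Lemma rapid_citg u : rapid u -> citg u.
Proof.
by move=> [uc /(_ (2 * d)%N)[c uC]]; apply: citg_decay uC; exact: cmes_continuous.
Qed.

Lemma continuous_norm_comp u : continuous u -> continuous (fun x => `|u x|).
Proof.
by move=> uc x; apply: (@continuous_comp _ _ _ u); [exact: uc|exact: norm_continuous].
Qed.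

Lemma weight_continuous m : continuous (fun x : E => (1 + `|x|) ^+ m).
Proof.
move=> x; apply: (@continuous_comp _ _ _ (fun x : E => 1 + `|x|) (fun r : R => r ^+ m)).
  exact: (cvgD (cvg_cst (1:R)) (@norm_continuous _ _ x)).
exact: exprn_continuous.
Qed.

Lemma rapid_moment u m : rapid u -> itg (fun x => (1 + `|x|) ^+ m * `|u x|).
Proof.
move=> [uc /(_ (2 * d + m)%N)[c uC]]; apply: (itg_decay (c := c)).
  apply: mesM; apply: mes_continuous; first exact: weight_continuous.
  exact: continuous_norm_comp.
move=> x; rewrite normrM normr_id ger0_norm; last by rewrite exprn_ge0// ltW.
by rewrite mulrA -exprD.
Qed.

Lemma rapid_norm u : rapid u -> itg (fun x => `|u x|).
Proof. by move=> /(rapid_moment 0); under eq_fun do rewrite expr0 mul1r. Qed.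

Lemma coord_continuous_rV i : continuous (fun x : E => x ord0 i).
Proof. exact: coord_continuous. Qed.

Lemma continuous_mul (T : topologicalType) (h1 h2 : T -> R) :
  continuous h1 -> continuous h2 -> continuous (fun z => h1 z * h2 z).
Proof. by move=> c1 c2 z; exact: (cvgM (c1 z) (c2 z)). Qed.

Lemma cofr_continuous (T : topologicalType) (h : T -> R) : continuous h ->
  continuous (fun z => cofr (h z) : C).
Proof. by move=> hc; apply/continuousCP; split => //; exact: cst_continuous. Qed.

Lemma rapid_coord (c : C) i u : rapid u -> rapid (fun y => c * cofr (y ord0 i) * u y).
Proof.
move=> [uc ud]; split.
  apply: continuousCM => //; apply: continuousCM; first exact: cst_continuous.
  by apply: cofr_continuous; exact: coord_continuous_rV.
move=> m; have [b ub] := ud m.+1; exists (`|c| * b) => x.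
rewrite !cnormM cnorm_cofr.
rewrite [leLHS](_ : _ = `|c| * (`|x ord0 i| * ((1 + `|x|) ^+ m * `|u x|))); last by ring.
rewrite ler_wpM2l//; apply: le_trans (ub x); rewrite exprS -mulrA ler_wpM2r//.
by rewrite (le_trans (coord_le _ _))// lerDr.
Qed.

Lemma dotpC k x : dotp k x = dotp x k.
Proof. by apply: eq_bigr => i _; rewrite mulrC. Qed.

Lemma dotpDl k k' x : dotp (k + k') x = dotp k x + dotp k' x.
Proof. by rewrite -big_split; apply: eq_bigr => i _; rewrite mxE mulrDl. Qed.

Lemma dotpZl (a : R) k x : dotp (a *: k) x = a * dotp k x.
Proof. by rewrite mulr_sumr; apply: eq_bigr => i _; rewrite mxE mulrA. Qed.

Lemma dotpZr (a : R) k x : dotp k (a *: x) = a * dotp k x.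
Proof. by rewrite !(dotpC k) dotpZl. Qed.

Lemma dotp_dir i x : dotp (dir i) x = x ord0 i.
Proof.
rewrite /dotp (bigD1 i)//= dirE eqxx mul1r big1 ?addr0// => j ji.
by rewrite dirE (negbTE ji) mul0r.
Qed.

Lemma dotp_continuous k : continuous (dotp k).
Proof.
rewrite /dotp; elim: (index_enum _) => [|i r ih].
  by under eq_fun do rewrite big_nil; exact: cst_continuous.
under eq_fun do rewrite big_cons.
move=> x; apply: (cvgD _ (ih x)).
have c1 : continuous (fun _ : E => k ord0 i) by exact: cst_continuous.
exact: (@continuous_mul _ _ _ c1 (@coord_continuous_rV i) x).
Qed.

Definition kern k x : C := cis (- (2 * pi * dotp k x)).

Lemma kernC k x : kern k x = kern x k.
Proof. by rewrite /kern dotpC. Qed.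

Lemma norm_kern k x : `|kern k x| = 1. Proof. exact: cnorm_cis. Qed.

Lemma kern_continuous k : continuous (kern k).
Proof.
move=> x; apply: (@continuous_comp _ _ _ (fun x => - (2 * pi * dotp k x)) (@cis R)).
  have c1 : continuous (fun _ : E => 2 * pi : R) by exact: cst_continuous.
  exact: (cvgN (@continuous_mul _ _ _ c1 (@dotp_continuous k) x)).
exact: cis_continuous.
Qed.

Lemma kernDl k k' x : kern (k + k') x = kern k x * kern k' x.
Proof. by rewrite /kern dotpDl mulrDr opprD cisD. Qed.

Lemma kernDr k x x' : kern k (x + x') = kern k x * kern k x'.
Proof. by rewrite !(kernC k) kernDl. Qed.

Lemma kernZ (a : R) k x : kern (a *: k) x = kern k (a *: x).
Proof. by rewrite /kern dotpZl dotpZr. Qed.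

Lemma is_derive_kern k x i : is_derive k (dir i) (fun k => kern k x)
  (Complex 0 (- (2 * pi)) * cofr (x ord0 i) * kern k x).
Proof.
rewrite -[k in is_derive k](addr0 k) -[X in k + X](scale0r (dir i)).
apply: is_derive_of_line.
have lin : is_derive (0 : R) (1 : R) (fun u : R => - (2 * pi * dotp (k + u *: dir i) x))
    (- (2 * pi * x ord0 i)).
  under eq_fun do rewrite dotpDl dotpZl dotp_dir.
  by apply: is_derive_eq; rewrite /GRing.scale/=; ring.
apply/is_derive_CP; split.
- have := is_derive1_comp (f := @cos R) (is_derive_cos _) lin.
  rewrite scale0r addr0 => /is_derive_eq; apply.
  by rewrite /kern /cis !creM/= ; ring.
- have := is_derive1_comp (f := @sin R) (is_derive_sin _) lin.
  rewrite scale0r addr0 => /is_derive_eq; apply.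
  by rewrite /kern /cis !cimM !creM/= ; ring.
Qed.

Lemma kernM_continuous k u : continuous u -> continuous (fun x => kern k x * u x).
Proof. by move=> uc; apply: continuousCM => //; exact: kern_continuous. Qed.

Lemma kernM_citg k u : rapid u -> citg (fun x => kern k x * u x).
Proof.
move=> ur; apply: (citg_le _ (rapid_norm ur)).
  by apply/cmes_continuous/kernM_continuous; have [] := ur.
by move=> x; rewrite cnormM norm_kern mul1r.
Qed.

Lemma is_derive_fourier u k i : rapid u -> is_derive k (dir i) (fourier u)
  (fourier (fun x => Complex 0 (- (2 * pi)) * cofr (x ord0 i) * u x) k).
Proof.
move=> ur; have ur' := rapid_coord (Complex 0 (- (2 * pi))) i ur.
apply: (is_derive_cint (H := fun k x => kern k x * u x)
  (DH := fun k x => kern k x * (Complex 0 (- (2 * pi)) * cofr (x ord0 i) * u x))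
  (G := fun x => `|Complex 0 (- (2 * pi)) * cofr (x ord0 i) * u x : C|)).
- by move=> k'; exact: kernM_citg.
- exact: rapid_norm.
- move=> k' x; have := is_deriveCM (is_derive_kern k' x i) (is_deriveCcst (u x) k' (dir i)).
  move=> /is_derive_eq; apply; rewrite mulr0 addr0.
  by rewrite mulrA [kern _ _ * _]mulrC.
- by move=> k' x _; rewrite cnormM norm_kern mul1r.
Qed.

Lemma fourier_bounded u : rapid u -> exists c : R, forall k, `|fourier u k| <= c.
Proof.
move=> ur; exists (2 * integral_rV (fun x => `|u x|)) => k.
apply: norm_cint; [exact: kernM_citg|exact: rapid_norm|].
by move=> x; rewrite cnormM norm_kern mul1r.
Qed.

(** The partial derivatives are Fourier transforms of rapid functions, hence bounded, so [fourier u]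
    is Lipschitz. *)
Lemma fourier_continuous u : rapid u -> continuous (fourier u).
Proof.
move=> ur.
pose D i := fourier (fun x => Complex 0 (- (2 * pi)) * cofr (x ord0 i) * u x).
have DB i : exists c : R, forall k, `|D i k| <= c.
  by apply: fourier_bounded; exact: rapid_coord.
have [c cD] := choice DB.
pose L := \sum_i `|c i|.
have L0 : 0 <= L by apply: sumr_ge0.
have DL k i : `|D i k| <= L.
  apply: (le_trans (cD _ _)); apply: (le_trans (ler_norm _)).
  by rewrite /L (bigD1 i)//= lerDl sumr_ge0.
apply: lipschitz_continuous; apply: (bounded_derive_lipschitz L0 _ DL).
by move=> k i; exact: is_derive_fourier.
Qed.

Lemma smooth_fourier u : rapid u -> smooth (fourier u).
Proof.
move=> ur; apply: (smooth_coind (P := fun f => exists2 u, rapid u & f = fourier u)); last by exists u.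
move=> _ [v vr ->]; split; first exact: fourier_continuous.
move=> i; eexists; first by move=> k; exact: is_derive_fourier.
by eexists; last reflexivity; exact: rapid_coord.
Qed.

Let cm2 (G : d.-tuple (measurableTypeR R) * d.-tuple (measurableTypeR R) -> C) :=
  measurable_fun setT (fun z => cre (G z)) /\ measurable_fun setT (fun z => cim (G z)).

Let cm2M G H : cm2 G -> cm2 H -> cm2 (fun z => G z * H z).
Proof.
move=> [G1 G2] [H1 H2]; split.
- by under eq_fun do rewrite creM; apply: measurable_funB; exact: measurable_funM.
- by under eq_fun do rewrite cimM; apply: measurable_funD; exact: measurable_funM.
Qed.

Let cint_eq f g : integral_rV (fun x => cre (f x)) = integral_rV (fun x => cre (g x)) ->
  integral_rV (fun x => cim (f x)) = integral_rV (fun x => cim (g x)) ->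
  cintegral_rV f = cintegral_rV g.
Proof. by move=> h1 h2; rewrite !cintE h1 h2. Qed.

(** The multiplication formula, by Fubini and the symmetry of the kernel. It stands in for Fourier
    inversion, both in [mollify_fourier] and in [fourier_unit_integral]. *)
Lemma fourier_mult u v : rapid u -> rapid v ->
  cintegral_rV (fun x => u x * fourier v x) = cintegral_rV (fun x => v x * fourier u x).
Proof.
move=> ur vr.
have E1 f g x : rapid g -> f x * fourier g x = cintegral_rV (fun y => f x * (kern x y * g y)).
  by move=> gr; rewrite cintM//; exact: kernM_citg.
under eq_fun do rewrite E1//.
rewrite [RHS](_ : _ = cintegral_rV (fun y => cintegral_rV (fun x => v y * (kern y x * u x)))); last first.
  by congr cintegral_rV; apply/funext => y; exact: E1.
have mH : cm2 (fun z => u (rV_of_tuple z.1) *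
    (kern (rV_of_tuple z.1) (rV_of_tuple z.2) * v (rV_of_tuple z.2))).
  have [[u1 u2] [v1 v2]] := (cmes_continuous ur.1, cmes_continuous vr.1).
  apply: cm2M; [|apply: cm2M].
  - by split; [exact: (measurableT_comp u1 measurable_fst)|exact: (measurableT_comp u2 measurable_fst)].
  - have mth : measurable_fun [set: d.-tuple (measurableTypeR R) * d.-tuple (measurableTypeR R)]
       (fun z => - (2 * pi * dotp (rV_of_tuple z.1) (rV_of_tuple z.2))).
      apply: measurableT_comp => //; apply: measurable_funM => //.
      rewrite /dotp; apply: measurable_sum => i.
      apply: measurable_funM.
        exact: (measurableT_comp (mes_coord i) measurable_fst).
      exact: (measurableT_comp (mes_coord i) measurable_snd).
    split; apply: measurableT_comp mth.
      by apply: continuous_measurable_fun; exact: continuous_cos.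
    by apply: continuous_measurable_fun; exact: continuous_sin.
  - by split; [exact: (measurableT_comp v1 measurable_snd)|exact: (measurableT_comp v2 measurable_snd)].
have bH x y : `|u x * (kern x y * v y) : C| <= `|u x| * `|v y|.
  by rewrite !cnormM norm_kern mul1r.
have E2 x y : v y * (kern y x * u x) = u x * (kern x y * v y).
  by rewrite (kernC y) mulrCA [RHS]mulrCA (mulrC (v y)).
apply: cint_eq.
- rewrite (integral_rV_Fubini mH.1 (rapid_norm ur) (rapid_norm vr)); last first.
    by move=> x y; exact: (le_trans (cre_le _)).
  congr integral_rV; apply/funext => y; congr integral_rV; apply/funext => x.
  by rewrite E2.
- rewrite (integral_rV_Fubini mH.2 (rapid_norm ur) (rapid_norm vr)); last first.
    by move=> x y; exact: (le_trans (cim_le _)).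
  congr integral_rV; apply/funext => y; congr integral_rV; apply/funext => x.
  by rewrite E2.
Qed.

End fourier_transform.

(** * Mollification *)

Section mollification.
Variables (R : realType) (d : nat).
Local Notation C := (Rcomplex R).
Local Notation E := 'rV[R]_d.
Local Notation dir := (@dir R d).
Implicit Types (f g phi psi : E -> C) (x y k : E) (i : 'I_d) (s : seq 'I_d).

Lemma bounded_imageP (T : Type) (h : T -> C) :
  bounded_fun h <-> exists c : R, forall t, `|h t| <= c.
Proof.
split=> [|[c hc]].
  move=> [c [_ hc]]; exists (c + 1) => t; apply: hc => //.
  by rewrite ltrDl.
by exists c; split; [exact: num_real|move=> y cy t _; exact: le_trans (hc t) (ltW cy)].
Qed.

Lemma norm_expr_le x m : `|x| ^+ m <= 1 + \sum_i `|x ord0 i| ^+ m.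
Proof.
have s0 : 0 <= \sum_i `|x ord0 i| ^+ m by apply: sumr_ge0 => i _; rewrite exprn_ge0.
have [x0|x0] := eqVneq `|x| 0.
  rewrite x0; case: m s0 => [|m] s0; first by rewrite expr0 lerDl.
  by rewrite expr0n/= addr_ge0.
have [[k i] xi] := mx_norm_neq0 x0.
have {}xi : `|x| = `|x ord0 i| by rewrite -[ord0](ord1 k); exact: xi.
rewrite xi.
rewrite (bigD1 i)//= addrCA lerDl addr_ge0// sumr_ge0// => j _; exact: exprn_ge0.
Qed.

(** Only pure powers of single coordinates occur on the right, so weighted bounds follow from
    finitely many monomial seminorms. *)
Lemma weight_expr_le x m : (1 + `|x|) ^+ m <= 2 ^+ m * (2 + \sum_i `|x ord0 i| ^+ m).
Proof.
apply: (@le_trans _ _ (2 ^+ m * (1 + `|x| ^+ m))); last first.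
  rewrite ler_wpM2l ?exprn_ge0//.
  by rewrite (_ : 2 = 1 + 1 :> R)// -addrA lerD2l norm_expr_le.
have [x1|x1] := leP `|x| 1.
  apply: (@le_trans _ _ (2 ^+ m)).
    by apply: lerXn2r; rewrite ?nnegrE ?addr_ge0//; rewrite (_ : 2 = 1 + 1 :> R)// lerD2l.
  by rewrite ler_peMr ?exprn_ge0// lerDl exprn_ge0.
apply: (@le_trans _ _ (2 ^+ m * `|x| ^+ m)).
  rewrite -exprMn; apply: lerXn2r; rewrite ?nnegrE ?addr_ge0 ?mulr_ge0//.
  by rewrite (_ : 2 = 1 + 1 :> R)// mulrDl mul1r lerD2r ltW.
by rewrite ler_wpM2l ?exprn_ge0// lerDr.
Qed.

Lemma schwartzP f : schwartz f <-> smooth f /\ forall s, rapid (partials s f).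
Proof.
split=> -[fs fb]; split=> //.
  move=> s.
  split; first exact: (smooth_continuous (smooth_partials s fs)).
  move=> m.
  have /bounded_imageP[c0 c0f] := fb (fun=> 0%N) s.
  have fbi i : exists c : R, forall x, `|schwartz_term (fun j => if j == i then m else 0%N) s f x| <= c.
    exact/bounded_imageP.
  have [c cf] := choice fbi.
  exists (2 ^+ m * (2 * c0 + \sum_i c i)) => x.
  apply: (le_trans (ler_wpM2r (normr_ge0 _) (weight_expr_le x m))).
  rewrite -mulrA ler_wpM2l ?exprn_ge0// mulrDl; apply: lerD.
    rewrite ler_wpM2l//; have := c0f x; rewrite /schwartz_term /monomial big1 ?scale1r//.
  rewrite mulr_suml; apply: ler_sum => i _.
  have := cf i x; rewrite /schwartz_term /monomial (bigD1 i)//= eqxx big1 ?mulr1.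
    by rewrite normrZ normrX.
  by move=> j /negbTE ->; rewrite expr0.
move=> a s; apply/bounded_imageP; have [_ /(_ (\sum_i a i)%N)[c fc]] := fb s.
exists c => x; apply: le_trans (fc x); rewrite normrZ ler_wpM2r//.
rewrite /monomial normr_prod -prodrXr; apply: ler_prod => i _.
rewrite normr_ge0/= normrX; apply: lerXn2r; rewrite ?nnegrE ?addr_ge0//.
by rewrite (le_trans (coord_le _ _))// lerDr.
Qed.

(** The natural domain of [mollify] with a rapid [psi]: bounded derivatives, integrated against
    [psi], have an integrable majorant, and the class is closed under [partial]. *)
Definition bsmooth f := smooth f /\ forall s, exists c : R, forall x, `|partials s f x| <= c.

Lemma rapid_bounded f : rapid f -> exists c : R, forall x, `|f x| <= c.
Proof. by move=> [_ /(_ 0%N)[c fc]]; exists c => x; have := fc x; rewrite expr0 mul1r. Qed.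

Lemma schwartz_bsmooth f : schwartz f -> bsmooth f.
Proof. by move=> /schwartzP[fs fr]; split => // s; exact: rapid_bounded. Qed.

Lemma schwartz_rapid f : schwartz f -> rapid f.
Proof. by move=> /schwartzP[_ /(_ [::])]. Qed.

Lemma schwartz_smooth f : schwartz f -> smooth f.
Proof. by case. Qed.

Lemma bsmooth_partial f i : bsmooth f -> bsmooth (partial i f).
Proof.
by move=> [fs fb]; split; [exact: smooth_partial|move=> s; rewrite -partials_rcons].
Qed.

Lemma schwartz_partial f i : schwartz f -> schwartz (partial i f).
Proof.
move=> /schwartzP[fs fr]; apply/schwartzP.
by split; [exact: smooth_partial|move=> s; rewrite -partials_rcons].
Qed.

(** Convolution with [psi] dilated by [r], written after the substitution that leaves [psi] fixed:
    no power of [r] appears, and derivatives in [x] fall on [phi]. *)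
Definition mollify (r : R) psi phi : E -> C :=
  fun x => cintegral_rV (fun z => phi (x - r *: z) * psi z).

Lemma comp_affine_continuous f (r : R) x : continuous f -> continuous (fun z : E => f (x - r *: z)).
Proof.
move=> fc z; apply: (@continuous_comp _ _ _ (fun z : E => x - r *: z) f); last exact: fc.
exact: (cvgB (cvg_cst x) (cvgZl_tmp (k := r) cvg_id)).
Qed.

Lemma mollify_citg (r : R) psi phi x : rapid psi -> continuous phi ->
  (exists c : R, forall x, `|phi x| <= c) -> citg (fun z => phi (x - r *: z) * psi z).
Proof.
move=> pr pc [c pb]; apply: (citg_le _ (itgZ c (rapid_norm pr))).
  apply: cmes_continuous; apply: continuousCM; last by case: pr.
  exact: comp_affine_continuous.
by move=> z; rewrite cnormM ler_wpM2r.
Qed.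

Lemma is_derive_mollify (r : R) psi phi x i : rapid psi -> bsmooth phi ->
  is_derive x (dir i) (mollify r psi phi) (mollify r psi (partial i phi) x).
Proof.
move=> pr pb; have [ps pbd] := pb; have [c pc] := pbd [:: i].
apply: (is_derive_cint (H := fun x z => phi (x - r *: z) * psi z)
  (DH := fun x z => partial i phi (x - r *: z) * psi z) (G := fun z => c * `|psi z|)).
- move=> y; apply: mollify_citg => //; first exact: smooth_continuous.
  exact: (pbd [::]).
- exact: itgZ (rapid_norm pr).
- move=> y z.
  have h1 : is_derive y (dir i) (fun y => phi (y - r *: z)) (partial i phi (y - r *: z)).
    have := @is_derive_affine _ _ phi 1 (- (r *: z)) y (dir i) (partial i phi (y - r *: z)).
    rewrite !scale1r addrC; under eq_fun do rewrite scale1r addrC.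
    by apply; exact: smooth_is_derive.
  have := is_deriveCM h1 (is_deriveCcst (psi z) y (dir i)).
  by rewrite mulr0 addr0.
- by move=> y z _; rewrite cnormM ler_wpM2r// pc.
Qed.

Lemma mollify_continuous (r : R) psi phi : rapid psi -> bsmooth phi ->
  continuous (mollify r psi phi).
Proof.
move=> pr pb.
have bd f : bsmooth f -> exists c : R, forall x, `|mollify r psi f x| <= c.
  move=> [fs fb]; have [c fc] := fb [::].
  exists (2 * integral_rV (fun z => c * `|psi z|)) => x; apply: norm_cint.
  - by apply: mollify_citg => //; [exact: smooth_continuous|exists c].
  - exact: itgZ (rapid_norm pr).
  - by move=> z; rewrite cnormM ler_wpM2r// fc.
have [c cD] := choice (fun i => bd _ (bsmooth_partial i pb)).
pose L := \sum_i `|c i|.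
have L0 : 0 <= L by apply: sumr_ge0.
apply: lipschitz_continuous; apply: (bounded_derive_lipschitz L0) => [x i|x i].
  exact: is_derive_mollify.
apply: (le_trans (cD _ _)); apply: (le_trans (ler_norm _)).
by rewrite /L (bigD1 i)//= lerDl sumr_ge0.
Qed.

Lemma mollify_smooth (r : R) psi phi : rapid psi -> bsmooth phi ->
  smooth (mollify r psi phi) /\
  forall s, partials s (mollify r psi phi) = mollify r psi (partials s phi).
Proof.
move=> pr pb; split.
  apply: (smooth_coind (P := fun f => exists2 g, bsmooth g & f = mollify r psi g)); last by exists phi.
  move=> _ [g gb ->]; split; first exact: mollify_continuous.
  move=> i; exists (mollify r psi (partial i g)); first by move=> x; exact: is_derive_mollify.
  by exists (partial i g) => //; exact: bsmooth_partial.
have bs s : bsmooth (partials s phi).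
  by elim: s => //= i s; exact: bsmooth_partial.
elim => //= i s ih; apply/funext => x; rewrite -!/(partials _ _) ih /partial.
by have [_ ->] := is_derive_mollify r x i pr (bs s).
Qed.

(** A Peetre-type inequality: the weight at [x] is shared between the decay of the translate of
    [phi] and a moment of [psi]. *)
Lemma weight_le (r : R) x z : 1 + `|x| <= (1 + `|x - r *: z|) * ((1 + `|r|) * (1 + `|z|)).
Proof.
apply: (@le_trans _ _ ((1 + `|x - r *: z|) * (1 + `|r *: z|))).
  have : `|x| <= `|x - r *: z| + `|r *: z| by rewrite -{1}(subrK (r *: z) x) ler_normD.
  have : 0 <= `|x - r *: z| * `|r *: z| by rewrite mulr_ge0.
  rewrite mulrDl mul1r mulrDr mulr1; lra.
rewrite ler_wpM2l ?addr_ge0// normrZ.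
have := normr_ge0 r; have := normr_ge0 z; rewrite mulrDl mul1r mulrDr mulr1; lra.
Qed.

Lemma mollify_schwartz (r : R) psi phi : rapid psi -> schwartz phi ->
  schwartz (mollify r psi phi).
Proof.
move=> pr ps; have pb := schwartz_bsmooth ps.
have [ms mp] := mollify_smooth r pr pb; apply/schwartzP; split => // s.
rewrite mp; split; first by rewrite -mp; exact: (smooth_continuous (smooth_partials s ms)).
move=> m; have /schwartzP[_ /(_ s)[pc /(_ m)[c cp]]] := ps.
have c0 : 0 <= c by apply: le_trans (cp 0); rewrite mulr_ge0// exprn_ge0// addr_ge0.
pose G z := c * (1 + `|r|) ^+ m * ((1 + `|z|) ^+ m * `|psi z|).
exists (2 * integral_rV G) => x.
have W0 : 0 <= (1 + `|x|) ^+ m by rewrite exprn_ge0// addr_ge0.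
have -> : (1 + `|x|) ^+ m * `|mollify r psi (partials s phi) x| =
    `|cofr ((1 + `|x|) ^+ m) * mollify r psi (partials s phi) x : C|.
  by rewrite cnormM cnorm_cofr ger0_norm.
have ci : citg (fun z => partials s phi (x - r *: z) * psi z).
  by apply: mollify_citg => //; exact: pb.2.
rewrite /mollify -cintM//; apply: norm_cint; first exact: citgM.
  exact: itgZ (rapid_moment m pr).
move=> z; rewrite !cnormM cnorm_cofr ger0_norm// /G.
rewrite [leRHS](_ : _ = c * ((1 + `|r|) * (1 + `|z|)) ^+ m * `|psi z|); last by rewrite exprMn; ring.
rewrite mulrA ler_wpM2r//.
apply: (@le_trans _ _ (((1 + `|x - r *: z|) * ((1 + `|r|) * (1 + `|z|))) ^+ m * `|partials s phi (x - r *: z)|)).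
  rewrite ler_wpM2r//; apply: lerXn2r; rewrite ?nnegrE ?mulr_ge0 ?addr_ge0//.
  exact: weight_le.
rewrite exprMn mulrAC ler_wpM2r// exprn_ge0// mulr_ge0 ?addr_ge0//.
Qed.

End mollification.

(** * Quadrature *)

Section quadrature.
Variables (R : realType) (d : nat).
Local Notation C := (Rcomplex R).
Local Notation E := 'rV[R]_d.
Implicit Types (psi H : E -> C) (x y z : E) (i : 'I_d).

Section grid.
Variable n : nat.
Hypothesis n0 : (0 < n)%N.

(* [cell z] lists the comparisons of the coordinates of [z] with the nodes; the
   [good] patterns are those of the bounded cells, which are cubes of side [1/n]. *)
Let node (a : nat) : R := a%:R / n%:R - n%:R.
Let J := {ffun 'I_d * 'I_(2 * n * n).+1 -> bool}.
Let cell z : J := [ffun p : 'I_d * 'I_(2 * n * n).+1 => node p.2 <= z ord0 p.1].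
Let good (j : J) : bool := [forall i, j (i, ord0) && ~~ j (i, ord_max)].
Let ind (j : J) z : R := (good j && (cell z == j))%:R.
(** Patterns that no point realises get the default 0, which is harmless since [ind j] then vanishes
    identically. *)
Let pt (j : J) : E := xget 0 [set z | cell z = j].

Let nR0 : 0 < n%:R :> R. Proof. by rewrite ltr0n. Qed.

Let mes_ind j : mes (ind j).
Proof.
have E1 z : ind j z = (good j)%:R * \prod_(p : 'I_d * 'I_(2 * n * n).+1) (((node p.2 <= z ord0 p.1) == j p)%:R).
  rewrite /ind; case: (good j); last by rewrite mul0r.
  rewrite mul1r andTb; have [<-|/eqP ne] := eqVneq (cell z) j.
    by rewrite big1// => p _; rewrite ffunE eqxx.
  have [p Hp] : exists p, cell z p != j p.
    by apply/existsP; apply: contra_notT ne => /existsPn H; apply/ffunP => p; have /negPn/eqP := H p.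
  by rewrite (bigD1 p)//=; move: Hp; rewrite ffunE => /negbTE ->; rewrite mul0r.
rewrite (_ : ind j = fun z => (good j)%:R * \prod_(p : 'I_d * 'I_(2 * n * n).+1) (((node p.2 <= z ord0 p.1) == j p)%:R)); last first.
  exact/funext.
apply: mesM; first exact: mes_cst.
rewrite /mes; apply: measurable_prod => p _ /=.
have mb : measurable_fun [set: measurableTypeR R] (fun u : R => ((node p.2 <= u) == j p)%:R : R).
  rewrite (_ : (fun _ => _) = \1_(if j p then `[node p.2, +oo[%classic else `]-oo, node p.2[%classic)).
    by apply: measurable_indic; case: (j p); exact: measurable_itv.
  apply/funext => u; rewrite indicE; congr (_%:R).
  case: (j p).
    by rewrite eqb_id mem_setE in_itv/= andbT.
  by rewrite eqbF_neg -ltNge mem_setE in_itv.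
exact: (measurableT_comp mb (mes_coord p.1)).
Qed.

Let near z j : ind j z = 1 -> `|z - pt j| <= n%:R^-1.
Proof.
rewrite /ind; case: (boolP (good j)) => [gj|_]; last by move=> /eqP; rewrite eq_sym oner_eq0.
case: eqP => [zj _|_ /eqP]; last by rewrite eq_sym oner_eq0.
have qj : cell (pt j) = j by apply: (@xgetPex _ 0 [set z | cell z = j]); exists z.
apply: norm_rV_le => [|i]; first by rewrite invr_ge0 ltW.
have /andP[] := forallP gj i; rewrite -zj !ffunE/= -ltNge => lo hi.
have u0 : 0 <= n%:R * (z ord0 i + n%:R).
  by apply: mulr_ge0; [exact: ltW|rewrite -lerBlDr sub0r; move: lo; rewrite /node mul0r sub0r].
(* The index of the last node not exceeding the coordinate of [z]. The pattern [j] is good, so the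
   coordinate lies below the last node [n]; hence [a.+1] is still an index of a node, and [pt j] is
   caught between the same two nodes. *)
set a := Num.truncn (n%:R * (z ord0 i + n%:R)).
have /andP[al ar] := truncn_itv u0; rewrite -/a in al ar.
have a1 : (a.+1 < (2 * n * n).+1)%N.
  rewrite ltnS -(ltr_nat R); apply: le_lt_trans al _.
  move: hi; rewrite /node/= natrM mulfK ?gt_eqF// natrM mulr_natl mulr2n addrK => hi.
  by rewrite [X in _ < X]mulrC ltr_pM2l// ltrD2r.
have a0 : (a < (2 * n * n).+1)%N by apply: leq_trans a1.
have nodeE (b : nat) u : (node b <= u) = (b%:R <= n%:R * (u + n%:R)).
  by rewrite /node lerBlDr ler_pdivrMr// mulrC.
have c1 : (node a <= pt j ord0 i).
  by have := congr1 (fun g : J => g (i, Ordinal a0)) (etrans qj (esym zj)); rewrite !ffunE/= (nodeE a (z _ _)) al.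
have c2 : (node a.+1 <= pt j ord0 i) = false.
  have := congr1 (fun g : J => g (i, Ordinal a1)) (etrans qj (esym zj)).
  by rewrite !ffunE/= (nodeE a.+1 (z _ _)) => ->; rewrite leNgt ar.
move/negbT : c2; rewrite -ltNge => c2.
have c3 : node a <= z ord0 i by rewrite nodeE.
have c4 : z ord0 i < node a.+1 by rewrite ltNge nodeE -ltNge.
have nS : node a.+1 = node a + n%:R^-1.
  by rewrite /node -natr1 mulrDl mul1r addrAC.
rewrite zj !mxE ler_norml; move: c1 c2 c3 c4; rewrite nS; lra.
Qed.

Let far z : (forall j, ind j z = 0) -> n%:R <= 1 + `|z|.
Proof.
move=> /(_ (cell z)); rewrite /ind eqxx andbT; case: (boolP (good _)); first by move=> _ /eqP; rewrite oner_eq0.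
move=> ng _; move: ng; rewrite /good negb_forall; case/existsP => i.
rewrite negb_and negbK !ffunE/= => /orP[|] h.
  move: h; rewrite /node -ltNge mul0r sub0r => h.
  apply: (@le_trans _ _ `|z|); last by rewrite lerDr.
  by apply: le_trans (coord_le z i); rewrite ler_normr orbC; apply/orP; left; rewrite lerNr ltW.
move: h; rewrite /node natrM mulfK ?gt_eqF// natrM mulr_natl mulr2n addrK => h.
apply: (@le_trans _ _ `|z|); last by rewrite lerDr.
by apply: le_trans (coord_le z i); rewrite ler_normr h.
Qed.

Let ind_uniq z j j' : ind j z = 1 -> j' != j -> ind j' z = 0.
Proof.
rewrite /ind; case: (cell z =P j) => [->|_]; last by rewrite andbF => /eqP; rewrite eq_sym oner_eq0.
by move=> _ jj'; rewrite eq_sym (negbTE jj') andbF.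
Qed.

Let ind01 j z : ind j z = 1 \/ ind j z = 0.
Proof. by rewrite /ind; case: (_ && _); [left|right]. Qed.

(** The weights are the integrals of [psi] over the cells. Inside the cube the local Lipschitz bound
    gives the error [1 / n]; outside it [n <= 1 + |z|], so the gain [1 / n] is paid with one more
    power of the weight. This is the origin of [m.+1]. *)
Lemma quadrature_step psi : rapid psi ->
  exists (q : J -> E) (w : J -> C), forall H m (c : R), 0 <= c -> continuous H ->
    (forall z, `|H z| <= c * (1 + `|z|) ^+ m) ->
    (forall z y, `|z - y| <= 1 -> `|H z - H y| <= c * `|z - y| * (1 + `|z|) ^+ m) ->
    `|\sum_j w j * H (q j) - cintegral_rV (fun z => H z * psi z) : C|
      <= c / n%:R * (2 * integral_rV (fun z => (1 + `|z|) ^+ m.+1 * `|psi z|)).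
Proof.
move=> pr.
have [pmr pmi] := cmes_continuous pr.1.
have ci j : citg (fun z => cofr (ind j z) * psi z).
  apply: (citg_le _ (rapid_norm pr)) => [|z].
    split.
      by under eq_fun do rewrite cofrM creZ; apply: mesM.
    by under eq_fun do rewrite cofrM cimZ; apply: mesM.
  by rewrite cnormM cnorm_cofr ler_piMl//; case: (ind01 j z) => ->; rewrite ?normr1 ?normr0.
exists pt, (fun j => cintegral_rV (fun z => cofr (ind j z) * psi z)).
move=> H m c c0 Hc Hb Hl.
have Hi : citg (fun z => H z * psi z).
  apply: (citg_le _ (itgZ c (rapid_moment m pr))).
    by apply: cmes_continuous; apply: continuousCM => //; case: pr.
  by move=> z; rewrite cnormM mulrA ler_wpM2r.
have := @cint_sum _ _ _ (index_enum J) (fun j z => H (pt j) * (cofr (ind j z) * psi z)) (fun j => citgM _ (ci j)).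
move=> [si sE].
have -> : \sum_j cintegral_rV (fun z => cofr (ind j z) * psi z) * H (pt j) =
    cintegral_rV (fun z => \sum_j H (pt j) * (cofr (ind j z) * psi z)).
  by rewrite sE; apply: eq_bigr => j _; rewrite cintM// mulrC.
rewrite -cintB// mulrCA -integral_rVZ; last exact: rapid_moment.
apply: norm_cint.
- by apply: citgD => //; have := citgM (-1) Hi; under eq_fun do rewrite mulN1r.
- exact: itgZ (rapid_moment _ pr).
move=> z.
have W1 : 1 <= 1 + `|z| by rewrite lerDl.
have W0 : 0 <= (1 + `|z|) ^+ m by rewrite exprn_ge0// addr_ge0.
have [/existsP[j /eqP jz]|/existsPn H0] := boolP [exists j, ind j z == 1].
  rewrite (bigD1 j)//= big1 ?addr0; last first.
    by move=> j' j'j; rewrite (ind_uniq jz j'j) (_ : cofr 0 = 0 :> C)// mul0r mulr0.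
  rewrite jz (_ : cofr 1 = 1 :> C)// mul1r -mulrBl cnormM mulrA ler_wpM2r// distrC.
  have n1 : n%:R^-1 <= 1 :> R by rewrite invf_le1// ler1n.
  apply: (le_trans (Hl _ _ (le_trans (near jz) n1))).
  rewrite -mulrA -mulrA ler_wpM2l// ler_pM ?near//.
  by rewrite exprS ler_peMl.
have H1 j : ind j z = 0 by have := H0 j; case: (ind01 j z) => ->; rewrite ?eqxx.
rewrite big1 ?sub0r; last by move=> j _; rewrite H1 (_ : cofr 0 = 0 :> C)// mul0r mulr0.
rewrite normrN cnormM mulrA ler_wpM2r//; apply: (le_trans (Hb z)).
rewrite -mulrA ler_wpM2l// exprS mulrA ler_peMl// mulrC ler_pdivlMr// mul1r.
exact: far.
Qed.

End grid.

(* Nodes and weights depend neither on [H] nor on the growth exponent [m]; hence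
   the same sums converge in every Schwartz seminorm. *)
Lemma quadrature psi : rapid psi ->
  exists r : nat -> seq (C * E), forall m, exists M : R, forall n, (0 < n)%N ->
    forall H (c : R), 0 <= c -> continuous H ->
    (forall z, `|H z| <= c * (1 + `|z|) ^+ m) ->
    (forall z y, `|z - y| <= 1 -> `|H z - H y| <= c * `|z - y| * (1 + `|z|) ^+ m) ->
    `|\sum_(p <- r n) p.1 * H p.2 - cintegral_rV (fun z => H z * psi z) : C|
      <= c / n%:R * M.
Proof.
move=> pr.
have /choice[r rP] : forall n, exists r : seq (C * E), (0 < n)%N ->
    forall H m (c : R), 0 <= c -> continuous H ->
    (forall z, `|H z| <= c * (1 + `|z|) ^+ m) ->
    (forall z y, `|z - y| <= 1 -> `|H z - H y| <= c * `|z - y| * (1 + `|z|) ^+ m) ->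
    `|\sum_(p <- r) p.1 * H p.2 - cintegral_rV (fun z => H z * psi z) : C|
      <= c / n%:R * (2 * integral_rV (fun z => (1 + `|z|) ^+ m.+1 * `|psi z|)).
  move=> n; have [n0|] := boolP (0 < n)%N; last by exists [::].
  have [q [w qw]] := quadrature_step n0 pr.
  exists [seq (w j, q j) | j <- index_enum _] => _ H m c c0 Hc Hb Hl.
  by rewrite big_map; exact: qw.
by exists r => m; eexists => n n0 H c c0 Hc Hb Hl; exact: rP.
Qed.

End quadrature.

(** * Almost periodicity *)

Section almost_periodicity.
Variables (R : realType) (d : nat).
Local Notation C := (Rcomplex R).
Local Notation E := 'rV[R]_d.
Implicit Types (f g h : E -> C) (x t k : E).

Lemma supnorm_le f (c : R) : (forall x, `|f x| <= c) -> supnorm f <= c.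
Proof.
move=> fc; apply: ge_sup; first by exists `|f 0|; exists 0.
by move=> _ [x _ <-].
Qed.

Lemma le_supnorm f x : (exists c : R, forall x, `|f x| <= c) -> `|f x| <= supnorm f.
Proof.
move=> [c fc]; apply: ub_le_sup; last by exists x.
by exists c => _ [y _ <-].
Qed.

Definition trigpoly (r : seq (C * E)) : E -> C := fun t => \sum_(p <- r) p.1 * kern p.2 t.

Definition trig_approx f := forall e : R, 0 < e ->
  exists r, forall t, `|f t - trigpoly r t| <= e.

Lemma trigpoly_continuous r : continuous (trigpoly r).
Proof.
rewrite /trigpoly; elim: r => [|p r ih].
  by under eq_fun do rewrite big_nil; exact: cst_continuous.
under eq_fun do rewrite big_cons.
have c1 : continuous (fun t => p.1 * kern p.2 t).
  by apply: continuousCM; [exact: cst_continuous|exact: kern_continuous].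
by move=> x; exact: (cvgD (@c1 x) (ih x)).
Qed.

Lemma trigpoly_bound r t : `|trigpoly r t| <= \sum_(p <- r) `|p.1|.
Proof.
apply: (le_trans (ler_norm_sum _ _ _)); apply: ler_sum => p _.
by rewrite cnormM norm_kern mulr1.
Qed.

(* Pigeonhole: two points whose characters lie in the same cell of the torus
   differ by an almost period, and there are finitely many cells. *)
Lemma near_periods (r : seq E) (e : R) : 0 < e ->
  relatively_dense [set t | forall k, k \in r -> `|kern k (- t) - 1| <= e].
Proof.
move=> e0.
have [n ne] : exists n : nat, n.+1%:R^-1 <= e / 2.
  exists (Num.truncn (e / 2)^-1); rewrite ltW// invf_plt ?posrE ?divr_gt0//.
  exact: truncnS_gt.
(* The interval [[-1, 1]] is cut into [2 * n.+1] pieces of length [1 / n.+1]; the right end point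
   needs one further index. *)
pose idx (u : R) : 'I_(2 * n.+1).+1 := inord (Num.truncn (n.+1%:R * (u + 1))).
have idxP u v : `|u| <= 1 -> `|v| <= 1 -> idx u = idx v -> `|u - v| <= n.+1%:R^-1.
  have tr w : `|w| <= 1 -> 0 <= n.+1%:R * (w + 1) :> R /\
      (Num.truncn (n.+1%:R * (w + 1)) < (2 * n.+1).+1)%N.
    rewrite ler_norml => /andP[w1 w2]; have w0 : 0 <= n.+1%:R * (w + 1) :> R.
      by rewrite mulr_ge0// -lerBlDr sub0r.
    split => //; rewrite ltnS -(ler_nat R); have /andP[+ _] := truncn_itv w0.
    move=> /le_trans; apply; rewrite natrM mulrC ler_wpM2r//.
    by rewrite (_ : 2 = 1 + 1 :> R)// lerD2r.
  move=> /tr[u0 ut] /tr[v0 vt] /(congr1 val); rewrite /= !inordK// => uv.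
  have /andP[u1 u2] := truncn_itv u0; have /andP[v1 v2] := truncn_itv v0.
  rewrite uv in u1 u2.
  have n0 : 0 < n.+1%:R :> R by [].
  rewrite -[leRHS]mul1r ler_pdivlMr// -[X in _ * X](gtr0_norm n0) -normrM.
  rewrite (_ : (u - v) * n.+1%:R = n.+1%:R * (u + 1) - n.+1%:R * (v + 1)); last by ring.
  rewrite ler_norml; move: u1 u2 v1 v2; rewrite -natr1; lra.
pose cell (z : E) : {ffun 'I_(size r) -> 'I_(2 * n.+1).+1 * 'I_(2 * n.+1).+1} :=
  [ffun i : 'I_(size r) => (idx (cre (kern (nth 0 r i) z)), idx (cim (kern (nth 0 r i) z)))].
pose rep j : E := xget 0 [set z | cell z = j].
(* The almost period found near [x] is [x - rep (cell x)], at distance [|rep (cell x)|] from [x].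
   Since there are finitely many cells, [rho] exceeds all these distances. *)
pose rho : R := 1 + \sum_j `|rep j|.
have rho0 : 0 < rho by rewrite ltr_pwDl// sumr_ge0.
exists rho => // x; exists (x - rep (cell x)); split; last first.
  rewrite -ball_normE /ball_/= opprB addrCA subrr addr0 /rho (bigD1 (cell x))//=.
  have : 0 <= \sum_(i | i != cell x) `|rep i| by apply: sumr_ge0.
  lra.
move=> k /(nthP 0)[i ir <-]; set q := nth 0 r i.
have cx : cell (rep (cell x)) = cell x.
  by apply: (@xgetPex _ 0 [set z | cell z = cell x]); exists x.
have nx z : `|cre (kern q z)| <= 1 /\ `|cim (kern q z)| <= 1.
  by split; rewrite -(norm_kern q z); [exact: cre_le|exact: cim_le].
have : cell (rep (cell x)) (Ordinal ir) = cell x (Ordinal ir) by rewrite cx.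
rewrite !ffunE -/q => -[e1 e2].
have h1 := idxP _ _ (nx _).1 (nx _).1 e1; have h2 := idxP _ _ (nx _).2 (nx _).2 e2.
have -> : `|kern q (- (x - rep (cell x))) - 1| = `|kern q (rep (cell x)) - kern q x|.
  have -> : kern q (rep (cell x)) = kern q x * kern q (- (x - rep (cell x))).
    by rewrite -kernDr opprB addrCA subrr addr0.
  set K := kern q (- _).
  have -> : kern q x * K - kern q x = kern q x * (K - 1) by rewrite mulrBr mulr1.
  by rewrite cnormM norm_kern mul1r.
apply: (le_trans (cnorm_le _)); rewrite creB cimB.
by rewrite (splitr e); apply: lerD; [exact: le_trans h1 ne|exact: le_trans h2 ne].
Qed.

Lemma trig_approx_bohr f : trig_approx f -> bohr_almost_periodic f.
Proof.
move=> fa; split.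
- move=> x; apply/(@cvgrPdist_le _ _ _ (nbhs x) (nbhs_filter x)) => e e0.
  have e30 : 0 < e / 3 by rewrite divr_gt0.
  have [r fr] := fa _ e30.
  have /(@cvgrPdist_le _ _ _ (nbhs x) (nbhs_filter x))/(_ _ e30) := @trigpoly_continuous r x.
  apply: filterS => y hy.
  have -> : f x - f y = (f x - trigpoly r x) + (trigpoly r x - trigpoly r y) - (f y - trigpoly r y).
    by rewrite addrA subrK opprB addrA subrK.
  apply: (le_trans (ler_normB _ _)).
  have := ler_normD (f x - trigpoly r x) (trigpoly r x - trigpoly r y).
  have := fr x; have := fr y; lra.
- have [r fr] := fa 1 ltr01; apply/bounded_imageP.
  exists (1 + \sum_(p <- r) `|p.1|) => t; rewrite -(subrK (trigpoly r t) (f t)).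
  by apply: (le_trans (ler_normD _ _)); rewrite lerD// trigpoly_bound.
- move=> e e0; have e40 : 0 < e / 4 by rewrite divr_gt0.
  have [r fr] := fa _ e40.
  (* When every character of [r] moves by at most [e / 4 / c], the polynomial moves by at most
     [e / 4]. The summand 1 keeps [c] positive. *)
  pose c := 1 + \sum_(p <- r) `|p.1|.
  have c0 : 0 < c by rewrite ltr_pwDl// sumr_ge0.
  have d0 : 0 < e / 4 / c by rewrite divr_gt0.
  have [rho rho0 rd] := near_periods [seq p.2 | p <- r] d0.
  exists rho => // x; have [t [tp tx]] := rd x; exists t; split => //.
  rewrite /almost_period/=; apply: supnorm_le => y.
  have pt : `|trigpoly r (y - t) - trigpoly r y| <= e / 4.
    rewrite /trigpoly -sumrB; apply: (le_trans (ler_norm_sum _ _ _)).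
    apply: (@le_trans _ _ (\sum_(p <- r) `|p.1| * (e / 4 / c))).
      rewrite big_seq [leRHS]big_seq; apply: ler_sum => p pr.
      rewrite -mulrBr cnormM ler_wpM2l// kernDr -[X in _ - X]mulr1 -mulrBr.
      by rewrite cnormM norm_kern mul1r tp// map_f.
    rewrite -mulr_suml mulrA ler_pdivrMr// mulrC ler_wpM2l//; first exact: ltW.
    by rewrite /c lerDr.
  have -> : f (y - t) - f y = (f (y - t) - trigpoly r (y - t)) +
     (trigpoly r (y - t) - trigpoly r y) - (f y - trigpoly r y).
    by rewrite addrA subrK opprB addrA subrK.
  apply: (le_trans (ler_normB _ _)).
  have := ler_normD (f (y - t) - trigpoly r (y - t)) (trigpoly r (y - t) - trigpoly r y).
  have := fr (y - t); have := fr y; lra.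
Qed.

Lemma trig_approx_limit f : (forall e : R, 0 < e ->
  exists2 g, trig_approx g & forall t, `|f t - g t| <= e) -> trig_approx f.
Proof.
move=> fg e e0; have e20 : 0 < e / 2 by rewrite divr_gt0.
have [g /(_ _ e20)[r gr] fge] := fg _ e20; exists r => t.
have -> : f t - trigpoly r t = (f t - g t) + (g t - trigpoly r t) by rewrite addrA subrK.
by rewrite (splitr e) (le_trans (ler_normD _ _))// lerD.
Qed.

Section unconditional_sums.
Local Open Scope fset_scope.
Variable b : E -> C.

Lemma partial_sumE (a : E -> C) (A : {fset E}) : partial_sum a A = \sum_(x <- A) a x.
Proof. by rewrite /partial_sum -(big_seq_fsetE _ _ xpredT a). Qed.

Lemma fsum_split (V : zmodType) (g : E -> V) (P : pred E) (A : {fset E}) :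
  \sum_(x <- A) g x =
  (\sum_(x <- [fset x in A | P x]) g x + \sum_(x <- [fset x in A | ~~ P x]) g x)%R.
Proof. exact: big_fsetID. Qed.

(** Real and imaginary parts are each split into their nonnegative and negative terms; each of the
    four resulting sums runs over a subset of [A]. This is how unconditional convergence becomes
    absolute convergence. *)
Lemma abs_sum_le (A : {fset E}) (e : R) :
  (forall B, B `<=` A -> `|\sum_(x <- B) b x| <= e) ->
  \sum_(x <- A) `|b x| <= 4 * e.
Proof.
move=> be.
have part (g : E -> R) : (forall B, B `<=` A -> `|\sum_(x <- B) g x| <= e) ->
    \sum_(x <- A) `|g x| <= 2 * e.
  move=> ge.
  have := ge [fset x in A | 0 <= g x] (fset_sub _ _).
  have := ge [fset x in A | ~~ (0 <= g x)] (fset_sub _ _).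
  move=> h1 h2.
  have -> : \sum_(x <- A) `|g x| = \sum_(x <- [fset x in A | 0 <= g x]) g x
      - \sum_(x <- [fset x in A | ~~ (0 <= g x)]) g x.
    rewrite (fsum_split _ (fun x => 0 <= g x)) -sumrN; congr (_ + _)%R.
      by rewrite big_seq [RHS]big_seq; apply: eq_bigr => x;
        rewrite !inE/= => /andP[_]; exact: ger0_norm.
    by rewrite big_seq [RHS]big_seq; apply: eq_bigr => x;
        rewrite !inE/= -ltNge => /andP[_]; exact: ltr0_norm.
  rewrite (le_trans (ler_norm _))// (le_trans (ler_normB _ _))//.
  by move: h1 h2; lra.
have reB (B : {fset E}) : cre (\sum_(x <- B) b x) = \sum_(x <- B) cre (b x).
  by elim/big_rec2: _ => // x y z _ <-; rewrite creD.
have imB (B : {fset E}) : cim (\sum_(x <- B) b x) = \sum_(x <- B) cim (b x).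
  by elim/big_rec2: _ => // x y z _ <-; rewrite cimD.
have h1 : \sum_(x <- A) `|cre (b x)| <= 2 * e.
  by apply: part => B BA; rewrite -reB (le_trans (cre_le _))// be.
have h2 : \sum_(x <- A) `|cim (b x)| <= 2 * e.
  by apply: part => B BA; rewrite -imB (le_trans (cim_le _))// be.
have : \sum_(x <- A) `|b x| <= \sum_(x <- A) (`|cre (b x)| + `|cim (b x)|).
  by apply: ler_sum => x _; exact: cnorm_le.
rewrite big_split/=; move: h1 h2; lra.
Qed.

(** The finite set [A0] is chosen from the sum without characters, hence independently of [t].
    Beyond [A0] the absolute sums are small, and characters of modulus 1 do not enlarge them; the
    set [A1], which depends on [t], is only used to reach [F t]. *)
Lemma unconditional_sum_trig_approx (l : C) (F : E -> C) :
  partial_sum b A @[A --> totally] --> l ->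
  (forall t, partial_sum (fun x => b x * kern x t) A @[A --> totally] --> F t) ->
  trig_approx F.
Proof.
(* The final error is [e'] for reaching [F t] plus [4 * (2 * e')] for the terms beyond [A0], that is
   [9 * e']. *)
move=> bl bF e e0; pose e' := e / 16.
have e'0 : 0 < e' by rewrite divr_gt0.
have cauchy (a : E -> C) (l' : C) : partial_sum a A @[A --> totally] --> l' ->
    exists A0 : {fset E}, forall A, A0 `<=` A -> `|l' - \sum_(x <- A) a x| <= e'.
  move=> /(@cvgrPdist_le _ _ _ _ totally_filter)/(_ _ e'0)[A0 _ hA0]; exists A0 => A A0A.
  by rewrite -partial_sumE; exact: hA0.
have [A0 hA0] := cauchy _ _ bl.
have sum_split (a : E -> C) (A : {fset E}) : A0 `<=` A ->
    \sum_(x <- A) a x = (\sum_(x <- A0) a x + \sum_(x <- A `\` A0) a x)%R.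
  move=> A0A; rewrite (fsum_split _ (fun x => x \in A0)); congr (_ + _)%R.
    congr (\sum_(x <- enum_fset _) _); apply/fsetP => x; rewrite !inE/=.
    by have [xA0|] := boolP (x \in A0); rewrite ?andbF// (fsubsetP A0A).
  by congr (\sum_(x <- enum_fset _) _); apply/fsetP => x; rewrite !inE/= andbC.
have small (A : {fset E}) : \sum_(x <- A `\` A0) `|b x| <= 4 * (2 * e').
  apply: abs_sum_le => B BA.
  have h1 := hA0 (A0 `|` B) (fsubsetUl _ _).
  have h2 := hA0 A0 (fsubset_refl _).
  have -> : \sum_(x <- B) b x = (l - \sum_(x <- A0) b x) - (l - \sum_(x <- A0 `|` B) b x).
    rewrite opprB addrC addrA subrK (sum_split _ _ (fsubsetUl _ _)) addrC addKr.
    congr (\sum_(x <- enum_fset _) _); apply/fsetP => x; rewrite !inE/=.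
    have := fsubsetP BA x; rewrite !inE; case: (x \in A0) => //=.
    by case: (x \in B) => // /(_ isT).
  by apply: (le_trans (ler_normB _ _)); rewrite mulr2n mulrDl !mul1r; exact: lerD.
exists [seq (b x, x) | x <- A0] => t.
rewrite /trigpoly big_map/=.
have [A1 hA1] := cauchy _ _ (bF t).
have h1 := hA1 (A0 `|` A1) (fsubsetUr _ _).
have -> : F t - \sum_(x <- A0) b x * kern x t =
   ((F t - \sum_(x <- A0 `|` A1) b x * kern x t) +
   \sum_(x <- (A0 `|` A1) `\` A0) b x * kern x t)%R.
  by rewrite (sum_split _ _ (fsubsetUl _ _)) opprD addrA subrK.
apply: (le_trans (ler_normD _ _)).
have h2 : `|\sum_(x <- (A0 `|` A1) `\` A0) b x * kern x t : C| <= 4 * (2 * e').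
  apply: le_trans (small (A0 `|` A1)); apply: (le_trans (ler_norm_sum _ _ _)).
  by apply: ler_sum => x _; rewrite cnormM norm_kern mulr1.
by move: h1 h2; rewrite /e'; lra.
Qed.

End unconditional_sums.

End almost_periodicity.

(** * Tempered distributions *)

Section tempered_convolution.
Variables (R : realType) (d : nat).
Local Notation C := (Rcomplex R).
Local Notation E := 'rV[R]_d.
Local Notation dir := (@dir R d).
Implicit Types (f g h phi psi : E -> C) (x y z t k : E) (i : 'I_d) (s : seq 'I_d).

Lemma schwartz_lin (c : C) f g : schwartz f -> schwartz g ->
  schwartz (fun x => c * f x + g x).
Proof.
move=> /schwartzP[fs fr] /schwartzP[gs gr]; apply/schwartzP.
have fgs : smooth (fun x => c * f x + g x).
  by apply: smoothD => //; apply: smoothM => //; exact: smooth_cst.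
split=> // s; split; first exact: (smooth_continuous (smooth_partials s fgs)).
rewrite partials_lin// => m; have [_ /(_ m)[a ha]] := fr s; have [_ /(_ m)[b hb]] := gr s.
exists (`|c| * a + b) => x.
have W : 0 <= (1 + `|x|) ^+ m by rewrite exprn_ge0// addr_ge0.
apply: (le_trans (ler_wpM2l W (ler_normD _ _))).
rewrite mulrDr lerD// cnormM mulrCA ler_wpM2l//.
Qed.

Lemma partials_cst0 s : partials s (fun _ : E => 0 : C) = fun=> 0.
Proof.
elim: s => //= i s; rewrite -/(partials _ _) => ->.
by apply/funext => x; rewrite /partial; have [_ ->] := is_deriveCcst (0 : C) x (dir i).
Qed.

Lemma schwartz0 : schwartz (fun _ : E => 0).
Proof.
have s0 := @smooth_cst R d 0.
apply/schwartzP; split => // s.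
rewrite partials_cst0.
split; first exact: cst_continuous.
by move=> m; exists 0 => x; rewrite normr0 mulr0.
Qed.

Lemma rapid_affine f (a : R) (b : E) : a != 0 -> rapid f ->
  rapid (fun x => f (b + a *: x)).
Proof.
move=> a0 [fc fb]; split.
  move=> x; apply: (@continuous_comp _ _ _ (fun x => b + a *: x)); last exact: fc.
  exact: (cvgD (cvg_cst b) (cvgZl_tmp (k := a) cvg_id)).
move=> m; have [c hc] := fb m.
have a1 : 0 < `|a| by rewrite normr_gt0.
exists (((1 + `|a|^-1) * (1 + `|b|)) ^+ m * c) => x.
apply: (@le_trans _ _ (((1 + `|a|^-1) * (1 + `|b|)) ^+ m *
    ((1 + `|b + a *: x|) ^+ m * `|f (b + a *: x)|))); last first.
  by rewrite ler_wpM2l// exprn_ge0// mulr_ge0 ?addr_ge0 ?invr_ge0.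
rewrite mulrA ler_wpM2r// -exprMn; apply: lerXn2r; rewrite ?nnegrE ?addr_ge0// ?mulr_ge0 ?addr_ge0 ?invr_ge0//.
have -> : `|x| = `|a|^-1 * `|(b + a *: x) - b|.
  by rewrite addrAC subrr add0r normrZ mulKf// gt_eqF.
have := ler_normB (b + a *: x) b; set X := `|b + a *: x|; set Y := `|_ - b| => XY.
have X0 : 0 <= X by exact: normr_ge0.
have b0 : 0 <= `|b| by exact: normr_ge0.
have i0 : 0 <= `|a|^-1 by rewrite invr_ge0.
have : `|a|^-1 * Y <= `|a|^-1 * (X + `|b|) by rewrite ler_wpM2l.
have := mulr_ge0 i0 X0; have := mulr_ge0 i0 b0; have := mulr_ge0 b0 X0.
have := mulr_ge0 i0 (mulr_ge0 b0 X0); nra.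
Qed.

Lemma schwartz_affine f (a : R) (b : E) : a != 0 -> schwartz f ->
  schwartz (fun x => f (b + a *: x)).
Proof.
move=> a0 /schwartzP[fs fr]; apply/schwartzP; split; first exact: smooth_affine.
move=> s; have [_ fb] := rapid_affine b a0 (fr s); rewrite partials_affine//; split.
  have := smooth_continuous (smooth_partials s (smooth_affine a b fs)).
  by rewrite partials_affine.
move=> m; have [c hc] := fb m; exists (`|a| ^+ size s * c) => x.
by rewrite normrZ normrX mulrCA ler_wpM2l ?exprn_ge0.
Qed.

Lemma schwartz_reflect f t : schwartz f -> schwartz (fun x => f (t - x)).
Proof.
move=> /(@schwartz_affine f (-1) t); rewrite oppr_eq0 oner_eq0 => /(_ isT).
by under eq_fun do rewrite scaleN1r.
Qed.

Lemma partials_reflect f t s : smooth f ->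
  partials s (fun x => f (t - x)) = fun x => (- 1) ^+ size s *: partials s f (t - x).
Proof.
move=> fs; have := partials_affine (-1) t s fs.
under eq_fun do rewrite scaleN1r.
by move=> ->; apply/funext => x; rewrite scaleN1r.
Qed.

Lemma norm_signZ (W : normedModType R) (n : nat) (w : W) : `|(- 1) ^+ n *: w| = `|w|.
Proof. by rewrite normrZ normrX normrN1 expr1n mul1r. Qed.

Lemma partials_sum (I : Type) (r : seq I) (w : I -> C) (F : I -> E -> C) s :
  (forall j, smooth (F j)) ->
  smooth (fun x => \sum_(j <- r) w j * F j x) /\
  partials s (fun x => \sum_(j <- r) w j * F j x) =
    fun x => \sum_(j <- r) w j * partials s (F j) x.
Proof.
move=> Fs; elim: r => [|j r [ih1 ih2]].
  under eq_fun do rewrite big_nil; under [in RHS]eq_fun do rewrite big_nil.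
  by split; [exact: smooth_cst|exact: partials_cst0].
under eq_fun do rewrite big_cons; under [in RHS]eq_fun do rewrite big_cons.
split; last by rewrite partials_lin// ih2.
by apply: smoothD => //; apply: smoothM => //; exact: smooth_cst.
Qed.

Section distribution.
Variable T : functional R d.
Hypothesis HT : tempered_distribution T.

Lemma distribution_lin (c : C) f g : schwartz f -> schwartz g ->
  T (fun x => c * f x + g x) = c * T f + T g.
Proof. by case: HT => + _; exact. Qed.

Lemma distribution0 : T (fun=> 0) = 0.
Proof.
have := distribution_lin (-1) schwartz0 schwartz0.
under eq_fun do rewrite mulr0 addr0.
by rewrite mulN1r addrC subrr.
Qed.

Lemma distributionM (c : C) f : schwartz f -> T (fun x => c * f x) = c * T f.
Proof.
move=> fs; have := distribution_lin c fs schwartz0; rewrite distribution0 addr0 => <-.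
by congr T; apply/funext => x; rewrite addr0.
Qed.

Lemma distribution_sum (I : Type) (r : seq I) (w : I -> C) (F : I -> E -> C) :
  (forall j, schwartz (F j)) ->
  schwartz (fun x => \sum_(j <- r) w j * F j x) /\
  T (fun x => \sum_(j <- r) w j * F j x) = \sum_(j <- r) w j * T (F j).
Proof.
move=> Fs; elim: r => [|j r [ih1 ih2]].
  under eq_fun do rewrite big_nil; rewrite big_nil distribution0.
  by split=> //; exact: schwartz0.
under eq_fun do rewrite big_cons.
split; first exact: schwartz_lin.
by rewrite big_cons -ih2 -distribution_lin.
Qed.

(** Continuity of [T] at [f] involves only seminorms of order at most [N], of which finitely many
    constants [c m s] matter; [K] bounds them all. Hence a common rate [eta] suffices, with no
    uniformity of [c] over all seminorms. *)
Lemma distribution_rate f (c : nat -> seq 'I_d -> R) : schwartz f ->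
  forall e : R, 0 < e -> exists2 del : R, 0 < del & forall g (eta : R), schwartz g ->
    0 <= eta <= del ->
    (forall m s x, (1 + `|x|) ^+ m * `|partials s g x - partials s f x| <= c m s * eta) ->
    `|T g - T f| < e.
Proof.
move=> fS e e0; have [_ /(_ _ fS _ e0)[N [rho rho0 HN]]] := HT.
pose K := 1 + \sum_(m < N.+1) \sum_(l < N.+1) \sum_(s : l.-tuple 'I_d) `|c m s|.
have K0 : 0 < K.
  by rewrite ltr_pwDl// sumr_ge0// => m _; rewrite sumr_ge0// => l _; rewrite sumr_ge0.
have cK m s : (m <= N)%N -> (size s <= N)%N -> c m s <= K.
  move=> mN sN; apply: (le_trans (ler_norm _)).
  rewrite /K; set S := \sum_(m < _) _; suff : `|c m s| <= S by lra.
  rewrite /S (bigD1 (Ordinal (mN : (m < N.+1)%N)))//=.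
  apply: ler_wpDr; first by rewrite sumr_ge0// => m' _; rewrite sumr_ge0// => l _; rewrite sumr_ge0.
  rewrite (bigD1 (Ordinal (sN : (size s < N.+1)%N)))//=.
  apply: ler_wpDr; first by rewrite sumr_ge0// => l _; rewrite sumr_ge0.
  rewrite (bigD1 (in_tuple s))//=.
  by apply: ler_wpDr; rewrite ?sumr_ge0.
exists (rho / (2 * K)); first by rewrite divr_gt0// mulr_gt0.
move=> g eta gS /andP[eta0 etaK] H; apply: HN => // a s aN sN.
apply: (@le_lt_trans _ _ (rho / 2)); last by rewrite ltr_pdivrMr// mulr_natr mulr2n ltrDl.
apply: supnorm_le => x; rewrite /schwartz_term.
have -> : partials s (fun x => g x - f x) x = partials s g x - partials s f x.
  have fs := schwartz_smooth fS; have gs := schwartz_smooth gS.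
  have -> : (fun x => g x - f x) = (fun x => (-1) * f x + g x).
    by apply/funext => y; rewrite mulN1r addrC.
  by rewrite partials_lin// mulN1r addrC.
rewrite normrZ; apply: (@le_trans _ _ (c (\sum_i a i)%N s * eta)).
  apply: le_trans (H _ _ x); rewrite ler_wpM2r//.
  rewrite /monomial normr_prod -prodrXr; apply: ler_prod => i _.
  rewrite normr_ge0/= normrX; apply: lerXn2r; rewrite ?nnegrE ?addr_ge0//.
  by rewrite (le_trans (coord_le _ _))// lerDr.
apply: (@le_trans _ _ (K * (rho / (2 * K)))).
  by apply: (le_trans (ler_wpM2r eta0 (cK _ _ aN sN))); rewrite ler_wpM2l// ltW.
have simp (u : R) : u != 0 -> u * (rho / (2 * u)) = rho / 2 by move=> u0; field.
by rewrite simp// gt_eqF.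
Qed.

Section schwartz_function.
Variable phi : E -> C.
Hypothesis phiS : schwartz phi.
Let f := Defs.conv T phi.

(** The weight sits at [x] and the derivative at [y]: within distance 1 the two weights differ by a
    factor at most 2, whence [2 ^+ m]. *)
Let decay m s : exists2 c : R, 0 <= c &
  forall x y, `|x - y| <= 1 -> (1 + `|x|) ^+ m * `|partials s phi y| <= c.
Proof.
have /schwartzP[_ /(_ s)[_ /(_ m)[c hc]]] := phiS.
have c0 : 0 <= c by apply: le_trans (hc 0); rewrite mulr_ge0// exprn_ge0// addr_ge0.
exists (2 ^+ m * c) => [|x y xy]; first by rewrite mulr_ge0// exprn_ge0.
apply: (@le_trans _ _ (2 ^+ m * ((1 + `|y|) ^+ m * `|partials s phi y|))); last first.
  by rewrite ler_wpM2l// exprn_ge0.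
rewrite mulrA ler_wpM2r// -exprMn; apply: lerXn2r; rewrite ?nnegrE ?mulr_ge0 ?addr_ge0//.
have : `|x| <= `|x - y| + `|y| by rewrite -{1}(subrK y x) ler_normD.
have := normr_ge0 y; move: xy; lra.
Qed.

Let wpos m x : 0 < (1 + `|x|) ^+ m.
Proof. by rewrite exprn_gt0// ltr_pwDl. Qed.

Let partials_is_derive s y i :
  is_derive y (dir i) (partials s phi) (partials (i :: s) phi y).
Proof. exact: (smooth_is_derive _ _ (smooth_partials s (schwartz_smooth phiS))). Qed.

Let local_lipschitz m s : exists2 c : R, 0 <= c & forall x y, `|x - y| <= 1 ->
  (1 + `|x|) ^+ m * `|partials s phi x - partials s phi y| <= c * `|x - y|.
Proof.
have [c cP] := choice (fun i => let: ex_intro2 c c0 h := decay m (i :: s) in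
  ex_intro (fun c => 0 <= c /\ forall x y, `|x - y| <= 1 ->
    (1 + `|x|) ^+ m * `|partials (i :: s) phi y| <= c) c (conj c0 h)).
pose L := \sum_i c i.
have L0 : 0 <= L by apply: sumr_ge0 => i _; case: (cP i).
exists (2 * d%:R * L) => [|x y xy]; first by rewrite !mulr_ge0.
rewrite mulrC -ler_pdivlMr//.
(* The unweighted [path_bound] is applied with [L] divided by the weight at [x]; [decay] justifies
   this at every point within distance 1 of [x]. *)
have Lx0 : 0 <= L / (1 + `|x|) ^+ m by rewrite divr_ge0// ltW.
have := @path_bound _ _ (partials s phi) (fun i => partials (i :: s) phi) x (y - x) _
  Lx0 (partials_is_derive s).
rewrite addrCA subrr addr0 (distrC y) (distrC (partials s phi x)) => H.
rewrite [leRHS](_ : _ = 2 * d%:R * (L / (1 + `|x|) ^+ m) * `|x - y|); last by ring.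
apply: H => z i zx; rewrite ler_pdivlMr// mulrC; have [_ /(_ x z)] := cP i.
rewrite distrC => /(_ (le_trans zx xy)) /le_trans; apply.
by rewrite /L (bigD1 i)//= lerDl sumr_ge0// => j _; case: (cP j).
Qed.

(** A weighted Taylor remainder: after division by [u] it shows that difference quotients of [phi]
    converge at rate [|u|] in every Schwartz seminorm. *)
Let second_order m s i : exists2 c : R, 0 <= c & forall y (u : R), `|u| <= 1 ->
  (1 + `|y|) ^+ m * `|partials s phi (y + u *: dir i) - partials s phi y
     - u *: partials (i :: s) phi y| <= c * (`|u| * `|u|).
Proof.
have [c c0 cP] := local_lipschitz m (i :: s).
exists (2 * c) => [|y u u1]; first by rewrite mulr_ge0.
pose p (v : R) : C := partials s phi (y + v *: dir i) - v *: partials (i :: s) phi y.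
pose dp (v : R) : C := partials (i :: s) phi (y + v *: dir i) - partials (i :: s) phi y.
have pd (v : R) : is_derive v (1 : R) p (dp v).
  have d1 := is_derive_to_line (partials_is_derive s (y + v *: dir i) i).
  have d2 : is_derive v (1 : R) (fun v : R => v *: partials (i :: s) phi y : C)
      (partials (i :: s) phi y).
    apply/is_derive_CP; split.
      under eq_fun do rewrite creZ.
      by apply: is_derive_eq; rewrite /GRing.scale/=; ring.
    under eq_fun do rewrite cimZ.
    by apply: is_derive_eq; rewrite /GRing.scale/=; ring.
  exact: is_deriveB.
have W := wpos m y.
have H := @mean_value_bound _ p dp u (c * `|u| / (1 + `|y|) ^+ m) pd.
rewrite mulrC -ler_pdivlMr//.
have -> : partials s phi (y + u *: dir i) - partials s phi y - u *: partials (i :: s) phi y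
    = p u - p 0.
  by rewrite /p !scale0r addr0 subr0 addrAC.
rewrite [leRHS](_ : _ = 2 * (c * `|u| / (1 + `|y|) ^+ m) * `|u|); last by ring.
apply: H => v vu; rewrite ler_pdivlMr// mulrC /dp distrC.
have yv : `|y - (y + v *: dir i)| <= `|u|.
  rewrite opprD addrA subrr add0r normrN normrZ (le_trans _ vu)// ler_piMr//.
  exact: norm_dir.
apply: (le_trans (cP _ _ (le_trans yv u1))).
by rewrite ler_wpM2l.
Qed.

Let weight_shift m t x : (1 + `|x|) ^+ m <= (1 + `|t|) ^+ m * (1 + `|t - x|) ^+ m.
Proof.
rewrite -exprMn; apply: lerXn2r; rewrite ?nnegrE ?mulr_ge0 ?addr_ge0//.
have : `|x| <= `|t| + `|t - x|.
  by have := ler_normB t (t - x); rewrite opprB addrCA subrr addr0.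
by have := normr_ge0 t; have := normr_ge0 (t - x); set a := `|t|; set b := `|t - x|; nra.
Qed.

(** By linearity the difference quotient of [f] is [T] applied to the difference quotient [g u] of
    the test function, and [g u] tends to the reflected [partial i phi] in the Schwartz topology by
    [second_order]; [distribution_rate] concludes with [eta = |u|]. *)
Lemma is_derive_conv t i : is_derive t (dir i) f (Defs.conv T (partial i phi) t).
Proof.
have phis := schwartz_smooth phiS.
pose g (u : R) x := cofr u^-1 * phi ((t + u *: dir i) - x) + - cofr u^-1 * phi (t - x).
have gS u : schwartz (g u).
  apply: schwartz_lin; first exact: schwartz_reflect.
  have := schwartz_lin (- cofr u^-1) (schwartz_reflect t phiS) schwartz0.
  by under eq_fun do rewrite addr0.
have Tg u : T (g u) = u^-1 *: (f (u *: dir i + t) - f t).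
  rewrite /g distribution_lin; [|exact: schwartz_reflect|]; last first.
    have := schwartz_lin (- cofr u^-1) (schwartz_reflect t phiS) schwartz0.
    by under eq_fun do rewrite addr0.
  rewrite distributionM; last exact: schwartz_reflect.
  by rewrite mulNr -mulrBr cofrM (addrC _ t).
have ex m s : exists c : R, 0 <= c /\
    forall y (u : R), `|u| <= 1 -> (1 + `|y|) ^+ m * `|partials s phi (y + u *: dir i)
      - partials s phi y - u *: partials (i :: s) phi y| <= c * (`|u| * `|u|).
  by have [c c0 h] := second_order m s i; exists c.
have /choice[c cP] : forall m, exists c : seq 'I_d -> R, forall s, 0 <= c s /\
    forall y (u : R), `|u| <= 1 -> (1 + `|y|) ^+ m * `|partials s phi (y + u *: dir i)
      - partials s phi y - u *: partials (i :: s) phi y| <= c s * (`|u| * `|u|).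
  by move=> m; have [c cP] := choice (ex m); exists c.
suff lim : (fun u : R => u^-1 *: (f (u *: dir i + t) - f t)) @ 0^' --> Defs.conv T (partial i phi) t.
  by split; [apply/cvg_ex; eexists; exact: lim|exact: (cvg_lim _ lim)].
apply/cvgrPdist_lt => e e0.
have dphiS := schwartz_reflect t (schwartz_partial i phiS).
have [del del0 H] := distribution_rate (fun m s => (1 + `|t|) ^+ m * c m s) dphiS e0.
near=> u; rewrite -Tg distrC; apply: (H _ `|u|) => //.
  rewrite normr_ge0/=; near: u; exact: dnbhs0_le.
move=> m s x.
have u0 : u != 0 by near: u; exact: nbhs_dnbhs_neq.
have u1 : `|u| <= 1 by near: u; exact: dnbhs0_le.
have an0 : 0 < `|u| by rewrite normr_gt0.
have E1 : partials s (g u) x = (-1) ^+ size s *: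
   (u^-1 *: (partials s phi ((t - x) + u *: dir i) - partials s phi (t - x))).
  have p1 : smooth (fun x => phi ((t + u *: dir i) - x)) by exact/schwartz_smooth/schwartz_reflect.
  have p2 : smooth (fun x => phi (t - x)) by exact/schwartz_smooth/schwartz_reflect.
  rewrite /g partials_lin//; last by apply: smoothM => //; exact: smooth_cst.
  have := partials_lin (- cofr u^-1) s p2 (@smooth_cst R d 0).
  under eq_fun do rewrite addr0.
  move=> ->.
  rewrite partials_cst0 addr0 !partials_reflect// mulNr -mulrBr -scalerBr cofrM scalerA mulrC -scalerA.
  by rewrite addrAC.
(* Symmetry of second derivatives moves the innermost [partial i] outside, where [second_order] has
   it. *)
have E2 : partials s (fun x => partial i phi (t - x)) x =
    (-1) ^+ size s *: partials (i :: s) phi (t - x).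
  by rewrite partials_reflect ?partials_partial//; exact: smooth_partial.
rewrite E1 E2 -scalerBr norm_signZ.
have -> : u^-1 *: (partials s phi (t - x + u *: dir i) - partials s phi (t - x))
   - partials (i :: s) phi (t - x) =
   u^-1 *: (partials s phi (t - x + u *: dir i) - partials s phi (t - x)
     - u *: partials (i :: s) phi (t - x)).
  by rewrite [RHS]scalerBr scalerA mulVf// scale1r.
rewrite normrZ normfV.
have [cs0 /(_ (t - x) u u1)] := cP m s.
set D := `|_ - _ - _| => Hc.
apply: (@le_trans _ _ ((1 + `|t|) ^+ m * ((1 + `|t - x|) ^+ m * (`|u|^-1 * D)))).
  by rewrite [leRHS]mulrA; apply: ler_wpM2r; [apply: mulr_ge0; [by rewrite invr_ge0|exact: normr_ge0]|exact: weight_shift].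
rewrite -[leRHS]mulrA; apply: ler_wpM2l; first by rewrite exprn_ge0// addr_ge0.
by rewrite mulrCA mulrC ler_pdivrMr// -mulrA; exact: Hc.
Unshelve. all: by end_near. Qed.

Lemma conv_lipschitz : (forall i, exists c : R, forall t, `|Defs.conv T (partial i phi) t| <= c) ->
  exists2 L : R, 0 <= L & forall x y, `|f x - f y| <= L * `|x - y|.
Proof.
move=> /choice[c cP]; pose L := \sum_i `|c i|.
have L0 : 0 <= L by apply: sumr_ge0.
exists (2 * d%:R * L); first by rewrite !mulr_ge0.
apply: (bounded_derive_lipschitz L0 (fun y i => is_derive_conv y i)) => y i.
apply: (le_trans (cP _ _)); apply: (le_trans (ler_norm _)).
by rewrite /L (bigD1 i)//= lerDl sumr_ge0.
Qed.

(* Both sides are limits of the same quadrature sums: on the left these converge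
   in the Schwartz space, before [T] is applied. *)
Lemma conv_mollify psi (r : R) (L B : R) t : rapid psi -> `|r| <= 1 -> 0 <= L ->
  (forall x, `|f x| <= B) -> (forall x y, `|f x - f y| <= L * `|x - y|) ->
  Defs.conv T (mollify r psi phi) t = cintegral_rV (fun z => f (t - r *: z) * psi z).
Proof.
move=> psir r1 L0 fB fL; have phis := schwartz_smooth phiS.
have [q qP] := quadrature psir; have [M MP] := choice qP.
have mS := mollify_schwartz r psir phiS.
have [ms mp] := mollify_smooth r psir (schwartz_bsmooth phiS).
pose F (p : C * E) x := phi (t - r *: p.2 - x).
pose G n x := \sum_(p <- q n) p.1 * F p x.
have FS p : schwartz (F p) by exact: schwartz_reflect.
have [GS TG] : (forall n, schwartz (G n)) /\
    (forall n, T (G n) = \sum_(p <- q n) p.1 * f (t - r *: p.2)).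
  by split=> n; have [] := distribution_sum (q n) (fun p => p.1) FS.
have rzy z y : `|t - r *: z - (t - r *: y)| <= `|z - y|.
  by rewrite -scalerB_sub normrZ distrC ler_piMl.
have ex m s : exists c : R, forall n x, (0 < n)%N -> (1 + `|x|) ^+ m *
    `|partials s (G n) x - partials s (fun x => mollify r psi phi (t - x)) x| <= c * n%:R^-1.
  have [c1 c10 c1P] := decay m s; have [c2 c20 c2P] := local_lipschitz m s.
  pose c0 := (1 + `|t|) ^+ m * 2 ^+ m * (c1 + c2).
  have c00 : 0 <= c0 by rewrite !mulr_ge0 ?exprn_ge0 ?addr_ge0.
  exists (c0 * M m) => n x n0; set W := (1 + `|x|) ^+ m.
  have W0 : 0 < W by exact: wpos.
  pose h z := partials s phi (t - x - r *: z).
  have Wz z : W <= (1 + `|t|) ^+ m * 2 ^+ m * (1 + `|z|) ^+ m * (1 + `|t - x - r *: z|) ^+ m.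
    apply: (le_trans (weight_shift m t x)); rewrite -!mulrA ler_wpM2l ?exprn_ge0 ?addr_ge0//.
    rewrite -!exprMn; apply: lerXn2r; rewrite ?nnegrE ?mulr_ge0 ?addr_ge0//.
    apply: (le_trans (weight_le r (t - x) z)).
    rewrite [leRHS](_ : _ = (1 + `|t - x - r *: z|) * (2 * (1 + `|z|))); last by ring.
    rewrite ler_wpM2l ?addr_ge0// ler_wpM2r ?addr_ge0//.
    by move: r1; lra.
  (* For fixed [x] the quadrature bound is used with constant [c0 / W]; multiplied by the weight [W]
     of the seminorm it becomes uniform in [x]. This lemma transfers bounds weighted at
     [t - x - r *: z] to that constant. *)
  have key z (a b u : R) : 0 <= a -> b <= (c1 + c2) * u ->
      (1 + `|t - x - r *: z|) ^+ m * a <= b -> a <= c0 / W * u * (1 + `|z|) ^+ m.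
    move=> a0 bc ab; rewrite -!mulrA (mulrC W^-1) !mulrA ler_pdivlMr// mulrC.
    apply: (le_trans (ler_wpM2r a0 (Wz z))); rewrite -[leLHS]mulrA.
    apply: (@le_trans _ _ ((1 + `|t|) ^+ m * 2 ^+ m * (1 + `|z|) ^+ m * ((c1 + c2) * u))).
      by rewrite ler_wpM2l ?(le_trans ab)// !mulr_ge0 ?exprn_ge0 ?addr_ge0.
    by rewrite /c0 le_eqVlt; apply/orP; left; apply/eqP; ring.
  have /= := MP m n n0 h (c0 / W).
  have hc : continuous h.
    by apply: comp_affine_continuous; exact: smooth_continuous (smooth_partials s phis).
  move=> /(_ _ hc) H.
  have -> : partials s (G n) x = (- 1) ^+ size s *: \sum_(p <- q n) p.1 * h p.2.
    have [_ ->] := partials_sum (q n) (fun p => p.1) s (fun p => schwartz_smooth (FS p)).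
    rewrite -cofrM big_distrr/=; apply: eq_bigr => p _.
    by rewrite /F partials_reflect// -cofrM mulrCA addrAC.
  have -> : partials s (fun x => mollify r psi phi (t - x)) x =
      (- 1) ^+ size s *: cintegral_rV (fun z => h z * psi z).
    by rewrite partials_reflect// mp.
  rewrite -scalerBr norm_signZ mulrC -ler_pdivlMr//.
  rewrite [leRHS](_ : _ = c0 / W / n%:R * M m); last by ring.
  apply: H; first by rewrite divr_ge0// ltW.
    by move=> z; rewrite -[c0 / W]mulr1; apply: (key z _ c1) => //; [rewrite mulr1 lerDl|apply: c1P; rewrite subrr normr0].
  have sh z y : t - x - r *: z - (t - x - r *: y) = t - r *: z - (t - r *: y) by rewrite -!scalerB_sub.
  move=> z y zy; apply: (key z _ (c2 * `|z - y|)) => //; first by rewrite mulrDl lerDr mulr_ge0.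
  apply: (le_trans (c2P _ (t - x - r *: y) _)); rewrite sh; first exact: le_trans (rzy _ _) zy.
  by rewrite ler_wpM2l.
have /choice[c cP] : forall m, exists c : seq 'I_d -> R, forall s n x, (0 < n)%N -> (1 + `|x|) ^+ m *
    `|partials s (G n) x - partials s (fun x => mollify r psi phi (t - x)) x| <= c s * n%:R^-1.
  by move=> m; have [c cP] := choice (ex m); exists c.
apply/eqP; rewrite -subr_eq0 -normr_eq0 eq_le normr_ge0 andbT.
apply/ler_addgt0Pr => e e0; rewrite add0r.
have e20 : 0 < e / 2 by rewrite divr_gt0.
have [del del0 H] := distribution_rate c (schwartz_reflect t mS) e20.
have B0 : 0 <= B by apply: le_trans (fB 0).
(* On the other side the integrand factor [f (t - r *: z)] is bounded by [B] and [L]-Lipschitz since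
   [|r| <= 1], so the growth exponent is 0 and [B + L] serves as the constant. *)
pose c0 := (B + L) * `|M 0%N|.
have c00 : 0 <= c0 by rewrite mulr_ge0// addr_ge0.
have [n n1 n2] : exists2 n, (0 < n)%N & n%:R^-1 <= del /\ c0 * n%:R^-1 <= e / 2.
  pose b := del^-1 + c0 / (e / 2).
  have b0 : 0 <= b by rewrite addr_ge0 ?divr_ge0 ?invr_ge0// ltW.
  exists (Num.truncn b).+1 => //.
  have bn : b <= (Num.truncn b).+1%:R by rewrite ltW// truncnS_gt.
  have N0 : 0 < (Num.truncn b).+1%:R :> R by rewrite ltr0n.
  split; first by rewrite -[leRHS]invrK lef_pV2 ?posrE ?invr_gt0// (le_trans _ bn)// lerDl divr_ge0// ltW.
  rewrite ler_pdivrMr// mulrC -ler_pdivrMr// (le_trans _ bn)// lerDr invr_ge0 ltW//.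
have := H (G n) n%:R^-1 (GS n).
rewrite invr_ge0 ler0n/= => /(_ n2.1) /(_ (fun m s x => cP m s n x n1)).
have fc : continuous (fun z => f (t - r *: z)).
  by apply: comp_affine_continuous; exact: lipschitz_continuous fL.
have := MP 0%N n n1 (fun z => f (t - r *: z)) (B + L) (addr_ge0 B0 L0) fc.
rewrite -TG => /(_ _ _).
set A := T (G n); set X := Defs.conv _ _ _; set Y := cintegral_rV _ => H1 H2.
have {}H1 : `|A - Y| <= e / 2.
  apply: le_trans n2.2; apply: (le_trans (H1 _ _)).
  - by move=> z; rewrite expr0 mulr1 (le_trans (fB _))// lerDl.
  - move=> z y _; rewrite expr0 mulr1 (le_trans (fL _ _))//.
    by rewrite ler_pM// ?lerDr.
  by rewrite /c0 mulrAC ler_wpM2r ?invr_ge0// ler_wpM2l ?addr_ge0// ler_norm.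
rewrite (_ : X - Y = (A - Y) - (A - X)); last by rewrite [RHS]addrC opprB addrA subrK.
apply: (le_trans (ler_normB _ _)); rewrite [e]splitr lerD//.
exact: ltW.
Qed.

End schwartz_function.

End distribution.
End tempered_convolution.

(** * Compact supports *)

Section compact_support.
Variables (R : realType) (d : nat).
Local Notation C := (Rcomplex R).
Local Notation E := 'rV[R]_d.
Local Notation dir := (@dir R d).
Implicit Types (f g h phi psi : E -> C) (x y z t k : E) (i : 'I_d) (s : seq 'I_d).

Lemma closed_normball (M : R) : closed [set x : E | `|x| <= M].
Proof.
rewrite (_ : mkset _ = (fun x : E => `|x|) @^-1` [set r : R | r <= M]); last by [].
by apply: closed_comp => [x _|]; [exact: norm_continuous|exact: closed_le].
Qed.

Lemma compact_normball (M : R) : compact [set x : E | `|x| <= M].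
Proof.
apply: bounded_closed_compact; last exact: closed_normball.
by exists M; split; [exact: num_real|] => N MN x /= xM; rewrite (le_trans xM)// ltW.
Qed.

Lemma supp_normball f (M : R) : (forall x, f x != 0 -> `|x| <= M) ->
  supp f `<=` [set x : E | `|x| <= M].
Proof.
move=> fM; have /closure_id -> := @closed_normball M.
by apply: closure_subset => x; exact: fM.
Qed.

Lemma compact_suppP f : compact (supp f) <-> exists M : R, forall x, f x != 0 -> `|x| <= M.
Proof.
split=> [cf|[M fM]].
  have [M [Mr MP]] := compact_bounded cf.
  exists (M + 1) => x fx; apply: (MP (M + 1) _ x); first by rewrite ltrDl.
  exact: subset_closure.
apply: (subclosed_compact _ (@compact_normball M)); first exact: closed_closure.
exact: supp_normball.
Qed.

Lemma compact_supp_sub f g : (forall x, f x != 0 -> g x != 0) ->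
  compact (supp g) -> compact (supp f).
Proof.
by move=> fg /compact_suppP[M gM]; apply/compact_suppP; exists M => x /fg; exact: gM.
Qed.

Lemma compact_supp_affine f (a : R) b : a != 0 -> compact (supp f) ->
  compact (supp (fun x => f (b + a *: x))).
Proof.
move=> a0 /compact_suppP[M fM]; apply/compact_suppP; exists (`|a|^-1 * (M + `|b|)) => x /fM xM.
have -> : x = a^-1 *: ((b + a *: x) - b) by rewrite [b + _]addrC addrK scalerA mulVf// scale1r.
rewrite normrZ normfV ler_wpM2l ?invr_ge0// (le_trans (ler_normB _ _))// lerD2r.
exact: xM.
Qed.

Lemma Cc_smoothM f g : smooth f -> Cc_smooth g -> Cc_smooth (fun x => f x * g x).
Proof.
move=> fs [gs gc]; split; first exact: smoothM.
by apply: compact_supp_sub gc => x; apply: contra_neq => ->; rewrite mulr0.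
Qed.

Lemma Cc_smooth_affine f (a : R) b : a != 0 -> Cc_smooth f ->
  Cc_smooth (fun x => f (b + a *: x)).
Proof. by move=> a0 [fs fc]; split; [exact: smooth_affine|exact: compact_supp_affine]. Qed.

Lemma Cc_smooth_Cc f : Cc_smooth f -> Cc f.
Proof. by move=> [fs fc]; split => //; exact: smooth_continuous. Qed.

Lemma Cc_bounded f : Cc f -> exists c : R, forall x, `|f x| <= c.
Proof.
move=> [fc fs]; have [|M [_ MP]] := @compact_bounded _ _ (f @` supp f).
  by apply: continuous_compact fs; exact: continuous_subspaceT.
exists (`|M| + 1) => x; have [->|fx] := eqVneq (f x) 0; first by rewrite normr0 addr_ge0.
apply: (MP (`|M| + 1)); first by rewrite (le_lt_trans (ler_norm M))// ltrDl.
by exists x => //; exact: subset_closure.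
Qed.

(** Outside the closed ball, [f] vanishes on a whole neighbourhood, so the difference quotients are
    eventually zero; the radius is not enlarged. *)
Lemma partial_vanish f i (M : R) : (forall x, f x != 0 -> `|x| <= M) ->
  forall x, partial i f x != 0 -> `|x| <= M.
Proof.
move=> fM x; apply: contraNT; rewrite -ltNge => Mx; apply/eqP.
rewrite /partial /derive; apply: (@cvg_lim _ (@norm_hausdorff _ _)).
apply/cvgrPdist_le => e e0.
have lim : (fun u : R => `|u *: (delta_mx 0 i : E) + x|) @ 0^' --> `|x|.
  have H := cvgD (cvgZr_tmp (a := delta_mx 0 i : E) (@cvg_id _ (nbhs (0:R)))) (cvg_cst x).
  rewrite scale0r add0r in H.
  by apply: cvg_norm; apply: cvg_within_filter; exact: H.
have nz y : M < `|y| -> f y = 0 by move=> My; apply/eqP; apply: contraTT My => /fM; rewrite -leNgt.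
near=> u; rewrite /= (nz x Mx) nz; first by rewrite subrr scaler0 subrr normr0 ltW.
near: u; have /cvgrPdist_lt/(_ (`|x| - M)) := lim.
rewrite subr_gt0 => /(_ Mx); apply: filterS => u; rewrite ltr_norml => /andP[_].
by rewrite ltrBlDr -ltrBlDl opprB addrC subrK.
Unshelve. all: by end_near. Qed.

Lemma partials_vanish f s (M : R) : (forall x, f x != 0 -> `|x| <= M) ->
  forall x, partials s f x != 0 -> `|x| <= M.
Proof. by move=> fM; elim: s => //= i s ih; exact: partial_vanish. Qed.

Lemma Cc_smooth_partials f s : Cc_smooth f -> Cc_smooth (partials s f).
Proof.
move=> [fs /compact_suppP[M fM]]; split; first exact: smooth_partials.
by apply/compact_suppP; exists M; exact: partials_vanish.
Qed.

Lemma Cc_rapid f : Cc f -> rapid f.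
Proof.
move=> fC; have [fc /compact_suppP[M fM]] := fC; have [c fb] := Cc_bounded fC.
split => // m; exists ((1 + `|M|) ^+ m * c) => x.
have c0 : 0 <= c by apply: le_trans (fb 0).
have [->|fx] := eqVneq (f x) 0; first by rewrite normr0 mulr0 mulr_ge0// exprn_ge0// addr_ge0.
apply: ler_pM => //.
apply: lerXn2r; rewrite ?nnegrE ?addr_ge0// lerD2l.
by rewrite (le_trans (fM _ fx))// ler_norm.
Qed.

Lemma Cc_smooth_schwartz f : Cc_smooth f -> schwartz f.
Proof.
move=> fC; apply/schwartzP; split; first by case: fC.
by move=> s; apply/Cc_rapid/Cc_smooth_Cc/Cc_smooth_partials.
Qed.

Lemma smooth_kern x : smooth (fun k => kern k x).
Proof.
apply: (smooth_coind (P := fun f => exists c, f = fun k => c * kern k x)); last first.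
  by exists 1; apply/funext => k; rewrite mul1r.
move=> _ [c ->]; split.
  apply: continuousCM; first exact: cst_continuous.
  by under eq_fun do rewrite kernC; exact: kern_continuous.
move=> i; exists (fun k => (c * (Complex 0 (- (2 * pi)) * cofr (x ord0 i))) * kern k x); last by eexists.
move=> k; have := is_deriveCM (is_deriveCcst c k (dir i)) (is_derive_kern k x i).
by rewrite mul0r add0r mulrA.
Qed.

(** The multiplication formula moves the transform from [g] to [u], a dilated translate of [phi]
    whose transform is explicit. Substituting [- r *: k] for the frequency then cancels the factor
    [|r| ^ d] and leaves [g] as a frequency cutoff. *)
Lemma mollify_fourier (r : R) g phi x : r != 0 -> rapid g -> rapid phi ->
  mollify r (fourier g) phi x = fourier (fun k => g (- r *: k) * fourier phi k) (- x).
Proof.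
move=> r0 gr pr; pose u z := phi (x + (- r) *: z).
have nr0 : - r != 0 by rewrite oppr_eq0.
have ur : rapid u by exact: rapid_affine.
pose D : R := `|r| ^+ d; have D0 : D != 0 by rewrite expf_neq0// normr_eq0.
have Fu k : fourier u k = D^-1 *: (kern k (r^-1 *: x) * fourier phi (- r^-1 *: k)).
  pose f0 w := kern k (r^-1 *: (x - w)) * phi w.
  have f0E w : f0 w = kern k (r^-1 *: x) * (kern (- r^-1 *: k) w * phi w).
    rewrite /f0 mulrA; congr *%R; rewrite scalerBr kernDr -scaleNr.
    by rewrite [kern (_ *: k) _]kernZ.
  have f0i : citg f0.
    have := citgM (kern k (r^-1 *: x)) (kernM_citg (- r^-1 *: k) pr).
    by congr citg; apply/funext => w.
  have [_ H] := cint_affine x nr0 f0i.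
  rewrite normrN in H; transitivity (cintegral_rV (fun z => f0 (x + - r *: z))).
    congr cintegral_rV; apply/funext => z; rewrite /f0 /u; congr (_ * _).
    by rewrite opprD addrA subrr add0r scaleNr opprK scalerA mulVf// scale1r.
  rewrite H -/D; congr (_ *: _); rewrite (funext f0E : f0 = _).
  by rewrite cintM//; exact: kernM_citg.
transitivity (cintegral_rV (fun z => u z * fourier g z)).
  by congr cintegral_rV; apply/funext => z; rewrite /u scaleNr.
rewrite fourier_mult//.
pose f1 k := D^-1 *: (g k * (kern k (r^-1 *: x) * fourier phi (- r^-1 *: k))).
have f1E k : f1 k = g k * fourier u k by rewrite /f1 Fu -!cofrM mulrCA.
have f1i : citg f1.
  rewrite (funext f1E : f1 = _); have [B FB] := fourier_bounded ur.
  apply: (citg_le _ (itgZ B (rapid_norm gr))).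
    by apply/cmes_continuous/continuousCM; [case: gr|exact: fourier_continuous].
  by move=> k; rewrite cnormM mulrC ler_wpM2r.
have [f1i' H] := cint_affine 0 nr0 f1i; rewrite normrN -/D in H.
transitivity (cintegral_rV f1); first by congr cintegral_rV; apply/funext => k; rewrite f1E.
have -> : cintegral_rV f1 = D *: cintegral_rV (fun z => f1 (0 + - r *: z)).
  by rewrite H scalerA divff// scale1r.
rewrite -cofrM -cintM//; congr cintegral_rV; apply/funext => z.
rewrite /f1 cofrM scalerA divff// scale1r add0r mulrCA -[cis _]/(kern (- x) z).
congr (_ * (_ * _)).
  rewrite kernZ scalerA mulNr divff// scaleN1r kernC //.
by rewrite scalerA mulrN mulNr opprK mulVf// scale1r.
Qed.

End compact_support.

(** * Bump functions and Fourier inversion *)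

Section bump_function.
Variables (R : realType) (d : nat).
Local Notation C := (Rcomplex R).
Local Notation E := 'rV[R]_d.
Local Notation dir := (@dir R d).

(* The derivatives of [u |-> exp (- 1 / u)] are combinations of these. *)
Definition flat (m : nat) (u : R) : R := if 0 < u then u^-1 ^+ m * expR (- u^-1) else 0.

Lemma flat_ge0 m u : 0 <= flat m u.
Proof.
rewrite /flat; case: ifPn => // u0.
by rewrite mulr_ge0 ?expR_ge0// exprn_ge0// invr_ge0 ltW.
Qed.

Lemma flatS m u : flat m u = u * flat m.+1 u.
Proof.
rewrite /flat; case: ifPn => [u0|_]; last by rewrite mulr0.
by rewrite exprS -!mulrA mulVKf// gt_eqF.
Qed.

(** With [W = 1 / u], one term of the exponential series gives [W ^ (m + 1) <= (m + 1)! * exp W],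
    and [W ^ m = u * W ^ (m + 1)]. *)
Lemma flat_le m u : `|flat m u| <= (m.+1)`!%:R * `|u|.
Proof.
rewrite ger0_norm ?flat_ge0// /flat; case: ifPn => [u0|_]; last by rewrite mulr_ge0.
have w0 : 0 <= u^-1 by rewrite invr_ge0 ltW.
have := expR_ge1Dxn m w0; set W := u^-1 in w0 *.
have uW : u * W = 1 by rewrite /W divff// gt_eqF.
have f0 : 0 < (m.+1)`!%:R :> R by rewrite ltr0n fact_gt0.
move=> H; have {}H : W ^+ m.+1 <= (m.+1)`!%:R * expR W.
  by rewrite mulrC -ler_pdivrMr//; apply: le_trans H; rewrite lerDr.
rewrite expRN ler_pdivrMr ?expR_gt0// gtr0_norm//.
have -> : W ^+ m = u * W ^+ m.+1 by rewrite exprS mulrA uW mul1r.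
by rewrite [leRHS]mulrAC [leRHS]mulrC ler_wpM2l// ltW.
Qed.

Lemma is_derive_flat m u :
  is_derive u (1 : R) (flat m) (flat m.+2 u - m%:R * flat m.+1 u).
Proof.
have [u0|u0|<-] := ltrgtP 0 u.
- apply: (@near_eq_is_derive _ _ _ (fun y : R => y^-1 ^+ m * expR (- y^-1))).
    near=> y; rewrite /flat ifT//; near: y; exact: lt_nbhsr.
  have un0 : u != 0 by rewrite gt_eqF.
  have d1 : is_derive u (1 : R) (fun y : R => y^-1) (- u ^- 2).
    by have := is_deriveV un0 (is_derive_id u (1:R)); rewrite /GRing.scale/= mulr1.
  have d2 : is_derive u (1 : R) (fun y : R => expR (- y^-1)) (u ^- 2 * expR (- u^-1)).
    have d3 : is_derive u (1 : R) (fun y : R => - y^-1) (u ^- 2).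
      by apply: is_derive_eq; rewrite opprK.
    have := @is_derive1_comp _ (@expR R) (fun y : R => - y^-1) u _ _ (is_derive_expR _) d3.
    by rewrite mulrC.
  have d4 : is_derive u (1 : R) (fun y : R => y^-1 ^+ m) (- (m%:R * u^-1 ^+ m.+1)).
    have := is_deriveX m d1; rewrite exprfctE /GRing.scale/=.
    move=> /is_derive_eq; apply; case: (m) => [|k]; first by rewrite !mul0r oppr0.
    by rewrite /= -[u ^- 2]exprVn !exprS expr0; ring.
  have := is_deriveM d4 d2; rewrite /GRing.scale/=.
  move=> /is_derive_eq; apply; rewrite /flat u0 -[u ^- 2]exprVn !exprS expr0; ring.
- apply: (@near_eq_is_derive _ _ _ (fun y : R => 0)).
    near=> y; rewrite /flat ifF//; apply/negbTE; rewrite -leNgt ltW//; near: y; exact: lt_nbhsl.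
  by rewrite /flat ifF ?ifF ?mulr0 ?subr0; [exact: is_derive_cst|exact: lt_gtF..].
have f0 k : flat k 0 = 0 by rewrite /flat ltxx.
rewrite !f0 mulr0 subr0.
suff lim : (fun h : R => h^-1 *: (flat m (h *: (1 : R) + 0) - flat m 0)) @ 0^' --> (0 : R).
  by split; [apply/cvg_ex; exists 0; exact: lim|exact: (cvg_lim _ lim)].
apply/cvgrPdist_le => e e0.
have f0' : 0 < (m.+2)`!%:R :> R by rewrite ltr0n fact_gt0.
near=> h; have h0 : h != 0 by near: h; exact: nbhs_dnbhs_neq.
(* At the origin the difference quotient of [flat m] is [flat m.+1 h], which tends to 0 by
   [flat_le]. *)
rewrite f0 addr0 subr0 sub0r normrN [h *: (1:R)]mulr1 [flat m h]flatS scalerA mulVf// scale1r.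
apply: (le_trans (flat_le _ _)); rewrite mulrC -ler_pdivlMr//; near: h.
by apply: dnbhs0_le; rewrite divr_gt0.
Unshelve. all: by end_near. Qed.

Lemma flat_continuous m : continuous (flat m).
Proof.
move=> u; apply: differentiable_continuous; apply/derivable1_diffP.
by have [] := is_derive_flat m u.
Qed.

Lemma smooth_flat_coord (i : 'I_d) : smooth (fun x : E => cofr (flat 0 (x ord0 i))).
Proof.
suff H n m : Cn n (fun x : E => cofr (flat m (x ord0 i))) by apply/smooth_Cn => n; exact: H.
have fc k : continuous (fun x : E => cofr (flat k (x ord0 i))).
  apply: cofr_continuous => x.
  by apply: (@continuous_comp _ _ _ (fun x : E => x ord0 i)); [exact: coord_continuous_rV|exact: flat_continuous].
elim: n m => [|n ih] m; split => // j.
pose l (x : E) : C := cofr (i == j)%:R *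
  (cofr (flat m.+2 (x ord0 i)) + cofr (- m%:R) * cofr (flat m.+1 (x ord0 i))).
exists l; last first.
  have Cc c : Cn n (fun _ : E => c : C) by move/smooth_Cn : (@smooth_cst R d c); exact.
  by apply: CnM => //; apply: CnD => //; exact: CnM.
move=> x; rewrite -[x in is_derive x](addr0 x) -[X in x + X](scale0r (dir j)).
apply: is_derive_of_line.
have E1 (u : R) : (x + u *: dir j) ord0 i = x ord0 i + (i == j)%:R * u.
  by rewrite !mxE/= mulrC.
under eq_fun do rewrite E1.
have dl : is_derive (0 : R) (1 : R) (fun u : R => x ord0 i + (i == j)%:R * u) (i == j)%:R.
  by apply: is_derive_eq; rewrite /GRing.scale/=; ring.
apply/is_derive_CP; split.
  have := @is_derive1_comp _ (flat m) (fun u : R => x ord0 i + (i == j)%:R * u) 0 _ _ (is_derive_flat m _) dl.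
  move=> /is_derive_eq; apply; rewrite mulr0 addr0 /l creM creD !creM /cre/cim/=.
  ring.
rewrite [cim _](_ : _ = 0); first exact: is_derive_cst.
by rewrite /l cimM cimD !cimM /cre/cim/=; ring.
Qed.

Lemma smooth_bump : exists b : E -> C, [/\ Cc_smooth b, forall x, cim (b x) = 0,
  forall x, 0 <= cre (b x), 0 < cre (b 0) & forall x, b x != 0 -> `|x| <= 1].
Proof.
pose w (u : R) := flat 0 (1 + u) * flat 0 (1 - u).
pose b (x : E) : C := \prod_i cofr (w (x ord0 i)).
have bE x : b x = cofr (\prod_i w (x ord0 i)).
  rewrite /b; elim: (index_enum _) => [|i r ih]; first by rewrite !big_nil.
  by rewrite !big_cons ih cofrM; apply/eqP; rewrite eq_complex/= mulr0 !eqxx.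
have w0 u : 0 <= w u by rewrite mulr_ge0 ?flat_ge0.
have bs x : b x != 0 -> `|x| <= 1.
  move=> bx; apply: norm_rV_le => // i; move: bx; apply: contraNT; rewrite -ltNge => xi.
  rewrite bE (bigD1 i)//= (_ : w _ = 0) ?mul0r// /w /flat.
  case: ifPn => [p1|]; last by rewrite mul0r.
  case: ifPn => [p2|]; last by rewrite mulr0.
  by move: xi; rewrite ltNge ler_norml; case/negP; apply/andP; split; lra.
exists b; split => //.
- split; last by apply/compact_suppP; exists 1.
  apply: smooth_prod => i.
  have := smoothM (smooth_affine 1 (const_mx 1) (smooth_flat_coord i))
    (smooth_affine (-1) (const_mx 1) (smooth_flat_coord i)).
  congr smooth; apply/funext => x; rewrite !mxE mul1r mulN1r cofrM.
  by apply/eqP; rewrite eq_complex/= mulr0 !eqxx.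
- by move=> x; rewrite bE.
- by move=> x; rewrite bE /cre/=; apply: prodr_ge0.
rewrite bE /cre/=; apply: prodr_gt0 => i _; rewrite mxE /w addr0 subr0 /flat ltr01.
by rewrite mulr_gt0// mulr_gt0 ?expR_gt0// expr0.
Qed.

End bump_function.

(** * Decay of Fourier transforms and a band-limited function of integral one *)

Section fourier_inversion.
Variables (R : realType) (d : nat).
Local Notation C := (Rcomplex R).
Local Notation E := 'rV[R]_d.
Local Notation dir := (@dir R d).
Implicit Types (f g h phi psi : E -> C) (x y z t k : E) (i : 'I_d) (s : seq 'I_d).

(** The integral of [f (y + z)] over [y] does not depend on [z]; differentiating it under the
    integral sign at [z = 0] gives the claim, which acts as integration by parts. *)
Lemma cint_partial f i : schwartz f -> cintegral_rV (partial i f) = 0.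
Proof.
move=> fS; have /schwartzP[fs fr] := fS.
have /(_ (2 * d)%N)[c cP] := (fr [:: i]).2.
(* One majorant for all shifts of length at most 1: then [1 + |y| <= 2 * (1 + |y + z|)], whence
   [2 ^+ (2 * d)]. *)
have [c1 c10 c1E] : exists2 G : E -> R, itg G & forall y z, `|z| <= 1 -> `|partial i f (y + z)| <= G y.
  pose p y : R := ((1 + `|y|) ^+ (2 * d))^-1.
  have pc : continuous p.
    move=> y; apply: (cvgV _ (@weight_continuous _ _ (2 * d) y)).
    by rewrite gt_eqF.
  have c0 : 0 <= c by apply: le_trans (cP 0); rewrite mulr_ge0// exprn_ge0// addr_ge0.
  exists (fun y => (2 ^+ (2 * d) * c) * p y).
    apply/itgZ/(itg_decay (c := 1)); first exact: mes_continuous.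
    by move=> y; rewrite ger0_norm ?invr_ge0 ?exprn_ge0 ?addr_ge0// divff// gt_eqF.
  move=> y z z1; rewrite /p ler_pdivlMr// mulrC.
  apply: (@le_trans _ _ (2 ^+ (2 * d) * ((1 + `|y + z|) ^+ (2 * d) * `|partial i f (y + z)|))); last first.
    by rewrite ler_wpM2l ?exprn_ge0//; exact: cP.
  rewrite mulrA ler_wpM2r// -exprMn; apply: lerXn2r; rewrite ?nnegrE ?mulr_ge0 ?addr_ge0//.
  have := ler_normB (y + z) z; rewrite addrK; have := normr_ge0 (y + z); move: z1; lra.
have fi := rapid_citg (schwartz_rapid fS).
have tr (z : E) : cintegral_rV (fun y => f (y + z)) = cintegral_rV f.
  have [_] := @cint_affine _ _ f 1 z (oner_neq0 _) fi.
  rewrite normr1 expr1n invr1 scale1r => <-; congr cintegral_rV.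
  by apply/funext => y; rewrite scale1r addrC.
have tri (z : E) : citg (fun y => f (y + z)).
  have [+ _] := @cint_affine _ _ f 1 z (oner_neq0 _) fi.
  by congr citg; apply/funext => y; rewrite scale1r addrC.
have := @is_derive_cint _ _ (fun z y => f (y + z)) (fun z y => partial i f (y + z)) c1 0 i tri c10.
have -> : (fun z => cintegral_rV (fun y => f (y + z))) = fun=> cintegral_rV f by exact/funext.
move=> H; have {H} [_] : is_derive (0:E) (dir i) (fun=> cintegral_rV f) (cintegral_rV (fun y => partial i f (y + 0))).
  apply: H => [z y|z y].
    have := @is_derive_affine _ _ f 1 y z (dir i) (partial i f (y + z)).
    rewrite !scale1r; under eq_fun do rewrite scale1r.
    by apply; exact: smooth_is_derive.
  by rewrite subr0; exact: c1E.
have [_ ->] := is_deriveCcst (cintegral_rV f) (0 : E) (dir i).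
by under eq_fun do rewrite addr0.
Qed.

Lemma fourier_partial f i k : Cc_smooth f ->
  fourier (partial i f) k = Complex 0 (2 * pi) * cofr (k ord0 i) * fourier f k.
Proof.
move=> fC; have [fs _] := fC.
have fr := Cc_rapid (Cc_smooth_Cc fC).
have dr := Cc_rapid (Cc_smooth_Cc (Cc_smooth_partials [:: i] fC)).
have kE : kern k = fun x => kern x k by apply/funext => x; exact: kernC.
have ks : smooth (kern k) by rewrite kE; exact: smooth_kern.
have kd x : is_derive x (dir i) (kern k) (Complex 0 (- (2 * pi)) * cofr (k ord0 i) * kern k x).
  by rewrite kernC kE; exact: is_derive_kern.
have := cint_partial i (Cc_smooth_schwartz (Cc_smoothM ks fC)).
have -> : partial i (fun x => kern k x * f x) =
    fun x => (Complex 0 (- (2 * pi)) * cofr (k ord0 i)) * (kern k x * f x) + kern k x * partial i f x.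
  apply/funext => x; rewrite mulrA.
  by have [_] := is_deriveCM (kd x) (smooth_is_derive x i fs).
rewrite cintD; [|exact/citgM/kernM_citg|exact: kernM_citg].
rewrite cintM; last exact: kernM_citg.
move/eqP; rewrite addrC addr_eq0 => /eqP H.
rewrite -[LHS]/(cintegral_rV (fun x => kern k x * partial i f x)) H.
rewrite -2!mulNr; congr (_ * _ * _).
by apply/eqP; rewrite eq_complex/= oppr0 opprK !eqxx.
Qed.

Lemma fourier_rapid f : Cc_smooth f -> rapid (fourier f).
Proof.
move=> fC; have fr := Cc_rapid (Cc_smooth_Cc fC); split; first exact: fourier_continuous.
move=> m.
have pw i n : exists c : R, forall k, `|k ord0 i| ^+ n * `|fourier f k| <= c.
  have : exists g, Cc_smooth g /\ forall k, `|k ord0 i| ^+ n * `|fourier f k| <= `|fourier g k|.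
    elim: n => [|n [g [gC gP]]]; first by exists f; split => // k; rewrite mul1r.
    exists (partial i g); split; first exact: Cc_smooth_partials [:: i] gC.
    move=> k; rewrite fourier_partial// !cnormM cnorm_cofr exprS -mulrA.
    apply: ler_pM => //.
    (* Each coordinate of [k] is paid for by one derivative of the function, since the factor
       [2 * pi] has modulus at least 1. *)
    rewrite ler_peMl//; apply: le_trans (cim_le _).
    rewrite ger0_norm /cim/= ?mulr_ge0 ?pi_ge0//.
    by have := pi_ge2 R; lra.
  move=> [g [gC gP]]; have [c cP] := fourier_bounded (Cc_rapid (Cc_smooth_Cc gC)).
  by exists c => k; exact: le_trans (gP k) (cP k).
have [c0 c0P] := fourier_bounded fr.
have [c cP] := choice (fun i => pw i m).
exists (2 ^+ m * (2 * c0 + \sum_i c i)) => k.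
apply: (le_trans (ler_wpM2r _ (weight_expr_le k m))) => //.
rewrite -mulrA ler_wpM2l ?exprn_ge0// mulrDl lerD//; first by rewrite ler_wpM2l.
by rewrite mulr_suml; apply: ler_sum => i _.
Qed.

Lemma fourier_translate f t k : rapid f ->
  fourier (fun x => f (x - t)) k = kern k t * fourier f k.
Proof.
move=> fr; have ki := kernM_citg k fr.
have [_] := @cint_affine _ _ (fun x => kern k x * f x) 1 (- t) (oner_neq0 _) ki.
rewrite normr1 expr1n invr1 scale1r -/(fourier f k) => <-.
rewrite -cintM; last first.
  by have [] := @cint_affine _ _ (fun x => kern k x * f x) 1 (- t) (oner_neq0 _) ki.
congr cintegral_rV; apply/funext => x; rewrite scale1r mulrA -kernDr addrA subrr add0r.
by rewrite addrC.
Qed.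

(** For a real bump [b] and its reflection this makes the product of the two transforms equal to
    [|fourier b k| ^ 2]. *)
Lemma fourier_conj f k : rapid f -> (forall x, cim (f x) = 0) ->
  fourier (fun x => f (- x)) k = Complex (cre (fourier f k)) (- cim (fourier f k)).
Proof.
move=> fr f0; have ki : citg (fun x => kern k x * f x) by exact: kernM_citg.
have ki' : citg (fun x => kern k (- x) * f x).
  apply: (citg_le _ (rapid_norm fr)); last by move=> x; rewrite cnormM norm_kern mul1r.
  apply: cmes_continuous; apply: continuousCM; last by case: fr.
  by move=> x; apply: (@continuous_comp _ _ _ (@GRing.opp E) (kern k)); [exact: oppr_continuous|exact: kern_continuous].
have N1 : -1 != 0 :> R by rewrite oppr_eq0 oner_neq0.
have [_] := @cint_affine _ _ _ _ 0 N1 ki'.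
rewrite normrN normr1 expr1n invr1 scale1r => H.
transitivity (cintegral_rV (fun x => kern k (- x) * f x)).
  by rewrite -H; congr cintegral_rV; apply/funext => x; rewrite add0r scaleN1r opprK.
have kc x : cre (kern k (- x)) = cre (kern k x) /\ cim (kern k (- x)) = - cim (kern k x).
  have -> : kern k (- x) = cis (- - (2 * pi * dotp k x)).
    by congr (cis (- _)); rewrite -mulrN; congr (_ * _); rewrite -scaleN1r dotpZr mulN1r.
  exact: conjC_cis.
have r1 x : cre (kern k (- x) * f x) = cre (kern k x * f x).
  by rewrite !creM f0 !mulr0; have [-> _] := kc x.
have i1 x : cim (kern k (- x) * f x) = - cim (kern k x * f x).
  by rewrite !cimM f0 !mulr0 !add0r; have [_ ->] := kc x; rewrite mulNr.
rewrite cintE; under eq_fun do rewrite r1.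
under [X in (_ +i* integral_rV X)%C]eq_fun do rewrite i1.
by rewrite integral_rVN//; case: ki.
Qed.

(* If [fourier g] had zero integral for every [g], then applying this to all
   translates of [g] the inverse transform of [fourier g] would vanish, and so
   would the square integral of [fourier b] for a bump [b]. *)
Lemma fourier_unit_integral : exists g : E -> C, Cc_smooth g /\ cintegral_rV (fourier g) = 1.
Proof.
have [b [bC b0 bpos b00 _]] := smooth_bump R d.
have br := Cc_rapid (Cc_smooth_Cc bC).
have [all0|] := pselect (forall g : E -> C, Cc_smooth g -> cintegral_rV (fourier g) = 0); last first.
  move=> /existsNP[g /not_implyP[gC /eqP g0]].
  exists (fun x => (cintegral_rV (fourier g))^-1 * g x); split.
    by apply: Cc_smoothM => //; exact: smooth_cst.
  have gr := Cc_rapid (Cc_smooth_Cc gC).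
  have -> : fourier (fun x => (cintegral_rV (fourier g))^-1 * g x) =
      fun k => (cintegral_rV (fourier g))^-1 * fourier g k.
    apply/funext => k; rewrite -cintM; last exact: kernM_citg.
    by congr cintegral_rV; apply/funext => x; rewrite mulrCA.
  rewrite cintM; last exact/rapid_citg/fourier_rapid.
  by rewrite mulVf.
exfalso.
have inv0 g t : Cc_smooth g -> fourier (fourier g) t = 0.
  move=> gC; have gr := Cc_rapid (Cc_smooth_Cc gC).
  rewrite -(all0 (fun x => g (x - t))); last first.
    have := @Cc_smooth_affine _ _ g 1 (- t) (oner_neq0 _) gC.
    by congr Cc_smooth; apply/funext => x; rewrite scale1r addrC.
  by congr cintegral_rV; apply/funext => k; rewrite fourier_translate// kernC.
pose h x := b (- x).
have hC : Cc_smooth h.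
  have N1 : -1 != 0 :> R by rewrite oppr_eq0 oner_neq0.
  have := @Cc_smooth_affine _ _ b _ 0 N1 bC.
  by congr Cc_smooth; apply/funext => x; rewrite scaleN1r add0r.
have fb := fourier_rapid bC.
have := fourier_mult fb (Cc_rapid (Cc_smooth_Cc hC)).
have -> : cintegral_rV (fun x => h x * fourier (fourier b) x) = 0.
  rewrite (_ : (fun x => _) = fun=> 0 * 0); last by apply/funext => x; rewrite inv0// mulr0 mul0r.
  have z0 : rapid (fun _ : E => 0 : C).
    by split; [exact: cst_continuous|move=> m; exists 0 => x; rewrite normr0 mulr0].
  by rewrite cintM ?mul0r//; exact: rapid_citg.
have sq k : fourier b k * fourier h k = cofr (`|fourier b k| ^+ 2).
  rewrite /h fourier_conj// Rcomplex_normE sqr_sqrtr ?addr_ge0 ?sqr_ge0//.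
  by case: (fourier b k) => u v; rewrite /cofr /cre /cim/=; congr Complex; ring.
move=> H0; have : integral_rV (fun k => `|fourier b k| ^+ 2) = 0.
  by have := congr1 (@cre R) H0; rewrite (funext sq : (fun x => fourier b x * fourier h x) = _).
apply/eqP; rewrite gt_eqF//.
have fc : continuous (fun k => `|fourier b k|).
  by apply: continuous_norm_comp; case: fb.
have [c cb] := rapid_bounded fb.
apply: (@integral_rV_gt0 _ _ _ 0).
- by under eq_fun do rewrite expr2; exact: continuous_mul.
- by move=> k; rewrite exprn_ge0.
- apply: (itg_le _ (itgZ c (rapid_norm fb))).
    by apply: mes_continuous; under eq_fun do rewrite expr2; exact: continuous_mul.
  by move=> k; rewrite normrX normr_id expr2 ler_wpM2r.
(* The square integral is positive because the transform does not vanish at frequency 0, where it is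
   the integral of the nonnegative bump. *)
rewrite exprn_gt0// normr_gt0; apply/negP => /eqP/(congr1 (@cre R)); rewrite [cre 0]/=.
have -> : cre (fourier b 0) = integral_rV (fun x => cre (b x)).
  rewrite /fourier/cintegral_rV/=; congr integral_rV; apply/funext => x; congr cre.
  rewrite (_ : dotp 0 x = 0) ?mulr0 ?oppr0 ?cis0 ?mul1r//.
  by rewrite -(scale0r (0 : E)) dotpZl mul0r.
have [bi _] := rapid_citg br; have [bc _] := br.
apply/eqP; rewrite gt_eqF//; apply: (@integral_rV_gt0 _ _ _ 0) => //.
by move/continuousCP : bc => [].
Qed.

End fourier_inversion.

(** * Poisson measures *)

Section almost_periodic_convolution.
Variables (R : realType) (d : nat).
Local Notation C := (Rcomplex R).
Local Notation E := 'rV[R]_d.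
Local Notation dir := (@dir R d).
Implicit Types (f g h phi psi : E -> C) (x y z t k : E) (i : 'I_d) (s : seq 'I_d).

Lemma trig_approx_opp f : trig_approx f -> trig_approx (fun t => f (- t)).
Proof.
move=> fa e e0; have [r rP] := fa e e0.
exists [seq (p.1, - p.2) | p <- r] => t.
have -> : trigpoly [seq (p.1, - p.2) | p <- r] t = trigpoly r (- t).
  rewrite /trigpoly big_map; apply: eq_bigr => p _ /=.
  by rewrite -[- p.2]scaleN1r kernZ scaleN1r.
exact: rP.
Qed.

Section poisson.
Variables (T : functional R d) (a : E -> C).
Hypothesis HT : tempered_distribution T.
Hypothesis spectrum : forall h, Cc_smooth h ->
  partial_sum (fun x => a x * h x) A @[A --> totally] --> T (fourier h).

Lemma fourier_trig_approx h : Cc_smooth h ->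
  trig_approx (fun t => T (fourier (fun k => kern k t * h k))).
Proof.
move=> hC; apply: (unconditional_sum_trig_approx (spectrum hC)) => t.
have -> : (fun x => a x * h x * kern x t) = fun x => a x * (kern x t * h x).
  by apply/funext => x; rewrite -mulrA [h x * _]mulrC.
exact: spectrum (Cc_smoothM (@smooth_kern R d t) hC).
Qed.

(** At [t - x], [mollify_fourier] yields a transform evaluated at [x - t]: the character is taken at
    [- t], hence the passage through [trig_approx_opp]. *)
Lemma conv_mollify_trig_approx g (r : R) phi : r != 0 -> Cc_smooth g -> schwartz phi ->
  trig_approx (Defs.conv T (mollify r (fourier g) phi)).
Proof.
move=> r0 gC pS; have pr := schwartz_rapid pS.
pose G k := g (- r *: k) * fourier phi k.
have GC : Cc_smooth G.
  have nr0 : - r != 0 by rewrite oppr_eq0.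
  have := Cc_smoothM (smooth_fourier pr) (Cc_smooth_affine 0 nr0 gC).
  by congr Cc_smooth; apply/funext => k; rewrite add0r mulrC.
have := trig_approx_opp (fourier_trig_approx GC).
congr trig_approx; apply/funext => t; congr T; apply/funext => x.
rewrite mollify_fourier//; last exact: Cc_rapid (Cc_smooth_Cc gC).
congr cintegral_rV; apply/funext => k; rewrite -!/(kern _ _) mulrA; congr (_ * _).
by rewrite opprB kernDl [kern (- t) k]kernC.
Qed.

Lemma conv_trig_approx phi : schwartz phi ->
  (exists B : R, forall t, `|Defs.conv T phi t| <= B) ->
  (forall i, exists B : R, forall t, `|Defs.conv T (partial i phi) t| <= B) ->
  trig_approx (Defs.conv T phi).
Proof.
move=> pS [B fB] dB; have [L L0 fL] := conv_lipschitz HT pS dB.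
have [g [gC g1]] := fourier_unit_integral R d.
have psir := fourier_rapid gC; set psi := fourier g in g1 psir.
set f := Defs.conv T phi in fB fL *.
(* Since [f] moves by at most [L * r * |z|], mollification changes it by at most [r * K]; the 2
   comes from [norm_cint]. *)
pose K := 2 * (L * integral_rV (fun z => (1 + `|z|) ^+ 1 * `|psi z|)).
have K0 : 0 <= K by rewrite !mulr_ge0// integral_rV_ge0// => x; rewrite mulr_ge0// addr_ge0.
apply: trig_approx_limit => e e0.
(* The bound 1 is what [conv_mollify] asks for, and [K + 1] avoids a division by zero. *)
pose r := Num.min 1 (e / (K + 1)).
have r0 : 0 < r by rewrite lt_min ltr01 divr_gt0// ltr_wpDl.
have r1 : `|r| <= 1 by rewrite gtr0_norm// ge_min lexx.
have rK : r * K <= e.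
  apply: (@le_trans _ _ (e / (K + 1) * K)); first by rewrite ler_wpM2r// ge_min lexx orbT.
  by rewrite mulrAC ler_pdivrMr ?ltr_wpDl// ler_wpM2l ?lerDl// ltW.
exists (Defs.conv T (mollify r psi phi)).
  by apply: conv_mollify_trig_approx => //; rewrite gt_eqF.
move=> t; rewrite (conv_mollify HT pS t psir r1 L0 fB fL) -/f.
have fc : continuous f by exact: lipschitz_continuous fL.
have fi : citg (fun z => f (t - r *: z) * psi z) by apply: mollify_citg => //; exists B.
have pi : citg (fun z => f t * psi z) by exact/citgM/rapid_citg.
have -> : f t = cintegral_rV (fun z => f t * psi z) by rewrite cintM ?g1 ?mulr1//; exact: rapid_citg.
rewrite distrC -cintB//; apply: le_trans rK.
have ig := rapid_moment 1 psir.
rewrite [leRHS](_ : _ = 2 * (r * L * integral_rV (fun z => (1 + `|z|) ^+ 1 * `|psi z|))); last first.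
  by rewrite /K; ring.
rewrite -integral_rVZ//; apply: norm_cint.
- have := citgD fi (citgM (-1) pi).
  by congr citg; apply/funext => z; rewrite mulN1r.
- exact: itgZ.
move=> z; rewrite -mulrBl cnormM mulrA ler_wpM2r//.
apply: (le_trans (fL _ _)); rewrite addrAC subrr add0r normrN normrZ gtr0_norm//.
rewrite mulrA [r * L]mulrC ler_wpM2l//; first by rewrite mulr_ge0// ltW.
by rewrite expr1 lerDr.
Qed.

Lemma conv_bohr phi : schwartz phi ->
  (exists B : R, forall t, `|Defs.conv T phi t| <= B) ->
  (forall i, exists B : R, forall t, `|Defs.conv T (partial i phi) t| <= B) ->
  bohr_almost_periodic (Defs.conv T phi).
Proof. by move=> pS b db; exact/trig_approx_bohr/conv_trig_approx. Qed.

End poisson.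

Lemma conv_agree (S : set (E -> C)) (Y Z : functional R d) phi :
  agree_on S Y Z -> (forall t, S (fun x => phi (t - x))) -> Defs.conv Y phi = Defs.conv Z phi.
Proof. by move=> YZ pS; apply/funext => t; exact: YZ. Qed.

Lemma Cc_smooth_reflect f t : Cc_smooth f -> Cc_smooth (fun x => f (t - x)).
Proof.
have N1 : -1 != 0 :> R by rewrite oppr_eq0 oner_neq0.
move=> /(Cc_smooth_affine t N1).
by congr Cc_smooth; apply/funext => x; rewrite scaleN1r.
Qed.

Section poisson_measure.
Variable mu : functional R d.
Hypothesis Hmu : poisson_measure mu.

Lemma tempered_extP : tempered_distribution (tempered_ext mu) /\
  agree_on (@Cc_smooth R d) mu (tempered_ext mu).
Proof. by have [_ Tmu _] := Hmu; exact: xgetPex Tmu. Qed.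

Lemma poisson_spectrum : exists a : E -> C, forall h, Cc_smooth h ->
  partial_sum (fun x => a x * h x) A @[A --> totally] --> tempered_ext mu (fourier h).
Proof.
have [_ _ [nu [_ [a aP]] nuP]] := Hmu; exists a => h hC.
rewrite -[tempered_ext mu _]/(fourier_dist (tempered_ext mu) h) nuP//.
exact/aP/Cc_smooth_Cc.
Qed.

Lemma poisson_schwartz : strongly_almost_periodic (@schwartz R d) (tempered_ext mu) <->
  translation_bounded (@schwartz R d) (tempered_ext mu).
Proof.
split=> [H phi /H[]//|H phi pS]; have [a aP] := poisson_spectrum.
have [HT _] := tempered_extP.
by apply: (conv_bohr HT aP) => // [|i]; apply/bounded_imageP/H => //; exact: schwartz_partial.
Qed.

(** The conclusion is approximation by trigonometric polynomials rather than almost periodicity,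
    because this form passes directly to uniform limits and is reused for continuous test
    functions. *)
Lemma poisson_Cc_smooth_trig_approx : translation_bounded (@Cc_smooth R d) mu ->
  forall phi, Cc_smooth phi -> trig_approx (Defs.conv mu phi).
Proof.
move=> H phi pC; have [a aP] := poisson_spectrum.
have [HT muT] := tempered_extP.
have E1 psi : Cc_smooth psi -> Defs.conv mu psi = Defs.conv (tempered_ext mu) psi.
  by move=> sC; apply: (conv_agree muT) => t; exact: Cc_smooth_reflect.
rewrite E1//; apply: (conv_trig_approx HT aP); first exact: Cc_smooth_schwartz.
  by rewrite -E1//; apply/bounded_imageP/H.
by move=> i; have iC := Cc_smooth_partials [:: i] pC; rewrite -E1//; apply/bounded_imageP/H.
Qed.

Lemma poisson_Cc_smooth : strongly_almost_periodic (@Cc_smooth R d) mu <->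
  translation_bounded (@Cc_smooth R d) mu.
Proof.
split=> [H phi /H[]//|H phi pC].
exact/trig_approx_bohr/poisson_Cc_smooth_trig_approx.
Qed.

End poisson_measure.
End almost_periodic_convolution.

(** * Translation-bounded measures *)

Section translation_bounded_measure.
Variables (R : realType) (d : nat).
Local Notation C := (Rcomplex R).
Local Notation E := 'rV[R]_d.
Implicit Types (f g h phi psi : E -> C) (x y z t k : E) (i : 'I_d) (s : seq 'I_d).

Lemma Cc_lin (c : C) f g : Cc f -> Cc g -> Cc (fun x => c * f x + g x).
Proof.
move=> [fc /compact_suppP[M fM]] [gc /compact_suppP[N gN]]; split.
  have cf : continuous (fun x => c * f x) by apply: continuousCM => //; exact: cst_continuous.
  by move=> x; exact: (cvgD (cf x) (gc x)).
apply/compact_suppP; exists (Num.max M N) => x; rewrite le_max.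
have [->|/fM ->//] := eqVneq (f x) 0.
by rewrite mulr0 add0r => /gN ->; rewrite orbT.
Qed.

Lemma Cc0 : Cc (fun _ : E => 0 : C).
Proof.
by split; [exact: cst_continuous|apply/compact_suppP; exists 0 => x; rewrite eqxx].
Qed.

Lemma Cc_reflect f t : Cc f -> Cc (fun x => f (t - x)).
Proof.
have N1 : -1 != 0 :> R by rewrite oppr_eq0 oner_neq0.
have -> : (fun x => f (t - x)) = (fun x => f (t + (-1) *: x)).
  by apply/funext => x; rewrite scaleN1r.
move=> [fc fs]; split; last exact: compact_supp_affine.
move=> x; apply: (@continuous_comp _ _ _ (fun x => t + (-1) *: x)); last exact: fc.
exact: (cvgD (cvg_cst t) (cvgZl_tmp (k := -1) cvg_id)).
Qed.

Lemma supnorm_reflect f t : supnorm (fun x => f (t - x)) = supnorm f.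
Proof.
congr sup; apply/seteqP; split => _ [x _ <-]; first by exists (t - x).
by exists (t - x) => //; rewrite opprB addrC subrK.
Qed.

(** The intervals with centre [a n] and radius [2 * del n] are nested, because
    [del n + 2 * del n.+1 <= 2 * del n]; the supremum of their left ends lies in all of them. *)
Lemma nested_limit (a del : nat -> R) : (forall n, 2 * del n.+1 <= del n) ->
  (forall n, `|a n.+1 - a n| <= del n) -> exists l, forall n, `|l - a n| <= 2 * del n.
Proof.
move=> dS aS.
have d0 n : 0 <= del n by apply: le_trans (aS n).
have up n : a n.+1 + 2 * del n.+1 <= a n + 2 * del n.
  by have := aS n; rewrite ler_norml => /andP[_]; have := dS n; lra.
have lo n : a n - 2 * del n <= a n.+1 - 2 * del n.+1.
  by have := aS n; rewrite ler_norml => /andP[+ _]; have := dS n; lra.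
have upm n (k : nat) : a (n + k)%N + 2 * del (n + k)%N <= a n + 2 * del n.
  elim: k => [|k ih]; first by rewrite addn0.
  by rewrite addnS (le_trans (up _)).
have lom n (k : nat) : a n - 2 * del n <= a (n + k)%N - 2 * del (n + k)%N.
  elim: k => [|k ih]; first by rewrite addn0.
  by rewrite addnS (le_trans ih).
have cross n m : a n - 2 * del n <= a m + 2 * del m.
  apply: le_trans (lom n m) _; rewrite addnC; apply: le_trans (upm m n).
  by have := d0 (m + n)%N; lra.
exists (sup (range (fun n => a n - 2 * del n))) => n.
have sl : a n - 2 * del n <= sup (range (fun n => a n - 2 * del n)).
  apply: ub_le_sup; last by exists n.
  by exists (a n + 2 * del n) => _ [m _ <-].
have su : sup (range (fun n => a n - 2 * del n)) <= a n + 2 * del n.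
  apply: ge_sup; first by exists (a 0%N - 2 * del 0%N); exists 0%N.
  by move=> _ [m _ <-].
by rewrite ler_norml; apply/andP; split; lra.
Qed.

(** Completeness of the continuous functions supported in a fixed ball, in the quantitative form
    that the gliding hump needs. The 4 is 2 for the real part plus 2 for the imaginary part. *)
Lemma nested_Cc_limit (M : R) (x_ : nat -> E -> C) (del : nat -> R) :
  (forall n, 2 * del n.+1 <= del n) -> (forall n, 0 < del n) ->
  (forall n, Cc (x_ n)) -> (forall n y, x_ n y != 0 -> `|y| <= M) ->
  (forall n y, `|x_ n.+1 y - x_ n y| <= del n) ->
  exists f, [/\ Cc f, forall y, f y != 0 -> `|y| <= M & forall n y, `|f y - x_ n y| <= 4 * del n].
Proof.
move=> dS d0 xC xM xS.
have /choice[l lP] : forall y, exists v : R, forall n, `|v - cre (x_ n y)| <= 2 * del n.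
  move=> y; apply: (@nested_limit (fun n => cre (x_ n y))) => // n.
  by rewrite -creB (le_trans (cre_le _)).
have /choice[m mP] : forall y, exists v : R, forall n, `|v - cim (x_ n y)| <= 2 * del n.
  move=> y; apply: (@nested_limit (fun n => cim (x_ n y))) => // n.
  by rewrite -cimB (le_trans (cim_le _)).
pose f y : C := Complex (l y) (m y).
have fx n y : `|f y - x_ n y| <= 4 * del n.
  apply: (le_trans (cnorm_le _)); rewrite creB cimB.
  by have := lP y n; have := mP y n; rewrite /f /cre /cim/=; lra.
have small e : 0 < e -> exists n, del n <= e.
  (* The halving of [del] makes [n.+1 * del n] nonincreasing, since [n + 2 <= 2 * (n + 1)]; this
     decay is enough. *)
  move=> e0; have dn n : n.+1%:R * del n <= del 0%N.
    elim: n => [|n ih]; first by rewrite mul1r.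
    apply: le_trans ih; apply: (@le_trans _ _ (n.+1%:R * (2 * del n.+1))).
      by rewrite mulrA ler_wpM2r ?(ltW (d0 _))// -natrM ler_nat muln2 -addnn addnS ltnS leq_addr.
    by rewrite ler_wpM2l.
  exists (Num.truncn (del 0%N / e)); set N := Num.truncn _.
  have N0 : 0 < N.+1%:R :> R by rewrite ltr0n.
  rewrite -(ler_pM2l N0) (le_trans (dn N))// -ler_pdivrMr// ltW//; exact: truncnS_gt.
have fM y : f y != 0 -> `|y| <= M.
  apply: contraNT => yM; rewrite -normr_eq0 eq_le normr_ge0 andbT.
  apply/ler_addgt0Pr => e e0; rewrite add0r.
  have [n ne] := small _ (divr_gt0 e0 (ltr0n _ 4)).
  have := fx n y; have -> : x_ n y = 0 by apply/eqP; apply: contraNT yM; exact: xM.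
  by rewrite subr0 => /le_trans; apply; move: ne; lra.
exists f; split => //; split; last by apply/compact_suppP; exists M.
move=> y; apply/(@cvgrPdist_le _ _ _ (nbhs y) (nbhs_filter y)) => e e0.
have [n ne] := small _ (divr_gt0 e0 (ltr0n _ 12)).
have e30 : 0 < e / 3 by rewrite divr_gt0.
have := (xC n).1 y => /(@cvgrPdist_le _ _ _ (nbhs y) (nbhs_filter y))/(_ _ e30).
apply: filterS => z yz.
have -> : f y - f z = (f y - x_ n y) + (x_ n y - x_ n z) - (f z - x_ n z).
  by rewrite opprB addrA [_ - _ + (_ - _)]addrA !subrK.
have := ler_normB (f y - x_ n y + (x_ n y - x_ n z)) (f z - x_ n z).
have := ler_normD (f y - x_ n y) (x_ n y - x_ n z).
by have := fx n y; have := fx n z; move: yz ne; lra.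
Qed.

(** Compactness of the ball of radius [M + 1] gives a common [r] there. Farther out both values
    vanish, because a shift of length at most [r <= 1] cannot reach the support. *)
Lemma Cc_uniformly_continuous phi (e : R) : Cc phi -> 0 < e ->
  exists2 r : R, 0 < r <= 1 & forall x z, `|z| <= 1 -> `|phi (x - r *: z) - phi x| <= e.
Proof.
move=> [pc /compact_suppP[M pM]] e0.
have := @compact_normball R d (M + 1); rewrite compact_near_coveringP => H.
pose P (r : R) x := forall z, `|z| <= 1 -> `|phi (x - r *: z) - phi x| <= e.
have near0 : \forall r \near (0 : R), [set x : E | `|x| <= M + 1] `<=` P r.
  apply: (H _ _ P (nbhs_filter (0 : R))) => x _; have e20 : 0 < e / 2 by rewrite divr_gt0.
  have := pc x => /(@cvgrPdist_le _ _ _ (nbhs x) (nbhs_filter x))/(_ _ e20).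
  move=> /nbhs_ballP[del /= del0 delP].
  have del20 : 0 < del / 2 by rewrite divr_gt0.
  exists (ball x (del / 2), ball (0 : R) (del / 2)).
    by split; exact: nbhsx_ballx.
  move=> [y r] /= [xy r0] z z1.
  have r0' : `|r| < del / 2 by move: r0; rewrite -ball_normE /ball_/= sub0r normrN.
  have xy' : `|x - y| < del / 2 by move: xy; rewrite -ball_normE.
  have d1 : `|phi x - phi y| <= e / 2.
    by apply: delP; rewrite -ball_normE /ball_/= (lt_trans xy')// ltr_pdivrMr// mulr_natr mulr2n ltrDl.
  have d2 : `|phi x - phi (y - r *: z)| <= e / 2.
    apply: delP; rewrite -ball_normE /ball_/= opprB addrCA addrC.
    apply: (le_lt_trans (ler_normD _ _)); rewrite [del]splitr ltr_leD// normrZ.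
    by apply: (@le_trans _ _ `|r|); [rewrite ler_piMr|exact: ltW].
  have -> : phi (y - r *: z) - phi y = (phi x - phi y) - (phi x - phi (y - r *: z)).
    by rewrite opprB [RHS]addrC addrA subrK.
  by apply: (le_trans (ler_normB _ _)); move: d1 d2; lra.
have [r r0 rP] : exists2 r : R, 0 < r <= 1 & [set x : E | `|x| <= M + 1] `<=` P r.
  have /nbhs_ballP[del /= del0 delP] := near0.
  exists (Num.min 1 (del / 2)).
    by rewrite lt_min ltr01 divr_gt0//= ge_min lexx.
  apply: delP; rewrite -ball_normE /ball_/= sub0r normrN gtr0_norm ?lt_min ?ltr01 ?divr_gt0//.
  by rewrite gt_min ltr_pdivrMr// mulr_natr mulr2n ltrDl del0 orbT.
exists r => // x z z1; have [xM|xM] := leP `|x| (M + 1); first exact: rP.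
have -> : phi x = 0.
  by apply/eqP; apply: contraTT xM => /pM; rewrite -leNgt => /le_trans; apply; rewrite lerDl.
have -> : phi (x - r *: z) = 0; last by rewrite subrr normr0 ltW.
apply/eqP; apply: contraTT xM => /pM xrM; rewrite -leNgt.
have := ler_normD (x - r *: z) (r *: z); rewrite subrK => /le_trans; apply; apply: lerD => //.
have /andP[r1 r2] := r0; by rewrite normrZ gtr0_norm// mulr_ile1// ltW.
Qed.

(** * A uniform bound for convolutions with a translation-bounded measure *)

Section uniform_boundedness.
Variable mu : functional R d.
Hypothesis Rmu : radon_measure mu.
Hypothesis Tmu : translation_bounded (@Cc R d) mu.

Lemma conv_lin (c : C) f g t : Cc f -> Cc g ->
  Defs.conv mu (fun x => c * f x + g x) t = c * Defs.conv mu f t + Defs.conv mu g t.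
Proof. by move=> fC gC; apply: Rmu.1; exact: Cc_reflect. Qed.

(* Gliding hump: otherwise a rapidly decreasing sum of functions [p_n], each
   chosen with a large convolution at some point [t_n], would have an unbounded
   convolution. *)
Lemma conv_uniform_bound (M : R) : exists c : R, forall psi (b : R) t, Cc psi ->
  (forall y, psi y != 0 -> `|y| <= M) -> (forall y, `|psi y| <= b) ->
  `|Defs.conv mu psi t| <= c * b.
Proof.
(* For a single [t] the bound is the Radon property on the ball of radius [|t| + M]; the issue is
   uniformity in [t]. *)
have /choice[c cP] t : exists c : R, 0 <= c /\ forall psi (b : R), Cc psi ->
    (forall y, psi y != 0 -> `|y| <= M) -> (forall y, `|psi y| <= b) ->
    `|Defs.conv mu psi t| <= c * b.
  have [c cP] := Rmu.2 _ (@compact_normball R d (`|t| + M)).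
  exists `|c|; split => // psi b pC pM pb.
  apply: (@le_trans _ _ (`|c| * supnorm psi)); last by rewrite ler_wpM2l//; exact: supnorm_le.
  rewrite -(supnorm_reflect psi t); apply: (le_trans (cP _ _ _)).
  - exact: Cc_reflect.
  - apply: supp_normball => x /pM xM.
    have := ler_normB t (t - x); rewrite opprB addrCA subrr addr0 => /le_trans; apply.
    by rewrite lerD2l.
  rewrite ler_wpM2r ?ler_norm//; apply: le_trans (normr_ge0 _) (le_supnorm 0 _).
  by exists b.
have /choice[B BP] psi : exists B : R, Cc psi -> 0 <= B /\ forall t, `|Defs.conv mu psi t| <= B.
  have [pC|npC] := pselect (Cc psi); last by exists 0 => /npC.
  have /bounded_imageP[B BP] := Tmu pC; exists B => _; split => //.
  exact: le_trans (BP 0).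
apply: contrapT => unb.
(* If no normalised function reached size [K], dividing by [b] would make [|K|] the desired
   constant; for [b = 0] the bound at the single point [t] already settles the case. *)
have /choice[p pP] K : exists p : (E -> C) * E, [/\ Cc p.1, forall y, p.1 y != 0 -> `|y| <= M,
    forall y, `|p.1 y| <= 1 & K <= `|Defs.conv mu p.1 p.2|].
  apply: contrapT => nK; apply: unb; exists `|K| => psi b t pC pM pb.
  have b0 : 0 <= b by apply: le_trans (pb 0).
  have [b00|bn0] := eqVneq b 0.
    by have := (cP t).2 psi b pC pM pb; rewrite b00 !mulr0.
  have bp : 0 < b by rewrite lt_neqAle eq_sym bn0.
  rewrite leNgt; apply/negP => Kb; apply: nK.
  have p0 : (fun x => cofr b^-1 * psi x) = (fun x => cofr b^-1 * psi x + (fun=> 0 : C) x).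
    by apply/funext => x; rewrite addr0.
  exists ((fun x => cofr b^-1 * psi x), t); split => /=.
  - by rewrite p0; apply: Cc_lin => //; exact: Cc0.
  - by move=> y yn; apply: pM; apply: contraNneq yn => ->; rewrite mulr0.
  - by move=> y; rewrite cnormM cnorm_cofr normfV gtr0_norm// ler_pdivrMl// mulr1.
  rewrite p0 conv_lin//; last exact: Cc0.
  have -> : Defs.conv mu (fun=> 0) t = 0.
    have := conv_lin (-1) t Cc0 Cc0; under eq_fun do rewrite mulr0 addr0.
    by rewrite mulN1r addrC subrr.
  rewrite addr0 cnormM cnorm_cofr normfV gtr0_norm// ler_pdivlMl// mulrC.
  by apply: le_trans (ltW Kb); rewrite ler_wpM2r// ler_norm.
(* The hump, of height [s.2], is to have convolution at least [n + B s.1 + 1] at its point [q.2]: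
   [B s.1] outweighs the previous partial sum, 1 the later humps, and [n] remains. The new height is
   at most half the old one for convergence, and at most [1 / (4 * (c q.2 + 1))] so that later humps
   contribute at most 1 at [q.2]. *)
pose step n (s : (E -> C) * R) : (E -> C) * R :=
  let q := p ((n%:R + B s.1 + 1) / s.2) in
  (fun y => cofr s.2 * q.1 y + s.1 y, Num.min (s.2 / 2) (4 * (c q.2 + 1))^-1).
pose st n := iteri n step (fun=> 0, 1).
pose x_ n := (st n).1; pose del n := (st n).2.
pose q n := p ((n%:R + B (x_ n) + 1) / del n).
have xE n : x_ n.+1 = fun y => cofr (del n) * (q n).1 y + x_ n y by [].
have delE n : del n.+1 = Num.min (del n / 2) (4 * (c (q n).2 + 1))^-1 by [].
have cq n : 0 < c (q n).2 + 1 by rewrite ltr_wpDl//; exact: (cP _).1.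
have d0 n : 0 < del n.
  by elim: n => // n ih; rewrite delE lt_min divr_gt0//= invr_gt0 mulr_gt0.
have dS n : 2 * del n.+1 <= del n.
  by rewrite mulrC -ler_pdivlMr// delE ge_min lexx.
have xC n : Cc (x_ n).
  elim: n => [|n ih]; first exact: Cc0.
  by rewrite xE; apply: Cc_lin => //; have [] := pP ((n%:R + B (x_ n) + 1) / del n).
have xM n y : x_ n y != 0 -> `|y| <= M.
  elim: n => [|n ih]; first by rewrite /x_/= eqxx.
  rewrite xE; have [->|qn _] := eqVneq ((q n).1 y) 0; first by rewrite mulr0 add0r.
  by have [_ + _ _] := pP ((n%:R + B (x_ n) + 1) / del n); apply.
have xS n y : `|x_ n.+1 y - x_ n y| <= del n.
  rewrite xE addrK cnormM cnorm_cofr gtr0_norm// ler_piMr//; first exact: ltW.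
  by have [_ _ + _] := pP ((n%:R + B (x_ n) + 1) / del n); apply.
have [f [fC fM fx]] := nested_Cc_limit dS d0 xC xM xS.
(* Since [n.+1] exceeds the bound [B f] of the convolution with the limit, the hump of index [n.+1]
   gives the contradiction. *)
have [B0 fB] := BP _ fC; set n := Num.truncn (B f).
have nB : B f < n.+1%:R by exact: truncnS_gt.
pose t := (q n.+1).2.
have [qC _ _ qK] := pP ((n.+1%:R + B (x_ n.+1) + 1) / del n.+1).
have N1 := conv_lin (-1) t (xC n.+2) fC.
have N2 : Defs.conv mu (x_ n.+2) t = cofr (del n.+1) * Defs.conv mu (q n.+1).1 t + Defs.conv mu (x_ n.+1) t.
  by rewrite xE conv_lin.
have N3 : `|Defs.conv mu (fun y => -1 * x_ n.+2 y + f y) t| <= 1.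
  apply: (le_trans ((cP t).2 _ (4 * del n.+2) _ _ _)).
  - exact: Cc_lin.
  - move=> y; have [->|/fM//] := eqVneq (f y) 0.
    by rewrite addr0 mulN1r oppr_eq0; exact: xM.
  - by move=> y; rewrite mulN1r addrC.
  have : del n.+2 <= (4 * (c t + 1))^-1 by rewrite delE ge_min lexx orbT.
  move=> dc; apply: (@le_trans _ _ (c t * (4 * (4 * (c t + 1))^-1))).
    by rewrite ler_wpM2l ?(cP t).1// ler_wpM2l.
  have ct : 0 < c t + 1 := cq n.+1.
  have -> : 4 / (4 * (c t + 1)) = (c t + 1)^-1 by rewrite invfM mulrA divff ?mul1r.
  by rewrite ler_pdivrMr// mul1r lerDl.
have [Bn0 xB] := BP _ (xC n.+1).
have N4 : n.+1%:R + B (x_ n.+1) + 1 <= `|cofr (del n.+1) * Defs.conv mu (q n.+1).1 t : C|.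
  by rewrite cnormM cnorm_cofr gtr0_norm// mulrC -ler_pdivrMr.
have N5 : cofr (del n.+1) * Defs.conv mu (q n.+1).1 t =
    Defs.conv mu f t - Defs.conv mu (fun y => -1 * x_ n.+2 y + f y) t - Defs.conv mu (x_ n.+1) t.
  by rewrite N1 N2 mulN1r; ring.
rewrite N5 in N4.
have := ler_normB (Defs.conv mu f t - Defs.conv mu (fun y => -1 * x_ n.+2 y + f y) t) (Defs.conv mu (x_ n.+1) t).
have := ler_normB (Defs.conv mu f t) (Defs.conv mu (fun y => -1 * x_ n.+2 y + f y) t).
have := fB t; have := xB t; move: N3 N4 nB; lra.
Qed.

End uniform_boundedness.

(** The radius [M] is fixed before the precision [e], so that one constant of [conv_uniform_bound]
    serves all approximations. The mollifier here has support in the unit ball, and [r <= 1]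
    enlarges the support by at most 1. *)
Lemma Cc_smooth_approx phi : Cc phi -> exists M : R, forall e : R, 0 < e ->
  exists psi, [/\ Cc_smooth psi, forall x, psi x - phi x != 0 -> `|x| <= M &
    forall x, `|psi x - phi x| <= e].
Proof.
move=> pC; have [pc /compact_suppP[M pM]] := pC; exists (M + 1) => e e0.
have [b [bC b0 bpos b00 b1]] := smooth_bump R d.
have bi := rapid_citg (Cc_rapid (Cc_smooth_Cc bC)).
pose eta x : C := (cintegral_rV b)^-1 * b x.
have etaC : Cc_smooth eta by apply: Cc_smoothM => //; exact: smooth_cst.
have etar := Cc_rapid (Cc_smooth_Cc etaC).
have bne : cintegral_rV b != 0.
  have : 0 < cre (cintegral_rV b).
    have [bir _] := bi; apply: (@integral_rV_gt0 _ _ _ 0) => //.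
    by have /continuousCP[] := (Cc_smooth_Cc bC).1.
  by apply: contraTneq => ->; rewrite ltxx.
have eta1 : cintegral_rV eta = 1 by rewrite /eta cintM// mulVf.
have eta0 x : eta x != 0 -> `|x| <= 1.
  by move=> ex; apply: b1; apply: contraNneq ex => bx0; rewrite /eta bx0 mulr0.
pose I := integral_rV (fun z => `|eta z|).
have I0 : 0 <= I by apply: integral_rV_ge0.
(* The oscillation of [phi] gets multiplied by [I], and by 2 in [norm_cint]. *)
have eI : 0 < e / (2 * (I + 1)) by rewrite divr_gt0// mulr_gt0// ltr_wpDl.
have [r /andP[r0 r1] rP] := Cc_uniformly_continuous pC eI.
have rn0 : r != 0 by rewrite gt_eqF.
have pb := Cc_bounded pC.
have mi x : citg (fun z => phi (x - r *: z) * eta z) by exact: mollify_citg.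
have ei x : citg (fun z => phi x * eta z) by exact/citgM/rapid_citg.
have diff x : mollify r eta phi x - phi x =
    cintegral_rV (fun z => (phi (x - r *: z) - phi x) * eta z).
  transitivity (cintegral_rV (fun z => phi (x - r *: z) * eta z - phi x * eta z)).
    by rewrite cintB// cintM ?eta1 ?mulr1//; exact: rapid_citg.
  by congr cintegral_rV; apply/funext => z; rewrite mulrBl.
have mM x : mollify r eta phi x != 0 -> `|x| <= M + 1.
  apply: contraNT; rewrite -ltNge => xM; rewrite /mollify.
  rewrite (_ : (fun z => _) = fun=> 0 * 0); last first.
    apply/funext => z; have [->|/eta0 z1] := eqVneq (eta z) 0; first by rewrite !mulr0.
    rewrite (_ : phi _ = 0) ?mul0r//; apply/eqP; apply: contraTT xM => /pM xrM; rewrite -leNgt.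
    have := ler_normD (x - r *: z) (r *: z); rewrite subrK => /le_trans; apply; apply: lerD => //.
    by rewrite normrZ gtr0_norm// mulr_ile1// ltW.
  by rewrite cintM ?mul0r//; exact/rapid_citg/Cc_rapid/Cc0.
exists (mollify r eta phi); split.
- split; last by apply/compact_suppP; exists (M + 1).
  (* As [phi] is merely continuous, derivatives must fall on the mollifier: a change of variables
     exchanges the roles and writes the function as the mollification of [k], the rescaled [eta], by
     [phi] at scale 1. *)
  pose k x : C := cofr (r ^+ d)^-1 * eta (0 + r^-1 *: x).
  have kC : Cc_smooth k.
    apply: Cc_smoothM; first exact: smooth_cst.
    by apply: Cc_smooth_affine => //; rewrite invr_eq0.
  have [+ _] := mollify_smooth 1 (Cc_rapid pC) (schwartz_bsmooth (Cc_smooth_schwartz kC)).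
  congr smooth; apply/funext => x.
  have Fi : citg (fun w => phi w * eta (r^-1 *: x - r^-1 *: w)).
    have etac := (Cc_smooth_Cc etaC).1; have [B etaB] := Cc_bounded (Cc_smooth_Cc etaC).
    apply: (citg_le _ (itgZ B (rapid_norm (Cc_rapid pC)))).
      by apply/cmes_continuous/continuousCM => //; exact: comp_affine_continuous.
    by move=> w; rewrite cnormM mulrC ler_wpM2r.
  have nr0 : - r != 0 by rewrite oppr_eq0.
  have [Fi' H] := cint_affine x nr0 Fi; rewrite normrN gtr0_norm// in H.
  transitivity (cofr (r ^+ d)^-1 * cintegral_rV (fun w => phi w * eta (r^-1 *: x - r^-1 *: w))).
    rewrite -cintM//; congr cintegral_rV; apply/funext => z.
    by rewrite /k scale1r add0r scalerBr -mulrA [eta _ * _]mulrC.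
  rewrite cofrM -H; congr cintegral_rV; apply/funext => z; rewrite scaleNr; congr (_ * eta _).
  by rewrite -scalerBr opprB addrC subrK scalerA mulVf// scale1r.
- move=> x; have [->|/pM] := eqVneq (phi x) 0; first by rewrite subr0; exact: mM.
  by move=> xM _; rewrite (le_trans xM)// lerDl.
move=> x; rewrite diff.
have ni : itg (fun z => e / (2 * (I + 1)) * `|eta z|) by exact/itgZ/rapid_norm.
apply: (@le_trans _ _ (2 * integral_rV (fun z => e / (2 * (I + 1)) * `|eta z|))).
  apply: norm_cint => //.
    have := citgD (mi x) (citgM (-1) (ei x)).
    by congr citg; apply/funext => z; rewrite mulN1r mulrBl.
  move=> z; rewrite cnormM; have [->|/eta0 z1] := eqVneq (eta z) 0; first by rewrite normr0 !mulr0.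
  by rewrite ler_wpM2r//; exact: rP.
rewrite integral_rVZ; last exact: rapid_norm.
rewrite -/I; clearbody I; have I1 : I + 1 != 0 by rewrite gt_eqF// ltr_wpDl.
have -> : 2 * (e / (2 * (I + 1)) * I) = e * I / (I + 1) by field.
rewrite ler_pdivrMr ?ltr_wpDl//.
by rewrite ler_wpM2l ?lerDl// ltW.
Qed.

(** Approximating [phi] within [e / (|c| + 1)] by smooth functions supported near it, the uniform
    bound [c] makes the convolutions differ by at most [e] everywhere, so [mu * phi] inherits
    approximation by trigonometric polynomials from the smooth case. *)
Lemma poisson_Cc (mu : functional R d) : poisson_measure mu ->
  strongly_almost_periodic (@Cc R d) mu <-> translation_bounded (@Cc R d) mu.
Proof.
move=> Hmu; split=> [H phi /H[]//|Tmu phi pC].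
have [[Rmu _] _ _] := Hmu.
apply: trig_approx_bohr; apply: trig_approx_limit => e e0.
have [M pM] := Cc_smooth_approx pC.
have [c cP] := conv_uniform_bound Rmu Tmu M.
have c0 : 0 < `|c| + 1 by rewrite ltr_wpDl.
have [psi [sC sM sb]] := pM _ (divr_gt0 e0 c0).
exists (Defs.conv mu psi).
  by apply: poisson_Cc_smooth_trig_approx => // f /Cc_smooth_Cc; exact: Tmu.
move=> t; have sC' := Cc_smooth_Cc sC.
have E1 : (fun x => psi x - phi x) = (fun x => -1 * phi x + psi x).
  by apply/funext => x; rewrite mulN1r addrC.
have dC : Cc (fun x => psi x - phi x) by rewrite E1; exact: Cc_lin.
have := cP _ _ t dC sM sb; rewrite E1 conv_lin// mulN1r addrC distrC => /le_trans; apply.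
apply: (@le_trans _ _ (`|c| * (e / (`|c| + 1)))).
  by rewrite ler_wpM2r ?ler_norm// divr_ge0// ltW.
by rewrite mulrA ler_pdivrMr// mulrC ler_wpM2l ?lerDl// ltW.
Qed.

End translation_bounded_measure.

Theorem theorem3p9 (R : realType) (d : nat) (mu : functional R d)
    (hmu : poisson_measure mu) :
  [/\ strongly_almost_periodic (@Cc_smooth R d) mu <->
        translation_bounded (@Cc_smooth R d) mu,
      strongly_almost_periodic (@schwartz R d) (tempered_ext mu) <->
        translation_bounded (@schwartz R d) (tempered_ext mu)
    & strongly_almost_periodic (@Cc R d) mu <->
        translation_bounded (@Cc R d) mu].
Proof.
split.
- exact: poisson_Cc_smooth.
- exact: poisson_schwartz.
- exact: poisson_Cc.
Qed.
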